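(* Let $K\subset\mathbb{C}$ be a compact set with $0<c(K)<1$. (a) Then $M(K)<1$. (b) Furthermore, if $c(K)\in(\frac12,1)$ and $K$ is either the closure of a bounded Jordan domain or a $C^2$ Jordan arc, then $m(K)>0$. (c) If $c(K)\le\frac14$ and $K$ is connected, then $\mathscr{C}_n(K)=1$ for all $n\in\mathbb{N}$ (with $n \geq 1$). Consequently $m(K)=0$.
   Context: For a compact set $K\subset\mathbb{C}$, the logarithmic capacity $c(K)$ is defined by $\log c(K)=\sup_{\mu}\int_K\int_K\log|z-w|\,d\mu(z)\,d\mu(w)$, the supremum being over all Borel probability measures $\mu$ on $K$. For $n\ge1$, $\mathscr{P}_n(K)$ is the set of monic complex polynomials $p(z)=\prod_{j=1}^n(z-z_j)$ of degree $n$ with all zeros $z_j\in K$. For a polynomial $p$, $\Lambda_p=\{z\in\mathbb{C}:|p(z)|<1\}$ and $\mathcal{C}(\Lambda_p)$ is the number of connected components of $\Lambda_p$ (at most $\deg p$). Put $\mathscr{C}_n(K)=\max_{p\in\mathscr{P}_n(K)}\mathcal{C}(\Lambda_p)$, $M(K)=\limsup_{n\to\infty}\mathscr{C}_n(K)/n$ and $m(K)=\liminf_{n\to\infty}\mathscr{C}_n(K)/n$. A bounded Jordan domain is the bounded component of the complement of a Jordan curve. *)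

(* Defs.v *)
From HB Require Import structures.
From mathcomp Require Import all_boot all_order all_algebra.
From mathcomp Require Import all_classical all_reals all_analysis.
From mathcomp Require Import complex.

Set Implicit Arguments.
Unset Strict Implicit.
Unset Printing Implicit Defensive.
Import Order.TTheory GRing.Theory Num.Theory.
Import numFieldNormedType.Exports.
Local Open Scope classical_set_scope.
Local Open Scope ring_scope.

(* The named head [complexes R] (instead of [R[i]]) lets the topology that the
   library puts on every numClosedFieldType be inferred. *)
Definition complexes (R : realType) : numClosedFieldType := R[i].

Definition ofreal {R : realType} (t : R) : complexes R := real_complex R t.

(* The norm of the numClosedFieldType is valued in the complex numbers;
   this is the same modulus as a real number. *)
Definition modulus {R : realType} (z : complexes R) : R :=
  complex.Re (`|z| : R[i]).

Definition borel_complexes (R : realType) :=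
  g_sigma_algebraType [set U : set (complexes R) | open U].

(* [lne] is the extended logarithm, so the integrand is -oo on the diagonal;
   it is bounded above on a compact [K], so the integrals are well defined. *)
Definition log_energy (R : realType) (K : set (complexes R))
    (mu : probability (borel_complexes R) R) : \bar R :=
  (\int[mu]_(z in K) \int[mu]_(w in K)
     lne (modulus ((z : complexes R) - (w : complexes R)))%:E)%E.

(* A Borel probability measure on [K] is a Borel probability measure on the
   plane giving mass 1 to [K]. *)
Definition log_capacity (R : realType) (K : set (complexes R)) : \bar R :=
  expeR (ereal_sup [set log_energy K mu |
    mu in [set mu : probability (borel_complexes R) R | mu K = 1%E]]).

Definition monic_with_zeros_in (R : realType) (n : nat)
    (K : set (complexes R)) : set {poly complexes R} :=
  [set p | exists2 z : 'I_n -> complexes R,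
     forall j, K (z j) & p = \prod_(j < n) ('X - (z j)%:P)].

Definition lemniscate (R : realType) (p : {poly complexes R}) :
    set (complexes R) :=
  [set z | `|p.[z]| < 1].

Definition components (T : topologicalType) (A : set T) : set (set T) :=
  [set connected_component A x | x in A].

(* [counting] is the number of elements, +oo for an infinite set. *)
Definition nb_components (R : realType) (p : {poly complexes R}) : \bar R :=
  counting (components (lemniscate p)).

(* For nonempty [K] and n >= 1 this is the supremum of a nonempty set of
   integers bounded by [n], hence a maximum. *)
Definition max_components (R : realType) (n : nat) (K : set (complexes R)) :
    \bar R :=
  ereal_sup [set nb_components p | p in monic_with_zeros_in n K].

Definition component_ratio (R : realType) (K : set (complexes R)) :
    (\bar R)^nat :=
  fun n => (max_components n K * (n%:R^-1)%:E)%E.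

Definition limsup_ratio (R : realType) (K : set (complexes R)) : \bar R :=
  limn_esup (component_ratio K).

Definition liminf_ratio (R : realType) (K : set (complexes R)) : \bar R :=
  limn_einf (component_ratio K).

Definition jordan_curve (R : realType) (J : set (complexes R)) : Prop :=
  exists gamma : R -> complexes R,
    [/\ {within `[0, 1], continuous gamma},
        gamma 0 = gamma 1,
        {in `[0, 1[ &, injective gamma}
      & J = gamma @` `[0, 1]].

Definition bounded_jordan_domain (R : realType) (D : set (complexes R)) :
    Prop :=
  exists J : set (complexes R),
    [/\ jordan_curve J, components (~` J) D & bounded_set D].

(* One-sided at an endpoint of an interval [A]. *)
Definition has_derivative_on (R : realType) (A : set R)
    (f f' : R -> complexes R) : Prop :=
  forall t, A t ->
    (f s - f t) / ofreal (s - t) @[s --> within A t^'] --> f' t.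

(* "Of class C^2" refers, as usual for arcs, to a regular parametrization:
   without [gamma1 t != 0] corners and cusps would be allowed. *)
Definition C2_jordan_arc (R : realType) (K : set (complexes R)) : Prop :=
  exists gamma gamma1 gamma2 : R -> complexes R,
    [/\ has_derivative_on `[0, 1] gamma gamma1,
        has_derivative_on `[0, 1] gamma1 gamma2
      & {within `[0, 1], continuous gamma2}] /\
    [/\ {in `[0, 1], forall t, gamma1 t != 0},
        {in `[0, 1] &, injective gamma}
      & K = gamma @` `[0, 1]].

(* Main.v *)
Require Import Defs.
From HB Require Import structures.
From mathcomp Require Import all_boot all_order all_algebra.
From mathcomp Require Import all_classical all_reals all_analysis.
From mathcomp Require Import complex.
From mathcomp Require Import measurable_realfun perm.
From mathcomp Require Import ring lra zify.

Set Implicit Arguments.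
Unset Strict Implicit.
Unset Printing Implicit Defensive.
Import Order.TTheory GRing.Theory Num.Theory.
Import numFieldNormedType.Exports.
Local Open Scope classical_set_scope.
Local Open Scope ring_scope.

(** The capacity of [K] is its transfinite diameter, and the proof uses the two
    halves of this fact, stated for [pairprod z n], the product of the distances
    between the pairs among [n] points.  If [C < c(K)], then for every [n] some
    [n] points of [K] have [C ^ binomial(n, 2) <= pairprod]
    ([points_of_capacity]): independent random points drawn from a measure of
    energy above [log C] do so on average.  Conversely, if such points exist for
    arbitrarily large [n], then [C <= c(K)] ([log_capacity_ge]): the uniform
    measures on these points accumulate at a measure of energy at least [log C].

    Part (a).  By the minimum modulus principle every component of the
    lemniscate of [p] contains a zero; choose one in each of the [r] components.
    On the component [G] of a chosen zero [z_i], apply the principle to the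
    product [f] of the factors of [p] whose zeros lie outside [G].  At a boundary
    point [|p| = 1], and each of the other factors of [p] is at most
    a constant [Rad] that depends on [K], so [|f(z_i)|] is bounded below
    ([other_roots_lower_bound]).  The product over the chosen zeros bounds the
    square of their [pairprod] below by [Rad ^ -(n + r (n - r))]
    ([reps_pairprod]).  When [c(K) < C < 1] this square is also at most
    [C ^ (r (r - 1))] for large [r], which is impossible if [n] is large and
    [r / n] is close to 1 ([limsup_ratio_lt1_pairprod]).

    Part (b).  A set of diameter at most 1 has capacity at most 1/2: some
    projection to a line divides the distances by at most 2 in geometric mean
    ([exists_direction]), and its image lies in an interval of length 1, of
    capacity 1/4 ([pairprod_interval]).  So [K] contains points [a] and [b] with
    [|a - b| > 1] ([diam_gt1]).  As [K] is connected, it contains points [z_j],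
    for [j < k], at equally spaced small distances from [b].  In
    [p = (X - a) ^ (n - k) * prod_j (X - z_j)] the first factor is exponentially
    large near [b]; when [n] is a large fixed multiple of [k] it outweighs the
    others on a circle around each [z_j], on which [|p| >= 1]
    ([large_on_circle]).  These circles separate the [z_j], and there are at
    least [k] components.

    Part (c).  A connected set with two points at distance [L] has capacity at
    least [L / 4], since its projection to the line through them covers an
    interval of length [L] ([leja_points]).  So [K] has diameter at most 1, and
    [|p| <= 1] on [K].  If [|p(w)| = 1] with [w] in [K], every zero is at
    distance exactly 1 from [w], and the directions from [w] to two zeros make an
    angle of at most 60 degrees; moving from [w] towards one zero then decreases
    the distances to all of them.  Hence the closure of a component that contains
    a zero meets [K] in a relatively open set, which is all of [K] by
    connectedness ([K_sub_closure]), and all zeros lie in one component. *)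

(** * The modulus and the topology of the complex plane *)

Section ModulusTheory.
Variable R : realType.
Implicit Types z w : complexes R.

Notation re z := (complex.Re (z : R[i])).
Notation im z := (complex.Im (z : R[i])).

Lemma modulusE z : modulus z = Num.sqrt (re z ^+ 2 + im z ^+ 2).
Proof. by rewrite /modulus normc_def. Qed.

Lemma normE z : `|z| = ofreal (modulus z).
Proof. by rewrite modulusE; exact: normc_def. Qed.

Lemma modulus_ge0 z : 0 <= modulus z.
Proof. by rewrite modulusE sqrtr_ge0. Qed.

Lemma ofrealI : injective (@ofreal R).
Proof. exact: complexI. Qed.

Lemma ofreal0 : @ofreal R 0 = 0. Proof. by []. Qed.
Lemma ofreal1 : @ofreal R 1 = 1. Proof. by []. Qed.

Lemma ofrealM (s t : R) : ofreal (s * t) = ofreal s * ofreal t.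
Proof. exact: (rmorphM (real_complex R)). Qed.

Lemma modulusM z w : modulus (z * w) = modulus z * modulus w.
Proof. by apply: ofrealI; rewrite -normE normrM !normE -rmorphM. Qed.

Lemma modulus0 : modulus (0 : complexes R) = 0.
Proof. by apply: ofrealI; rewrite -normE normr0. Qed.

Lemma modulus1 : modulus (1 : complexes R) = 1.
Proof. by apply: ofrealI; rewrite -normE normr1. Qed.

Lemma modulus_eq0 z : (modulus z == 0) = (z == 0).
Proof. by rewrite -[RHS]normr_eq0 normE -(inj_eq ofrealI). Qed.

Lemma modulus_gt0 z : (0 < modulus z) = (z != 0).
Proof. by rewrite lt_def modulus_eq0 modulus_ge0 andbT. Qed.

Lemma modulusN z : modulus (- z) = modulus z.
Proof. by apply: ofrealI; rewrite -!normE normrN. Qed.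

Lemma modulusBC z w : modulus (z - w) = modulus (w - z).
Proof. by rewrite -modulusN opprB. Qed.

Lemma modulusD z w : modulus (z + w) <= modulus z + modulus w.
Proof. by have := ler_normD z w; rewrite !normE -rmorphD lecR. Qed.

Lemma modulusB_le z w u : modulus (z - u) <= modulus (z - w) + modulus (w - u).
Proof. by rewrite -[z - u](subrKA w) modulusD. Qed.

Lemma modulus_ge_sub z w : modulus z - modulus w <= modulus (z - w).
Proof. by rewrite lerBlDr -{1}(subrK w z) modulusD. Qed.

Lemma modulus_ofreal (t : R) : modulus (ofreal t) = `|t|.
Proof. by rewrite modulusE /= expr0n addr0 sqrtr_sqr. Qed.

Lemma modulusV z : modulus z^-1 = (modulus z)^-1.
Proof. by apply: ofrealI; rewrite -!normE normfV normE; exact/esym/(fmorphV (real_complex R)). Qed.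

Lemma modulusX z n : modulus (z ^+ n) = modulus z ^+ n.
Proof. by apply: ofrealI; rewrite -!normE normrX normE; exact/esym/(rmorphXn (real_complex R)). Qed.

Lemma modulus_prod I (r : seq I) (P : pred I) (F : I -> complexes R) :
  modulus (\prod_(i <- r | P i) F i) = \prod_(i <- r | P i) modulus (F i).
Proof. apply: (@big_morph R (complexes R) (@modulus R) 1 *%R 1 *%R). exact: modulusM. exact: modulus1. Qed.

Lemma modulus_sum I (r : seq I) (P : pred I) (F : I -> complexes R) :
  modulus (\sum_(i <- r | P i) F i) <= \sum_(i <- r | P i) modulus (F i).
Proof.
elim/big_ind2: _ => [|x a y b hx hy|//]; first by rewrite modulus0.
by apply: (le_trans (modulusD _ _)); exact: lerD.
Qed.

Lemma modulus_sqr z : modulus z ^+ 2 = re z ^+ 2 + im z ^+ 2.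
Proof. by rewrite modulusE sqr_sqrtr // addr_ge0 // sqr_ge0. Qed.

Lemma normRe_le z : `|re z| <= modulus z.
Proof. by rewrite modulusE -sqrtr_sqr ler_wsqrtr // lerDl sqr_ge0. Qed.

Lemma normIm_le z : `|im z| <= modulus z.
Proof. by rewrite modulusE -sqrtr_sqr ler_wsqrtr // lerDr sqr_ge0. Qed.

Lemma modulus_le_ReIm z : modulus z <= `|re z| + `|im z|.
Proof.
rewrite modulusE -[leRHS]ger0_norm ?addr_ge0 // -sqrtr_sqr ler_wsqrtr //.
rewrite sqrrD !real_normK ?num_real // -addrA lerD2l lerDr.
by rewrite mulrn_wge0 ?mulr_ge0.
Qed.

Lemma nbhs_complexP z (A : set (complexes R)) :
  nbhs z A <-> exists2 e : R, 0 < e & forall w, modulus (z - w) < e -> A w.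
Proof.
split.
- move/nbhs_ballP => [e /= e0 sA].
  have [er ei] : 0 < re e /\ e = ofreal (re e).
    by move: e0; case: e {sA} => a b; rewrite ltcE /= => /andP[/eqP-> a0].
  exists (re e) => // w zw; apply: sA.
  by rewrite -ball_normE /= normE ei ltcR.
- move=> [e e0 sA]; apply/nbhs_ballP; exists (ofreal e) => /=.
    by rewrite ltcR.
  by move=> w; rewrite -ball_normE /= normE ltcR; exact: sA.
Qed.

Lemma open_complexP (A : set (complexes R)) :
  open A <-> forall z, A z -> exists2 e : R, 0 < e &
    forall w, modulus (z - w) < e -> A w.
Proof.
rewrite openE; split => [h z /h|h z /h]; first by move/nbhs_complexP.
by move=> ?; exact/nbhs_complexP.
Qed.

(** The metric of [complexes R] has complex radii; here the radius is real. *)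
Definition disc z (e : R) : set (complexes R) := [set w | modulus (z - w) < e].

Lemma open_disc z e : open (disc z e).
Proof.
apply/open_complexP => w zw; exists (e - modulus (z - w)).
  by rewrite subr_gt0.
move=> u wu; rewrite /disc /=.
by apply: (le_lt_trans (modulusB_le z w u)); rewrite addrC -ltrBrDr.
Qed.

Lemma disc_center z e : 0 < e -> disc z e z.
Proof. by move=> e0; rewrite /disc /= subrr modulus0. Qed.

Lemma nbhs_disc z (e : R) : 0 < e -> nbhs z (disc z e).
Proof. by move=> e0; apply/nbhs_complexP; exists e. Qed.

Lemma continuous_lip1 (f : complexes R -> R) :
  (forall z w, `|f z - f w| <= modulus (z - w)) -> continuous f.
Proof.
move=> h z A /nbhs_ballP[e /= e0 sA].
apply/nbhs_complexP; exists e => // w zw; apply: sA => /=.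
by rewrite -ball_normE /=; apply: le_lt_trans zw; exact: h.
Qed.

Lemma continuous_modulus : continuous (@modulus R).
Proof.
apply: continuous_lip1 => z w; rewrite ler_norml modulus_ge_sub andbT.
by rewrite lerNl opprB modulusBC modulus_ge_sub.
Qed.

Lemma continuous_re : continuous (fun z => re z).
Proof. by apply: continuous_lip1 => z w; have := normRe_le (z - w); rewrite raddfB. Qed.

Lemma continuous_im : continuous (fun z => im z).
Proof. by apply: continuous_lip1 => z w; have := normIm_le (z - w); rewrite raddfB. Qed.

Lemma continuous_ofreal : continuous (@ofreal R).
Proof.
move=> x A /nbhs_complexP[e e0 sA].
apply/nbhs_ballP; exists e => // y; rewrite -ball_normE /= => xy; apply: sA.
by rewrite -[_ - _](rmorphB (real_complex R)) -/(ofreal _) modulus_ofreal.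
Qed.

Lemma continuous_horner (p : {poly complexes R}) : continuous (fun z => p.[z]).
Proof.
elim/poly_ind: p => [|p c ih] z.
  have -> : (fun z : complexes R => (0 : {poly complexes R}).[z]) = cst 0.
    by apply/funext => u; rewrite horner0.
  exact: cst_continuous.
have -> : (fun z : complexes R => (p * 'X + c%:P).[z]) =
    (fun z => p.[z] * z + c) by apply/funext => u; rewrite hornerMXaddC.
apply: (@continuousD _ _ _ (fun z => p.[z] * z) (cst c)).
  by apply: continuousM; [exact: ih|exact: cvg_id].
exact: cst_continuous.
Qed.

Lemma continuous_modulus_horner (p : {poly complexes R}) :
  continuous (fun z => modulus p.[z]).
Proof.
move=> z; apply: (@continuous_comp _ _ _ (fun z => p.[z]) (@modulus R)).
  exact: continuous_horner.
exact: continuous_modulus.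
Qed.

Lemma lemniscateE (p : {poly complexes R}) z : lemniscate p z = (modulus p.[z] < 1) :> Prop.
Proof. by rewrite /lemniscate /= normE -[1]/(ofreal 1) ltcR. Qed.

Lemma open_lemniscate (p : {poly complexes R}) : open (lemniscate p).
Proof.
have -> : lemniscate p = (fun z => modulus p.[z]) @^-1` [set x | x < 1].
  by apply/seteqP; split => z /=; rewrite lemniscateE.
by apply: open_comp => [z _|]; [exact: continuous_modulus_horner|exact: open_lt].
Qed.

(** A closed bounded set is a closed part of the image of a square. *)
Lemma compact_complex (A : set (complexes R)) (B : R) :
  closed A -> (forall z, A z -> modulus z <= B) -> compact A.
Proof.
move=> cA bA.
pose S := [set x : R * R | x.1 \in `[-B, B] /\ x.2 \in `[-B, B]].
pose h (x : R * R) : complexes R := ofreal x.1 + 'i%C * ofreal x.2.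
have ch : continuous h.
  move=> x; apply: (@continuousD _ _ _ (fun x : R * R => ofreal x.1)
    (fun x : R * R => ('i%C : complexes R) * ofreal x.2)).
    by apply: continuous_comp; [exact: cvg_fst|exact: continuous_ofreal].
  apply: continuousM; first exact: cst_continuous.
  by apply: continuous_comp; [exact: cvg_snd|exact: continuous_ofreal].
have cS : compact S.
  have -> : S = `[-B, B]%classic `*` `[-B, B]%classic.
    by apply/seteqP; split => x /=; rewrite /S/= !in_itv.
  by apply: compact_setX; exact: segment_compact.
apply: (@subclosed_compact _ _ (h @` S)) => //.
  apply: continuous_compact => //; exact: continuous_subspaceT.
move=> z Az; exists (re z, im z) => /=.
  rewrite /S /= !in_itv /= -!ler_norml; split; apply: le_trans (bA _ Az).
    exact: normRe_le.
  exact: normIm_le.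
by rewrite /h /= -complexE.
Qed.

Lemma compact_bounded_modulus (A : set (complexes R)) : compact A ->
  exists2 B : R, 1 <= B & forall z, A z -> modulus z <= B.
Proof.
move=> cA.
have : compact (@modulus R @` A).
  apply: continuous_compact => //; apply: continuous_subspaceT; exact: continuous_modulus.
move/compact_bounded => [M [_ hM]].
exists (Num.max 1 (M + 1)); first by rewrite le_max lexx.
move=> z Az; rewrite le_max; apply/orP; right.
have M1 : M < M + 1 by rewrite ltrDl ltr01.
apply: le_trans (ler_norm _) _; apply: hM M1 (modulus z) _.
by exists z.
Qed.

End ModulusTheory.

(** * The minimum modulus principle *)

Section LemniscateComponents.
Variable R : realType.
Implicit Types (z w : complexes R) (p : {poly complexes R}).

Definition segment z w : set (complexes R) :=
  (fun t : R => z + ofreal t * (w - z)) @` `[0, 1].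

Lemma connected_segment z w : connected (segment z w).
Proof.
apply: connected_continuous_connected; first exact: segment_connected.
apply: continuous_subspaceT => t.
apply: (@continuousD _ _ _ (cst z) (fun t : R => ofreal t * (w - z))).
  exact: cst_continuous.
apply: continuousM; first exact: continuous_ofreal.
exact: cst_continuous.
Qed.

Lemma segmentl z w : segment z w z.
Proof. by exists 0; rewrite ?ofreal0 ?mul0r ?addr0 //= in_itv /= lexx ler01. Qed.

Lemma segmentr z w : segment z w w.
Proof. by exists 1; rewrite ?ofreal1 ?mul1r ?subrKC //= in_itv /= lexx ler01. Qed.

Lemma connected_disc z (e : R) : connected (disc z e).
Proof.
have [e0|e0] := ltP 0 e; last first.
  have -> : disc z e = set0; last exact: connected0.
  apply/seteqP; split => // w; rewrite /disc /= => h.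
  by have := lt_le_trans h e0; rewrite ltNge modulus_ge0.
have -> : disc z e = \bigcup_(w in disc z e) segment z w.
  apply/seteqP; split => [w zw|u [w zw [t t01 <-]]]; first by exists w => //; exact: segmentr.
  rewrite /disc /= opprD addNKr modulusN modulusM modulus_ofreal.
  move: t01; rewrite /= in_itv /= => /andP[t0 t1].
  rewrite ger0_norm // modulusBC; apply: le_lt_trans zw.
  by rewrite ler_piMl ?modulus_ge0.
apply: bigcup_connected; last by move=> *; exact: connected_segment.
by exists z => w _; exact: segmentl.
Qed.

Lemma open_component (A : set (complexes R)) z :
  open A -> open (connected_component A z).
Proof.
move=> /open_complexP oA; apply/open_complexP => w Cw.
have [e e0 sA] := oA w (connected_component_sub Cw).
exists e => // u wu; apply: (connected_component_trans Cw).
apply: (@connected_component_max _ _ (disc w e)) => //.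
- exact: disc_center.
- exact: connected_disc.
Qed.

Lemma closure_component (A : set (complexes R)) z w :
  open A -> A w -> closure (connected_component A z) w ->
  connected_component A z w.
Proof.
move=> oA Aw /(_ (connected_component A w)) h.
have [|u [Cu Cwu]] := h.
  apply: open_nbhs_nbhs; split; first exact: open_component.
  exact: connected_component_refl.
apply: (connected_component_trans Cu); exact: connected_component_sym.
Qed.

(** With [c = p.[w]] and [p - c = (X - w) ^ m * q], where [q] does not vanish at
    [w], the [m]-th roots of [- c / q.[w]] are the directions in which [p] moves
    from [c] straight towards 0, to first order. *)
Lemma poly_modulus_decrease p w (e : R) : (1 < size p)%N -> p.[w] != 0 ->
  0 < e -> exists2 z, disc w e z & modulus p.[z] < modulus p.[w].
Proof.
move=> sp pw e0; set c := p.[w].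
have [m [q nq pq]] := multiplicity_XsubC (p - c%:P) w.
have pc0 : p - c%:P != 0.
  apply: contraTneq sp => /subr0_eq ->.
  by rewrite size_polyC -leqNgt leq_b1.
have {nq} : ~~ root q w by move: nq; rewrite pc0.
rewrite rootE => qw.
have m0 : (0 < m)%N.
  rewrite lt0n; apply: contraNneq qw => m0.
  by move: pq; rewrite m0 expr0 mulr1 => <-; rewrite !hornerE subrr.
set b := q.[w] in qw *.
pose xi := m.-root (- c / b).
have xiE : xi ^+ m = - c / b by rewrite rootCK.
have xi0 : xi != 0.
  apply/eqP => x0; move/eqP: xiE; rewrite x0 expr0n eqn0Ngt m0 /= eq_sym.
  by rewrite mulf_eq0 invr_eq0 oppr_eq0 (negbTE pw) (negbTE qw).
have bpos : 0 < modulus b by rewrite modulus_gt0.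
have xpos : 0 < modulus xi by rewrite modulus_gt0.
have : nbhs w ((fun z => q.[z]) @^-1` (disc b (modulus b / 2))).
  by apply: continuous_horner; apply: nbhs_disc; rewrite divr_gt0.
move=> /nbhs_complexP[d d0 hd].
pose t := Num.min (1/2) (Num.min d e / (2 * modulus xi)).
have t0 : 0 < t by rewrite lt_min !divr_gt0 ?lt_min ?d0 ?mulr_gt0.
have t1 : t <= 1.
  by rewrite /t ge_min; apply/orP; left; rewrite ler_pdivrMr // mul1r ler1n.
pose z := w + ofreal t * xi.
have wz : modulus (w - z) < Num.min d e.
  rewrite /z opprD addNKr modulusN modulusM modulus_ofreal gtr0_norm //.
  rewrite -ltr_pdivlMr //; apply: (@le_lt_trans _ _ (Num.min d e / (2 * modulus xi))).
    by rewrite /t ge_min lexx orbT.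
  rewrite ltr_pM2l ?lt_min ?d0 // ltf_pV2 ?posrE ?mulr_gt0 //.
  by rewrite ltr_pMl // ltr1n.
exists z; first by move: wz; rewrite lt_min => /andP[].
have pz : p.[z] = c * (1 - ofreal (t ^+ m) * (q.[z] / b)).
  have -> : p.[z] = c + (p - c%:P).[z] by rewrite hornerD hornerN hornerC addrC subrK.
  have zw : z - w = ofreal t * xi by rewrite /z addrAC subrr add0r.
  rewrite pq hornerM horner_exp hornerXsubC zw exprMn xiE.
  have -> : ofreal (t ^+ m) = ofreal t ^+ m by exact: (rmorphXn (real_complex R)).
  clearbody z b; move: (q.[z]) (ofreal t ^+ m) => Q T; by field.
rewrite pz modulusM gtr_pMr ?modulus_gt0 //.
have qz : modulus (q.[z] / b - 1) < 1 / 2.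
  have -> : q.[z] / b - 1 = (q.[z] - b) / b by field.
  rewrite modulusM modulusV ltr_pdivrMr // modulusBC.
  by rewrite mulrC mulrA mulr1; apply: hd; move: wz; rewrite lt_min => /andP[].
have -> : 1 - ofreal (t ^+ m) * (q.[z] / b) =
  ofreal (1 - t ^+ m) - ofreal (t ^+ m) * (q.[z] / b - 1).
  have -> : ofreal (1 - t ^+ m) = 1 - ofreal (t ^+ m).
    exact: (rmorphB (real_complex R)).
  by ring.
apply: (le_lt_trans (modulusD _ _)).
rewrite modulusN modulusM !modulus_ofreal.
have tm0 : 0 < t ^+ m by rewrite exprn_gt0.
have tm1 : t ^+ m <= 1 by rewrite exprn_ile1 // ltW.
rewrite ger0_norm ?subr_ge0 // ger0_norm ?ltW //.
nra.
Qed.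

(** The minimum of [|p|] on the compact closure of [C] is not attained inside
    [C], where [poly_modulus_decrease] applies; a constant [p] only needs some
    boundary point, and a rightmost point of the closure is one. *)
Lemma min_modulus p (C : set (complexes R)) (B : R) z :
  open C -> (forall w, C w -> modulus w <= B) ->
  (forall w, C w -> p.[w] != 0) -> C z ->
  exists w, [/\ closure C w, ~ C w & modulus p.[w] <= modulus p.[z]].
Proof.
move=> oC bC pC Cz.
have clC : closed [set w : complexes R | modulus w <= B].
  apply: (@preimage_closed _ _ (@modulus R) [set x | x <= B]).
    by move=> u _; exact: continuous_modulus.
  exact: closed_le.
have bclC w : closure C w -> modulus w <= B.
  move=> Cw; suff : closure [set w : complexes R | modulus w <= B] w.
    by rewrite -(iffLR (closure_id _) clC).
  by move: Cw; apply: closureS.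
have cC : compact (closure C).
  by apply: (compact_complex (B := B)) => //; exact: closed_closure.
have C0 : closure C !=set0 by exists z; exact: subset_closure.
have [sp|sp] := leqP (size p) 1.
  have [|w] := compact_EVT_max C0 cC (f := fun z => complex.Re (z : R[i])).
    by apply: continuous_subspaceT; exact: continuous_re.
  move=> /set_mem Cw wmax; exists w; split => //; last first.
    by rewrite (size1_polyC sp) !hornerE.
  move=> /(iffLR (open_complexP _) oC)[e e0 we].
  have : closure C (w + ofreal (e / 2)).
    apply: subset_closure; apply: we.
    rewrite opprD addNKr modulusN modulus_ofreal gtr0_norm ?divr_gt0 //; lra.
  move=> /mem_set/wmax /=; rewrite raddfD /=; lra.
have [|w] := compact_EVT_min C0 cC (f := fun z => modulus p.[z]).
  by apply: continuous_subspaceT; exact: continuous_modulus_horner.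
move=> /set_mem Cw wmin; exists w; split => //; last first.
  by apply: wmin; apply/mem_set; exact: subset_closure.
move=> Cw'; have [e e0 we] := iffLR (open_complexP _) oC w Cw'.
have [u wu] := poly_modulus_decrease sp (pC _ Cw') e0.
rewrite ltNge => /negP; apply; apply: wmin; apply/mem_set.
by apply: subset_closure; exact: we.
Qed.

Lemma closure_lemniscate_le p (C : set (complexes R)) w :
  C `<=` lemniscate p -> closure C w -> modulus p.[w] <= 1.
Proof.
move=> sC; have clC : closed [set w : complexes R | modulus p.[w] <= 1].
  apply: (@preimage_closed _ _ (fun w => modulus p.[w]) [set x | x <= 1]).
    by move=> u _; exact: continuous_modulus_horner.
  exact: closed_le.
move=> Cw; suff : closure [set w : complexes R | modulus p.[w] <= 1] w.
  by rewrite -(iffLR (closure_id _) clC).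
by move: Cw; apply: closureS => u /sC; rewrite lemniscateE => /ltW.
Qed.

(** A component is relatively closed, so its other limit points lie outside the
    lemniscate. *)
Lemma boundary_component_ge p z w :
  closure (connected_component (lemniscate p) z) w ->
  ~ connected_component (lemniscate p) z w -> 1 <= modulus p.[w].
Proof.
move=> Cw nCw; rewrite leNgt; apply/negP => h; apply: nCw.
apply: closure_component => //; first exact: open_lemniscate.
by rewrite lemniscateE.
Qed.

End LemniscateComponents.

(** * Components of a lemniscate and products of distances *)

Section CountingComponents.
Variable R : realType.
Implicit Types (z w : complexes R) (p : {poly complexes R}).

Lemma counting_injective (T : choiceType) (f : nat -> T) (r : nat) :
  {in `I_r &, injective f} -> @counting T R (f @` `I_r) = r%:R%:E.
Proof.
move=> fi; have e : (f @` `I_r #= `I_r)%card by exact: inj_card_eq.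
rewrite /counting asboolT; last by apply/finite_setP; exists r.
by rewrite (card_fset_set e).
Qed.

(** The modulus of the Vandermonde determinant of [z 0, ..., z n.-1]. *)
Definition pairprod (z : nat -> complexes R) (n : nat) : R :=
  \prod_(j < n) \prod_(i < j) modulus (z j - z i).

Lemma pairprodS (z : nat -> complexes R) n :
  pairprod z n.+1 = pairprod z n * \prod_(i < n) modulus (z n - z i).
Proof. by rewrite /pairprod big_ord_recr. Qed.

Lemma pairprod_ge0 (z : nat -> complexes R) n : 0 <= pairprod z n.
Proof. by do 2!apply: prodr_ge0 => ? _; exact: modulus_ge0. Qed.

Lemma pairprod_sqr (z : nat -> complexes R) n :
  \prod_(j < n) \prod_(i < n | i != j) modulus (z j - z i) = pairprod z n ^+ 2.
Proof.
elim: n => [|n ih]; first by rewrite /pairprod !big_ord0 expr1n.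
rewrite pairprodS exprMn -ih big_ord_recr /=.
have -> : \prod_(i < n.+1 | i != ord_max) modulus (z n - z i) =
    \prod_(i < n) modulus (z n - z i).
  rewrite [LHS]big_mkcond big_ord_recr /= eqxx mulr1.
  apply: eq_bigr => i _; rewrite ifT //.
  by rewrite -val_eqE /= ltn_eqF.
rewrite expr2 mulrA; congr (_ * _).
have -> : \prod_(i < n) modulus (z n - z i) = \prod_(i < n) modulus (z i - z n).
  by apply: eq_bigr => i _; rewrite modulusBC.
rewrite -big_split /=; apply: eq_bigr => j _.
rewrite [LHS]big_mkcond big_ord_recr /= ifT; last first.
  by rewrite -val_eqE /= gtn_eqF.
by rewrite [in RHS]big_mkcond.
Qed.

Section RootsOfMonic.
Variables (n : nat) (z : 'I_n -> complexes R) (B Rad : R).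
Hypothesis zB : forall i, modulus (z i) <= B.
Hypothesis zRad : forall i j, modulus (z i - z j) + 1 <= Rad.
Hypothesis Rad1 : 1 <= Rad.

Let p : {poly complexes R} := \prod_(j < n) ('X - (z j)%:P).
Let comp i := connected_component (lemniscate p) (z i).

Lemma modulus_prod_XsubC (P : pred 'I_n) w :
  modulus (\prod_(j < n | P j) ('X - (z j)%:P)).[w] =
  \prod_(j < n | P j) modulus (w - z j).
Proof.
rewrite horner_prod modulus_prod; apply: eq_bigr => j _.
by rewrite hornerXsubC.
Qed.

Lemma lemniscate_root i : lemniscate p (z i).
Proof.
rewrite lemniscateE modulus_prod_XsubC (bigD1 i) //= subrr modulus0 mul0r.
exact: ltr01.
Qed.

Lemma near_some_root w : modulus p.[w] <= 1 -> (0 < n)%N ->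
  exists j, modulus (w - z j) <= 1.
Proof.
move=> pw n0; apply: contrapT => /forallNP h.
have : 1 < modulus p.[w].
  rewrite modulus_prod_XsubC.
  apply: (@le_lt_trans _ _ (\prod_(j < n) 1)); first by rewrite big1.
  apply: ltr_prod; last by move=> i _; rewrite ler01 /= ltNge; apply/negP/h.
  by apply/hasP; exists (Ordinal n0); rewrite ?mem_index_enum.
by rewrite ltNge pw.
Qed.

Lemma lemniscate_bounded w : lemniscate p w -> modulus w <= B + 1.
Proof.
rewrite lemniscateE => pw; have [n0|n0] := posnP n.
  exfalso; move: pw; rewrite modulus_prod_XsubC big1 ?ltxx // => i.
  by have := ltn_ord i; rewrite {2}n0.
have [j zj] := near_some_root (ltW pw) n0.
by rewrite -(subrK (z j) w) addrC (le_trans (modulusD _ _)) // lerD.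
Qed.

(** Otherwise the minimum modulus principle yields a boundary point where
    [|p|] is at most its value at [w], which is less than 1. *)
Lemma component_has_root w : lemniscate p w ->
  exists i, comp i = connected_component (lemniscate p) w.
Proof.
move=> Lw; set C := connected_component _ w.
suff [i Ci] : exists i, C (z i).
  by exists i; apply/esym/same_connected_component.
apply: contrapT => /forallNP nC.
have Cw : C w by exact: connected_component_refl.
have oC : open C by apply: open_component; exact: open_lemniscate.
have pC u : C u -> p.[u] != 0.
  move=> Cu; rewrite horner_prod; apply/prodf_neq0 => i _.
  by rewrite hornerXsubC subr_eq0; apply: contra_notN (nC i) => /eqP <-.
have [|u [cu nu pu]] := min_modulus oC _ pC Cw (B := B + 1).
  by move=> v /connected_component_sub; exact: lemniscate_bounded.
have := boundary_component_ge cu nu; rewrite leNgt => /negP; apply.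
by move: Lw; rewrite lemniscateE; exact: le_lt_trans.
Qed.

(** The minimum modulus principle, applied on the component to the product of
    the factors whose zeros lie outside it, compares its value at [z i] with its
    value at a boundary point, where the whole of [|p|] is at least 1 and each of
    the remaining factors is at most [Rad]. *)
Lemma other_roots_lower_bound i :
  1 <= Rad ^+ #|[set j | z j \in comp i]%SET| *
       \prod_(j < n | z j \notin comp i) modulus (z i - z j).
Proof.
set C := comp i; pose f := \prod_(j < n | z j \notin C) ('X - (z j)%:P).
have Ci : C (z i) by apply: connected_component_refl; exact: lemniscate_root.
have oC : open C by apply: open_component; exact: open_lemniscate.
have fC u : C u -> f.[u] != 0.
  move=> Cu; rewrite horner_prod; apply/prodf_neq0 => j nj.
  by rewrite hornerXsubC subr_eq0; apply: contraNneq nj => <-; rewrite inE.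
have [|u [cu nu fu]] := min_modulus oC _ fC Ci (B := B + 1).
  by move=> v /connected_component_sub; exact: lemniscate_bounded.
have pu1 : modulus p.[u] <= 1.
  apply: closure_lemniscate_le cu; exact: connected_component_sub.
have := boundary_component_ge cu nu.
rewrite modulus_prod_XsubC (bigID [pred j | z j \in C]) /= => /le_trans; apply.
move: fu; rewrite !modulus_prod_XsubC => fu; apply: ler_pM => //.
- by apply: prodr_ge0 => j _; exact: modulus_ge0.
- by apply: prodr_ge0 => j _; exact: modulus_ge0.
have -> : Rad ^+ #|[set j | z j \in C]%SET| = \prod_(j < n | z j \in C) Rad.
  by rewrite prodr_const cardsE.
apply: ler_prod => j _; rewrite modulus_ge0 /=.
have n0 : (0 < n)%N by apply: leq_ltn_trans (ltn_ord i).
have [k uk] := near_some_root pu1 n0.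
apply: (le_trans (modulusB_le u (z k) (z j))); rewrite addrC.
by apply: le_trans (zRad k j); rewrite lerD2l.
Qed.

Definition reps : {set 'I_n} := [set i : 'I_n | [forall j : 'I_n, (j < i)%N ==> `[< comp j <> comp i >]]]%SET.

Lemma reps_inj : {in reps &, injective comp}.
Proof.
have lt_case i j : i \in reps -> comp j = comp i -> (i <= j)%N.
  rewrite inE => /forallP h ji; rewrite leqNgt; apply/negP => ij.
  by have /implyP/(_ ij)/asboolP := h j.
move=> i j ri rj ij; apply/val_inj/eqP; rewrite eqn_leq.
by rewrite (lt_case i j) // (lt_case j i).
Qed.

Lemma repsP i : exists2 j, j \in reps & comp j = comp i.
Proof.
have [m im] := ubnP (val i); elim: m i im => // m ih i im.
have [ri|] := boolP (i \in reps); first by exists i.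
rewrite inE negb_forall => /existsP[j]; rewrite negb_imply => /andP[ji].
move=> /asboolPn/contrapT ij.
have [|k rk kj] := ih j; first by apply: leq_trans ji _.
by exists k => //; rewrite kj.
Qed.

(** The chosen zeros, numbered by initial naturals as [pairprod] expects. *)
Definition rep_seq (k : nat) : complexes R :=
  if ltnP k #|reps| is LtnNotGeq lt then z (enum_val (Ordinal lt)) else 0.

Lemma rep_seqE (k : 'I_#|reps|) : rep_seq k = z (enum_val k).
Proof.
rewrite /rep_seq; case: ltnP => [lt|]; last by rewrite leqNgt ltn_ord.
by congr (z (enum_val _)); exact: val_inj.
Qed.

Lemma nb_components_reps : nb_components p = #|reps|%:R%:E.
Proof.
pose f k := connected_component (lemniscate p) (rep_seq k).
have -> : nb_components p = counting (f @` `I_#|reps|).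
  congr counting; apply/seteqP; split => [_ [w Lw <-]|_ [k /= kr <-]].
    have [i <-] := component_has_root Lw.
    have [j rj <-] := repsP i.
    exists (enum_rank_in rj j) => /=; first exact: ltn_ord.
    by rewrite /f rep_seqE enum_rankK_in.
  exists (rep_seq k) => //.
  by rewrite (rep_seqE (Ordinal kr)); exact: lemniscate_root.
apply: counting_injective => k l; rewrite !inE /= => kr lr.
rewrite /f (rep_seqE (Ordinal kr)) (rep_seqE (Ordinal lr)) => e.
suff : Ordinal kr = Ordinal lr by case.
by apply: enum_val_inj; apply: reps_inj e; exact: enum_valP.
Qed.

(** The product over the chosen zeros of the bounds of
    [other_roots_lower_bound].  The powers of [Rad] coming from the zeros inside
    the components add up to at most [n], as components are disjoint; of the
    zeros outside, the [n - r] that were not chosen cost at most one factor [Rad]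
    each, and the chosen ones give every pair twice. *)
Lemma reps_pairprod (r := #|reps|) :
  1 <= Rad ^+ n * Rad ^+ (r * (n - r)) * pairprod rep_seq r ^+ 2.
Proof.
have Rad0 : 0 <= Rad by apply: le_trans Rad1; exact: ler01.
have step i : i \in reps ->
    1 <= Rad ^+ #|[set j | z j \in comp i]%SET| * Rad ^+ (n - r) *
      \prod_(j in reps | j != i) modulus (z i - z j).
  move=> ri; apply: (le_trans (other_roots_lower_bound i)).
  rewrite -mulrA ler_wpM2l ?exprn_ge0 //.
  rewrite (bigID (mem reps)) /= mulrC ler_pM //.
  - by apply: prodr_ge0 => j _; exact: modulus_ge0.
  - by apply: prodr_ge0 => j _; exact: modulus_ge0.
  - apply: (@le_trans _ _ (\prod_(j in (~: reps)%SET) Rad)).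
      rewrite [leRHS](bigID [pred j | z j \notin comp i]) /=.
      rewrite -[leLHS]mulr1; apply: ler_pM => //.
      + by apply: prodr_ge0 => j _; exact: modulus_ge0.
      + rewrite [leLHS](eq_bigl (fun j => (j \in ~: reps)%SET && (z j \notin comp i))).
          apply: ler_prod => j _; rewrite modulus_ge0 /=.
          by apply: le_trans (zRad i j); rewrite lerDl.
        by move=> j; rewrite finset.in_setC andbC.
      + by rewrite prodr_const exprn_ege1.
    by rewrite prodr_const cardsCs finset.setCK card_ord.
  - rewrite le_eqVlt; apply/orP; left; apply/eqP; apply: eq_bigl => j.
    rewrite andbC; have [rj|//] /= := boolP (j \in reps).
    have [->|ji] := eqVneq j i.
      by apply/negbF/mem_set; apply: connected_component_refl;
        exact: lemniscate_root.
    apply/negP => /set_mem zj; move/eqP: ji; apply; apply: reps_inj => //.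
    by apply/esym/same_connected_component.
have : 1 <= \prod_(i in reps) (Rad ^+ #|[set j | z j \in comp i]%SET| *
    Rad ^+ (n - r) * \prod_(j in reps | j != i) modulus (z i - z j)).
  apply: (@le_trans _ _ (\prod_(i in reps) 1)); first by rewrite big1.
  by apply: ler_prod => i /step ->; rewrite ler01.
rewrite !big_split /= => /le_trans; apply; rewrite -mulrA -[leRHS]mulrA; apply: ler_pM.
- by apply: prodr_ge0 => j _; exact: exprn_ge0.
- apply: mulr_ge0; first by apply: prodr_ge0 => j _; exact: exprn_ge0.
  by do 2!apply: prodr_ge0 => ? _; exact: modulus_ge0.
- rewrite prodrXr ler_weXn2l //.
  under eq_bigr do rewrite -sum1_card.
  rewrite (exchange_big_dep predT) //= -[leqRHS]card_ord -sum1_card.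
  apply: leq_sum => j _; rewrite sum1_card.
  apply/card_le1P => i /andP[ri]; rewrite finset.in_set => /set_mem zi k.
  rewrite [RHS]inE; apply/andP/eqP => [[rk]|->]; last first.
    by split => //; rewrite finset.in_set; exact/mem_set.
  rewrite finset.in_set => /set_mem zk; apply: reps_inj => //.
  apply: same_connected_component.
  by apply: (connected_component_trans zk); exact: connected_component_sym.
- rewrite prodr_const -exprM mulnC ler_wpM2l ?exprn_ge0 //.
  rewrite -pairprod_sqr le_eqVlt; apply/orP; left; apply/eqP.
  rewrite big_enum_val /=; apply: eq_bigr => k _.
  rewrite big_enum_val_cond /=.
  apply: eq_big => [l|l _]; first by rewrite (inj_eq enum_val_inj).
  by rewrite -!rep_seqE.
Qed.

Lemma rep_seq_root k : (k < #|reps|)%N -> exists i, rep_seq k = z i.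
Proof. by move=> kr; exists (enum_val (Ordinal kr)); rewrite -rep_seqE. Qed.

End RootsOfMonic.
End CountingComponents.

(** * A proportion of components bounded away from 1 *)

Section FewComponents.
Variable R : realType.

Lemma limn_esup_le (u : (\bar R)^nat) (c : \bar R) (N : nat) :
  (forall n, (N <= n)%N -> (u n <= c)%E) -> (limn_esup u <= c)%E.
Proof.
move=> h; apply: (@le_trans _ _ (ereal_sup (u @` [set n | (N <= n)%N]))).
  by apply: ereal_inf_lbound; exists [set n | (N <= n)%N] => //; exists N.
by apply/ereal_supP => _ [n /= Nn <-]; exact: h.
Qed.

Lemma limn_einf_ge (u : (\bar R)^nat) (c : \bar R) (N : nat) :
  (forall n, (N <= n)%N -> (c <= u n)%E) -> (c <= limn_einf u)%E.
Proof.
move=> h; rewrite /limn_einf leeNr; apply: (@limn_esup_le _ _ N) => n Nn.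
by rewrite leeN2 h.
Qed.

Lemma expr_lt_eventually (x e : R) : 0 <= x < 1 -> 0 < e ->
  exists N : nat, forall n, (N <= n)%N -> x ^+ n < e.
Proof.
move=> /andP[x0 x1] e0.
have : (fun n => x ^+ n) @ \oo --> (0 : R).
  by apply: cvg_expr; rewrite ger0_norm.
move/cvgrPdist_lt => /(_ _ e0)[N _ hN]; exists N => n Nn.
have := hN n Nn; rewrite /= sub0r normrN ger0_norm //; exact: exprn_ge0.
Qed.

(** Dividing the hypothesis by [r] gives, up to constants, [r <= q (n - r)], or
    [r <= n * q / (q + 1)]; the weaker slope of the conclusion absorbs the
    constants for large [n]. *)
Lemma few_components_arith (q n r N : nat) : (0 < q)%N ->
  (4 * q + 2 <= n)%N -> (2 * N <= n)%N -> (r <= n)%N ->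
  ((N <= r)%N -> (r * r.-1 <= q * n + q * (r * (n - r)))%N) ->
  (r * (2 * q.+1) <= n * (2 * q + 1))%N.
Proof.
move=> q0 qn Nn rn h; rewrite leqNgt; apply/negP => big.
have rn2 : (n <= 2 * r)%N by nia.
have {}h : (r * r.-1 <= q * n + q * (r * (n - r)))%N by apply: h; lia.
have r1 : (0 < r)%N by lia.
have : (r.-1 <= q * 2 + q * (n - r))%N.
  by rewrite -(leq_pmul2l r1) (leq_trans h) // !mulnDr; nia.
nia.
Qed.

(** With [q] such that [Rad * C ^ q <= 1], comparing the lower bound
    [reps_pairprod] with the assumed upper bound turns into an inequality between
    exponents, which [few_components_arith] solves for [r]. *)
Lemma limsup_ratio_lt1_pairprod (K : set (complexes R)) (C : R) (N : nat) :
  compact K -> 0 < C < 1 ->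
  (forall n, (N <= n)%N -> forall z, (forall k, (k < n)%N -> K (z k)) ->
    pairprod z n <= C ^+ 'C(n, 2)) ->
  (limsup_ratio K < 1)%E.
Proof.
move=> cK /andP[C0 C1] hC; have C0' := ltW C0.
have [B B1 KB] := compact_bounded_modulus cK.
pose Rad := 2 * B + 1.
have Rad1 : 1 <= Rad by rewrite /Rad; lra.
have [q0 hq] : exists q : nat, forall n, (q <= n)%N -> C ^+ n < Rad^-1.
  by apply: expr_lt_eventually; rewrite ?(ltW C0) //= invr_gt0; lra.
pose q := q0.+1.
have Cq : Rad * C ^+ q <= 1.
  by rewrite -ler_pdivlMl ?mulr1 ?ltW ?hq //; lra.
pose c : R := (2 * q + 1)%N%:R / (2 * q.+1)%N%:R.
have c1 : c < 1 by rewrite ltr_pdivrMr ?mul1r ?ltr_nat ?ltr0n //; lia.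
apply: le_lt_trans (_ : c%:E < 1)%E; last by rewrite lte_fin.
apply: (@limn_esup_le _ _ (4 * q + 2 + 2 * N)) => n Nn.
have n0 : 0 < n%:R :> R by rewrite ltr0n; lia.
rewrite /component_ratio lee_pdivrMr // -EFinM.
apply/ereal_supP => _ [p [z Kz ->] <-].
have zB i : modulus (z i) <= B by exact: KB.
have zRad i j : modulus (z i - z j) + 1 <= Rad.
  rewrite lerD2r (le_trans (modulusD _ _)) // modulusN.
  by have := zB i; have := zB j; lra.
rewrite (nb_components_reps zB) lee_fin /c mulrAC ler_pdivlMr ?ltr0n // -!natrM ler_nat.
rewrite [leqRHS]mulnC; set r := #|reps z|.
have rn : (r <= n)%N by rewrite -[n in (_ <= n)%N]card_ord max_card.
apply: (@few_components_arith q n r N); rewrite //; [lia|lia|] => Nr.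
have Rad0 : 0 <= Rad by apply: le_trans Rad1; exact: ler01.
have := reps_pairprod zB zRad Rad1; clearbody Rad q; rewrite -/r => h.
have hr : pairprod (rep_seq z) r ^+ 2 <= C ^+ (r * r.-1).
  apply: (@le_trans _ _ ((C ^+ 'C(r, 2)) ^+ 2)).
    rewrite ler_pXn2r ?nnegrE ?pairprod_ge0 ?exprn_ge0 //.
    apply: hC => // k kr; have [i ->] := rep_seq_root kr; exact: Kz.
  rewrite -exprM bin2 muln2 -[X in _ <= C ^+ X]odd_double_half.
  by rewrite oddM; case: (r) => // m /=; rewrite andNb.
clearbody r; have : 1 <= Rad ^+ n * Rad ^+ (r * (n - r)) * C ^+ (r * r.-1).
  by apply: (le_trans h); apply: ler_wpM2l hr; rewrite mulr_ge0 ?exprn_ge0.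
rewrite leqNgt => h1; apply/negP => lt; move: h1; apply/negP; rewrite -ltNge.
rewrite -exprD; set m := (n + r * (n - r))%N.
have -> : (r * r.-1 = q * m + (r * r.-1 - q * m))%N.
  by rewrite subnKC // /m mulnDr ltnW.
rewrite exprD mulrA [_ ^+ m * _]mulrC exprM -exprMn.
apply: (@le_lt_trans _ _ (C ^+ (r * r.-1 - q * m))).
  apply: ler_piMl; first exact: exprn_ge0.
  by rewrite exprn_ile1 // ?mulr_ge0 ?exprn_ge0 // mulrC.
by rewrite exprn_ilt1 // -lt0n subn_gt0 /m mulnDr.
Qed.

End FewComponents.

(** * The energy of a measure as the integral of a nonnegative kernel *)

Section LogEnergy.
Variable R : realType.
Notation borelC := (borel_complexes R).
Implicit Types (K : set (complexes R)) (mu : probability (borel_complexes R) R).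

Lemma measurable_open K : open K -> measurable (K : set borelC).
Proof. by move=> oK; exact: sub_sigma_algebra. Qed.

Lemma measurable_closed K : closed K -> measurable (K : set borelC).
Proof.
move=> cK; rewrite -(setCK K); apply: measurableC; apply: measurable_open.
exact: closed_openC.
Qed.

Lemma compact_closed_complex K : compact K -> closed K.
Proof. by apply: compact_closed; exact: norm_hausdorff. Qed.

Lemma continuous_borel (f : complexes R -> R) : continuous f ->
  measurable_fun [set: borelC] (f : borelC -> R).
Proof.
move=> cf; apply: (measurability _ (RGenOInfty.measurableE R)) => //.
move=> _ [_ [x ->] <-]; rewrite setTI; apply: measurable_open.
apply: open_comp => [z _|]; first exact: cf.
by have -> : `]x, +oo[%classic = [set y | x < y];
  [apply/seteqP; split => y /=; rewrite in_itv /= andbT|exact: open_gt].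
Qed.

Lemma measurable_re : measurable_fun [set: borelC] (fun z : borelC => complex.Re (z : R[i])).
Proof. by apply: continuous_borel; exact: continuous_re. Qed.

Lemma measurable_im : measurable_fun [set: borelC] (fun z : borelC => complex.Im (z : R[i])).
Proof. by apply: continuous_borel; exact: continuous_im. Qed.

Lemma measurable_dist : measurable_fun [set: borelC * borelC]
  (fun x : borelC * borelC => modulus ((x.1 : complexes R) - (x.2 : complexes R))).
Proof.
pose f (x : borelC * borelC) : R :=
  Num.sqrt ((complex.Re (x.1 : R[i]) - complex.Re (x.2 : R[i])) ^+ 2 +
            (complex.Im (x.1 : R[i]) - complex.Im (x.2 : R[i])) ^+ 2).
apply: (eq_measurable_fun f).
  by move=> x _; rewrite modulusE !raddfB.
have m1 (h : borelC -> R) : measurable_fun setT h ->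
    measurable_fun [set: borelC * borelC] (fun x => h x.1 - h x.2).
  move=> mh; apply: measurable_funB.
    exact: (measurableT_comp mh measurable_fst).
  exact: (measurableT_comp mh measurable_snd).
apply: (@measurableT_comp _ _ _ _ _ _ (@Num.sqrt R)); first by apply: continuous_measurable_fun; exact: sqrt_continuous.
apply: measurable_funD; apply: measurable_funX; apply: m1.
  exact: measurable_re.
exact: measurable_im.
Qed.

Lemma measurable_lneEFin : measurable_fun [set: R] (fun x : R => lne x%:E).
Proof.
rewrite /lne /=; apply: measurable_fun_ifT => //.
  by apply: measurable_fun_ler.
by apply/measurable_EFinP; exact: measurable_ln.
Qed.

Definition log_dist (z w : complexes R) : \bar R := lne (modulus (z - w))%:E.

Lemma measurable_log_dist : measurable_fun [set: borelC * borelC]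
  (fun x : borelC * borelC => log_dist x.1 x.2).
Proof. exact: (measurableT_comp measurable_lneEFin measurable_dist). Qed.

Section BoundedKernel.
Variables (K : set (complexes R)) (D : R).
Hypotheses (cK : compact K) (D0 : 0 < D).
Hypothesis KD : forall z w, K z -> K w -> modulus (z - w) <= D.

(** On [K] this is [ln (D / |z - w|)], where [D] bounds the diameter of [K]; it
    is cut off at 0 so as to be nonnegative everywhere, which makes monotone
    convergence and Tonelli's theorem available. *)
Definition logker (z w : complexes R) : \bar R :=
  maxe 0%E ((ln D)%:E - log_dist z w)%E.

Lemma logker_ge0 z w : (0 <= logker z w)%E.
Proof. by rewrite /logker le_max lexx. Qed.

Lemma log_dist_logker z w : K z -> K w -> log_dist z w = ((ln D)%:E - logker z w)%E.
Proof.
move=> Kz Kw; have := KD Kz Kw; rewrite /logker /log_dist.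
have [m0|m0] := eqVneq (modulus (z - w)) 0.
  by move=> _; rewrite m0 /= lexx /= max_r ?leey.
have {}m0 : 0 < modulus (z - w) by rewrite lt_def m0 modulus_ge0.
rewrite lne_EFin // => mD; rewrite -EFinB -EFin_max max_r.
  by rewrite -EFinB subKr.
by rewrite subr_ge0 ler_ln ?posrE.
Qed.

Lemma measurable_logker : measurable_fun [set: borelC * borelC]
  (fun x : borelC * borelC => logker x.1 x.2).
Proof.
apply: measurable_maxe => //; apply: emeasurable_funB => //.
exact: measurable_log_dist.
Qed.

Lemma measurable_logker1 (z : complexes R) :
  measurable_fun [set: borelC] (fun w : borelC => logker z w).
Proof.
have := measurableT_comp measurable_logker (pair1_measurable (z : borelC)).
by [].
Qed.

Definition kpotential mu (z : complexes R) : \bar R :=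
  (\int[mu]_(w in (K : set borelC)) logker z w)%E.

Definition kenergy mu : \bar R :=
  (\int[mu]_(z in (K : set borelC)) kpotential mu z)%E.

Lemma measurable_compact : measurable (K : set borelC).
Proof. by apply: measurable_closed; exact: compact_closed_complex. Qed.

Lemma kpotential_ge0 mu z : (0 <= kpotential mu z)%E.
Proof. apply: integral_ge0 => w _. exact: logker_ge0. Qed.

Lemma measurable_potential mu (G : complexes R -> complexes R -> \bar R) :
  measurable_fun [set: borelC * borelC] (fun x : borelC * borelC => G x.1 x.2) ->
  (forall z w, 0 <= G z w)%E ->
  measurable_fun [set: borelC]
    (fun z : borelC => \int[mu]_(w in (K : set borelC)) G z w)%E.
Proof.
move=> mG G0.
pose f (x : borelC * borelC) : \bar R := (G x.1 x.2 * (\1_(K : set borelC) x.2)%:E)%E.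
have -> : (fun z : borelC => \int[mu]_(w in (K : set borelC)) G z w)%E = fubini_F mu f.
  apply/funext => z; rewrite /fubini_F [LHS]integral_mkcond /f /=.
  by rewrite epatch_indic.
apply: measurable_fun_fubini_tonelli_F.
  apply: emeasurable_funM; first exact: mG.
  apply/measurable_EFinP; apply: (measurableT_comp (measurable_indic _)); last exact: measurable_snd.
  exact: measurable_compact.
by move=> x; apply: mule_ge0; [exact: G0|rewrite lee_fin].
Qed.

Lemma measurable_kpotential mu :
  measurable_fun [set: borelC] (fun z : borelC => kpotential mu z).
Proof. by apply: measurable_potential; [exact: measurable_logker|exact: logker_ge0]. Qed.

Lemma kenergy_ge0 mu : (0 <= kenergy mu)%E.
Proof. by apply: integral_ge0 => w _; exact: kpotential_ge0. Qed.

(** The integral of [h] may be infinite; the difference is then bounded above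
    by [c], so that its positive part is integrable and its integral is [-oo]. *)
Lemma integral_cst_sub mu (c : R) (h : borelC -> \bar R) :
  mu K = 1%E -> measurable_fun (K : set borelC) h -> (forall x, K x -> (0 <= h x)%E) ->
  (\int[mu]_(x in (K : set borelC)) (c%:E - h x) =
   c%:E - \int[mu]_(x in (K : set borelC)) h x)%E.
Proof.
move=> muK mh h0.
have mK := measurable_compact.
have ic : mu.-integrable (K : set borelC) (cst c%:E).
  by apply: finite_measure_integrable_cst.
have cint : (\int[mu]_(x in (K : set borelC)) c%:E = c%:E)%E.
  by rewrite integral_cst // [X in (_ * X)%E](_ : _ = 1%E) ?mule1.
have [fin|] := ltP (\int[mu]_(x in (K : set borelC)) h x)%E +oo%E.
  have ih : mu.-integrable (K : set borelC) h.
    apply/integrableP; split => //.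
    rewrite (eq_integral h) // => x /set_mem Kx; rewrite gee0_abs //; exact: h0.
  by rewrite integralB // cint.
rewrite leye_eq => /eqP hoo; rewrite hoo /=.
pose k x := (c%:E - h x)%E.
have mk : measurable_fun (K : set borelC) k by apply: emeasurable_funB.
have cabs : (\int[mu]_(x in (K : set borelC)) `|c|%:E = `|c|%:E)%E.
  by rewrite integral_cst // [X in (_ * X)%E](_ : _ = 1%E) ?mule1.
have kp : (\int[mu]_(x in (K : set borelC)) (k^\+ x) <= `|c|%:E)%E.
  rewrite -cabs; apply: ge0_le_integral => //.
    exact: measurable_funepos.
  move=> x Kx; rewrite funeposE ge_max /k lee_fin normr_ge0 andbT.
  apply: (@le_trans _ _ (c%:E)); last by rewrite lee_fin ler_norm.
  by rewrite geeDl // leeNl oppe0 h0.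
have kn : (\int[mu]_(x in (K : set borelC)) (k^\- x) = +oo)%E.
  apply/eqP; rewrite -leye_eq -(@leeD2rE _ `|c|%:E) // addye // -hoo -[in leRHS]cabs.
  rewrite -ge0_integralD //; last exact: measurable_funeneg.
  apply: ge0_le_integral => //.
    apply: emeasurable_funD => //; exact: measurable_funeneg.
  move=> x Kx; rewrite funenegE /k.
  have := h0 _ Kx; case: (h x) => [r| |] //= r0.
  rewrite -EFin_max -EFinD lee_fin opprB.
  have := ler_norm c; have : r - c <= Num.max (r - c) 0 by rewrite le_max lexx.
  lra.
rewrite -[LHS]/(\int[mu]_(x in (K : set borelC)) k x)%E integralE kn.
by rewrite addeNy // lt_eqF // (le_lt_trans kp) // ltry.
Qed.

(** Reduces the study of the energy to that of a nonnegative kernel. *)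
Lemma log_energy_kenergy mu : mu K = 1%E ->
  log_energy K mu = ((ln D)%:E - kenergy mu)%E.
Proof.
move=> muK; rewrite /log_energy.
transitivity (\int[mu]_(z in (K : set borelC)) ((ln D)%:E - kpotential mu z))%E.
  apply: eq_integral => z /set_mem Kz.
  rewrite -integral_cst_sub //.
  - apply: eq_integral => w /set_mem Kw.
    exact: log_dist_logker.
  - by apply: measurable_funTS; exact: measurable_logker1.
  - by move=> w _; exact: logker_ge0.
rewrite integral_cst_sub //.
- by apply: measurable_funTS; exact: measurable_kpotential.
- by move=> w _; exact: kpotential_ge0.
Qed.

End BoundedKernel.
End LogEnergy.

(** * From points to a measure: binary codes *)

Section ClusterPoint.
Variable R : realType.

(** Tychonoff's theorem in the product of countably many copies of [0, 1].  It
    stands in for the weak compactness of probability measures: the coordinates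
    will be the masses of countably many cells. *)
Lemma cluster_point_coordinates (f : nat -> nat -> R) :
  (forall k i, 0 <= f k i <= 1) ->
  exists a : nat -> R, forall (M N : nat) (e : R), 0 < e ->
    exists2 k, (N <= k)%N & forall i, (i < M)%N -> `|f k i - a i| < e.
Proof.
move=> f01.
have := @tychonoff nat (fun=> R : topologicalType) (fun=> `[0, 1]%classic)
  (fun=> @segment_compact R 0 1).
move=> /(_ (f @ \oo)) [].
- by exists 0%N => // k _ i; rewrite /= in_itv /= f01.
- move=> a [_ cla]; exists a => M N e e0.
  pose U := [set g : prod_topology (fun _ : nat => R) | forall i, (i < M)%N -> `|g i - a i| < e].
  have nU : nbhs (a : prod_topology (fun _ : nat => R)) U.
    rewrite /U; elim: M {U} => [|M ihM]; first by apply: filterS filterT => g _ i.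
    have hM : nbhs (a : prod_topology (fun _ : nat => R)) (proj M @^-1` (ball (a M) e)).
      by apply: (@proj_continuous _ (fun _ : nat => R) M); exact: nbhsx_ballx.
    apply: filterS (filterI ihM hM) => g [gi gM] i.
    rewrite ltnS leq_eqVlt => /predU1P[->|]; last exact: gi.
    by move: gM; rewrite /= -ball_normE /= distrC.
  have nV : (f @ \oo) (f @` [set k | (N <= k)%N]).
    by exists N => // k /= Nk; exists k.
  by have [_ [[k /= Nk <-] Uk]] := cla _ _ nV nU; exists k.
Qed.

End ClusterPoint.

Section BinaryCodes.
Variable R : realType.

Definition dyadic (k : nat) (x : R) : nat := Num.truncn (2 ^+ k * x).

(** Halving removes the last binary digit. *)
Lemma dyadic_half k (x : R) : 0 <= x -> (dyadic k.+1 x)./2 = dyadic k x.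
Proof.
move=> x0; have y0 : 0 <= 2 ^+ k * x by rewrite mulr_ge0 ?exprn_ge0.
apply/esym/truncn_def; have /andP[l u] := truncn_itv y0.
have z0 : 0 <= 2 ^+ k.+1 * x by rewrite mulr_ge0 ?exprn_ge0.
have /andP[] := truncn_itv z0; rewrite -/(dyadic k.+1 x).
have := odd_double_half (dyadic k.+1 x).
move: (_./2) (odd _) => h b <-; rewrite exprS -mulrA.
rewrite -!natr1 natrD -muln2 natrM => l' u'.
have b1 : (b : nat)%:R <= 1 :> R by rewrite lern1 leq_b1.
have b0 : 0 <= (b : nat)%:R :> R by [].
by apply/andP; split; lra.
Qed.

Lemma dyadic_eq_dist k (x y : R) : 0 <= x < 1 -> 0 <= y < 1 ->
  (forall j, (j <= k)%N -> odd (dyadic j x) = odd (dyadic j y)) ->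
  `|x - y| <= (2 ^+ k)^-1.
Proof.
move=> /andP[x0 x1] /andP[y0 y1] h.
have : dyadic k x = dyadic k y.
  elim: k h => [|k ih] h.
    by rewrite /dyadic !expr0 !mul1r !(@truncn_def _ _ 0%N) // ?x0 ?y0.
  rewrite -[LHS]odd_double_half -[RHS]odd_double_half h // !dyadic_half //.
  by rewrite ih // => j jk; apply: h; exact: leqW.
have p0 : 0 < 2 ^+ k :> R by rewrite exprn_gt0.
have /truncn_itv : 0 <= 2 ^+ k * x by rewrite mulr_ge0 ?exprn_ge0.
have /truncn_itv : 0 <= 2 ^+ k * y by rewrite mulr_ge0 ?exprn_ge0.
rewrite -!/(dyadic _ _) => /andP[ly uy] /andP[lx ux] e.
rewrite -[_^-1]mulr1 ler_pdivlMl // -[2 ^+ k]gtr0_norm // -normrM mulrBr ler_norml.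
move: ly uy lx ux; rewrite e -!natr1 => *; apply/andP; split; lra.
Qed.

Section Code.
Variables (X Y : complexes R -> R).

(** The nodes of the infinite binary tree are numbered from the root 1 as in a
    heap, the children of [i] being [2i] and [2i + 1]; level [m] consists of the
    [i] with [2 ^ m <= i < 2 ^ m.+1].  A point goes down the tree by the digits
    of its coordinates, which alternate so that deep cells are small in both
    directions. *)
Fixpoint bincode (m : nat) (z : complexes R) : nat :=
  if m is m'.+1 then
    (odd (dyadic m'./2 (if odd m' then X z else Y z)) + (bincode m' z).*2)%N
  else 1%N.

Lemma bincode_half m z : (bincode m.+1 z)./2 = bincode m z.
Proof. by rewrite /= half_bit_double. Qed.

Lemma bincode_digit m z w : bincode m z = bincode m w -> forall j, (j < m)%N ->
  odd (dyadic j./2 (if odd j then X z else Y z)) =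
  odd (dyadic j./2 (if odd j then X w else Y w)).
Proof.
elim: m => // m ih e j; have e' := congr1 half e.
rewrite !bincode_half in e'; rewrite ltnS leq_eqVlt => /predU1P[->|]; last exact: ih.
by have := congr1 odd e; rewrite /= !oddD !odd_double !addbF; do 2!case: (odd (dyadic _ _)).
Qed.
End Code.

(** A dyadic subdivision of a square containing [K]. *)
Lemma exists_code (K : set (complexes R)) : compact K ->
  exists code : nat -> complexes R -> nat,
  [/\ forall z, code 0%N z = 1%N,
      forall m z, (code m.+1 z)./2 = code m z &
      forall e : R, 0 < e -> exists m, forall z w, K z -> K w ->
        code m z = code m w -> modulus (z - w) <= e].
Proof.
move=> cK; have [B B1 KB] := compact_bounded_modulus cK.
pose S := 2 * B + 1; have S0 : 0 < S by rewrite /S; lra.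
pose X (z : complexes R) := (complex.Re (z : R[i]) + B) / S.
pose Y (z : complexes R) := (complex.Im (z : R[i]) + B) / S.
exists (bincode X Y); split => // [m z|e e0]; first exact: bincode_half.
have bnd (t : R) : `|t| <= B -> 0 <= (t + B) / S < 1.
  rewrite ler_norml => /andP[l u].
  by rewrite divr_ge0 ?ltr_pdivrMr ?mul1r /S //; lra.
have X01 z : K z -> 0 <= X z < 1.
  by move=> /KB zB; apply: bnd; exact: le_trans (normRe_le z) zB.
have Y01 z : K z -> 0 <= Y z < 1.
  by move=> /KB zB; apply: bnd; exact: le_trans (normIm_le z) zB.
have [k hk] : exists k : nat, 2 * S * (2 ^+ k)^-1 <= e.
  have h1 : 0 <= (2^-1 : R) < 1 by lra.
  have he : 0 < e / (2 * S) by rewrite divr_gt0 ?mulr_gt0.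
  have [k hk] := expr_lt_eventually h1 he; exists k.
  rewrite mulrC -ler_pdivlMr ?mulr_gt0 // -exprVn; exact/ltW/hk.
(* Digits 0 to [k] of both coordinates. *)
exists (k.+1).*2 => z w Kz Kw zw; have d := bincode_digit zw.
apply: le_trans hk; apply: (le_trans (modulus_le_ReIm _)).
have hX : `|X z - X w| <= (2 ^+ k)^-1.
  apply: dyadic_eq_dist; [exact: X01|exact: X01|] => j jk.
  have := d j.*2.+1; rewrite /= odd_double /= uphalf_double; apply.
  by rewrite doubleS !ltnS leq_double.
have hY : `|Y z - Y w| <= (2 ^+ k)^-1.
  apply: dyadic_eq_dist; [exact: Y01|exact: Y01|] => j jk.
  have := d j.*2; rewrite /= odd_double /= doubleK; apply.
  by rewrite ltn_double.
have sc (t u : R) : (t + B) / S - (u + B) / S = (t - u) / S by field; rewrite gt_eqF.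
move: hX hY; rewrite /X /Y !sc !normrM !(gtr0_norm (_ : 0 < S^-1)) ?invr_gt0 //.
rewrite !ler_pdivrMr // !raddfB /=; lra.
Qed.

End BinaryCodes.

(** * From points to a measure: sampling from masses on a binary tree *)

Section Quantile.
Variable R : realType.
Variable a : nat -> R.
Hypothesis a1 : a 1%N = 1.
Hypothesis a0 : forall i, 0 <= a i.
Hypothesis aD : forall i, (0 < i)%N -> a i = a i.*2 + a i.*2.+1.

(** The half-open unit interval is cut, at each level of the tree, into
    consecutive intervals of lengths [a i]; this is the left end of the one of
    node [i]. *)
Fixpoint left_end (m i : nat) : R :=
  if m is m'.+1 then left_end m' i./2 + (if odd i then a i.-1 else 0) else 0.

Fixpoint node (m : nat) (s : R) : nat :=
  if m is m'.+1 then
    (~~ (s < left_end m' (node m' s) + a (node m' s).*2)%R + (node m' s).*2)%N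
  else 1%N.

Lemma node_half m s : (node m.+1 s)./2 = node m s.
Proof. by rewrite /= half_bit_double. Qed.

Lemma node_range m s : (2 ^ m <= node m s < 2 ^ m.+1)%N.
Proof.
elim: m => //= m ih; rewrite expnS [(2 ^ m.+2)%N]expnS.
move: (node m s) ih => i; case: (_ < _) => /=; lia.
Qed.

Lemma node_itv m s : 0 <= s < 1 ->
  left_end m (node m s) <= s < left_end m (node m s) + a (node m s).
Proof.
move=> s01; elim: m => [|m /andP[l u]]; first by rewrite /= add0r a1.
rewrite [left_end _ _]/= node_half /=; case: ltP => h /=.
  by rewrite add0n odd_double addr0 l.
by rewrite odd_double /= add1n /= h -addrA -aD // (leq_trans _ (andP (node_range m s)).1) // expn_gt0.
Qed.

(** Sends the numbers that are in no interval of level 0 to some number that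
    is in one. *)
Definition clamp (s : R) : R := if (0 <= s < 1) then s else 0.

Lemma clamp01 s : 0 <= clamp s < 1.
Proof. by rewrite /clamp; case: ifP => //; rewrite lexx ltr01. Qed.

Lemma measurable_clamp : measurable_fun [set: R] clamp.
Proof.
apply: measurable_fun_ifT => //; apply: measurable_and.
  exact: measurable_fun_ler.
exact: measurable_fun_ltr.
Qed.

(** The naturals are discrete, so [h] is automatically measurable. *)
Lemma measurable_fun_nat d (T : measurableType d) (h : nat -> T) (f : R -> nat) :
  measurable_fun [set: R] f -> measurable_fun [set: R] (fun s => h (f s)).
Proof.
move=> mf _ B mB; rewrite setTI.
have -> : (fun s => h (f s)) @^-1` B = f @^-1` (h @^-1` B) by [].
by rewrite -[_ @^-1` _]setTI; apply: mf.
Qed.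

Lemma measurable_node m : measurable_fun [set: R] (fun s => node m (clamp s)).
Proof.
elim: m => [|m ih] /=; first exact: measurable_cst.
have mb : measurable_fun [set: R] (fun s => clamp s < left_end m (node m (clamp s)) + a (node m (clamp s)).*2).
  apply: measurable_fun_ltr; first exact: measurable_clamp.
  by apply: measurable_funD; [exact: (measurable_fun_nat (left_end m) ih)|exact: (measurable_fun_nat (fun i => a i.*2) ih)].
have -> : (fun s => (~~ (clamp s < left_end m (node m (clamp s)) + a (node m (clamp s)).*2)%R +
    (node m (clamp s)).*2)%N) = (fun s => if clamp s < left_end m (node m (clamp s)) +
    a (node m (clamp s)).*2 then (node m (clamp s)).*2 else (node m (clamp s)).*2.+1).
  by apply/funext => s; case: ifP.
apply: measurable_fun_ifT => //; first exact: (measurable_fun_nat double ih).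
exact: (measurable_fun_nat (fun i => i.*2.+1) ih).
Qed.

Local Notation P := (uniform_prob (@ltr01 R)).

(** Up to the point 1, the event is the interval of node [i], of length [a i].
    The inequality suffices for upper bounds on energies. *)
Lemma uniform_prob_node_le m i :
  (P ((fun s => node m (clamp s)) @^-1` [set i]) <= (a i)%:E)%E.
Proof.
set E := _ @^-1` _.
have mE : measurable E by rewrite -[E]setTI; exact: measurable_node.
rewrite /uniform_prob integral_uniform_pdf.
apply: (@le_trans _ _ (\int[lebesgue_measure]_(x in E `&` `[0%R, 1%R]) 1)%E).
  apply: ge0_le_integral => //.
  - exact: measurableI.
  - by move=> x _; rewrite lee_fin uniform_pdf_ge0.
  - by apply/measurable_EFinP/measurable_funTS; exact: measurable_uniform_pdf.
  - move=> x _; rewrite lee_fin /uniform_pdf; case: ifP => // _.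
    by rewrite subr0 invr1.
rewrite integral_cst ?mul1e; last exact: measurableI.
have sE : E `&` `[0%R, 1%R] `<=` `[left_end m i, left_end m i + a i[ `|` [set 1].
  move=> s [/= Es]; rewrite !in_itv /= => /andP[s0].
  rewrite le_eqVlt => /predU1P[->|s1]; [by right|left].
  have := node_itv m (clamp01 s); move: Es; rewrite /E /= => ->.
  by rewrite /clamp s0 s1.
apply: (@le_trans _ _ (lebesgue_measure (`[left_end m i, left_end m i + a i[ `|` [set 1]))).
  by apply: le_measure; rewrite ?inE //; [exact: measurableI|exact: measurableU].
apply: (le_trans (measureU2 _ _ _)) => //.
rewrite [X in (_ + X)%E](_ : _ = 0%E); last exact: lebesgue_measure_set1.
rewrite [X in (X + _)%E](lebesgue_measure_itv `[left_end m i, (left_end m i + a i)[).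
rewrite adde0 /= lte_fin.
by case: ifP => _; rewrite ?lee_fin // addrAC subrr add0r.
Qed.

Lemma integral_node_le m (phi : nat -> R) : (forall i, 0 <= phi i) ->
  (\int[P]_s (phi (node m (clamp s)))%:E <=
   (\sum_(2 ^ m <= i < 2 ^ m.+1) a i * phi i)%:E)%E.
Proof.
move=> phi0.
pose E i := (fun s => node m (clamp s)) @^-1` [set i].
have mE i : measurable (E i) by rewrite -[E i]setTI; exact: measurable_node.
have -> : (fun s => (phi (node m (clamp s)))%:E) =
    (fun s => \sum_(i <- index_iota (2 ^ m) (2 ^ m.+1)) (phi i)%:E * (\1_(E i) s)%:E)%E.
  apply/funext => s; rewrite (bigD1_seq (node m (clamp s))) ?iota_uniq //=; last first.
    by rewrite mem_index_iota node_range.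
  rewrite indicE mem_set // mule1 big1 ?adde0 // => i /eqP ni.
  by rewrite indicE memNset ?mule0 // => /esym.
rewrite ge0_integral_sum //.
- rewrite -sumEFin; apply: lee_sum => i _.
  rewrite ge0_integralZl //.
  + rewrite integral_indic //; last exact: mE.
    rewrite setIT muleC EFinM.
    by apply: lee_wpmul2r; rewrite ?lee_fin //; exact: uniform_prob_node_le.
  + by apply/measurable_EFinP; apply: measurable_indic; exact: mE.
  + by rewrite lee_fin.
- move=> i; apply: emeasurable_funM => //; apply/measurable_EFinP.
  by apply: measurable_indic; exact: mE.
- by move=> i s _; rewrite -EFinM lee_fin mulr_ge0.
Qed.

End Quantile.

(** * From points to a measure: the limit masses *)

Section TreeLimit.
Variable R : realType.
Variable code : nat -> complexes R -> nat.
Hypothesis code0 : forall z, code 0%N z = 1%N.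
Hypothesis code_half : forall m z, (code m.+1 z)./2 = code m z.

Lemma code_range m z : (2 ^ m <= code m z < 2 ^ m.+1)%N.
Proof.
elim: m => [|m ih]; first by rewrite code0.
by move: ih; rewrite -code_half !expnS; lia.
Qed.

(** The mass of cell [i] for the uniform measure on the points; the level of
    [i] is the integer part of its binary logarithm. *)
Definition freq (n : nat) (z : nat -> complexes R) (i : nat) : R :=
  (\sum_(k < n) (code (trunc_log 2 i) (z k) == i)%:R) / n%:R.

Lemma freq01 n z i : 0 <= freq n z i <= 1.
Proof.
rewrite divr_ge0 ?sumr_ge0 //=; have [->|n0] := posnP n.
  by rewrite /freq big_ord0 mul0r ler01.
rewrite ler_pdivrMr ?ltr0n // mul1r -[X in _ <= X%:R]card_ord -sum1_card natr_sum.
by apply: ler_sum => k _; rewrite ler_nat leq_b1.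
Qed.

Lemma freq1 n z : (0 < n)%N -> freq n z 1 = 1.
Proof.
move=> n0; rewrite /freq trunc_log1 (eq_bigr (fun=> 1)).
  by rewrite sumr_const card_ord divff // pnatr_eq0 -lt0n.
by move=> k _; rewrite code0 eqxx.
Qed.

Lemma trunc_log2_level m i : (2 ^ m <= i < 2 ^ m.+1)%N -> trunc_log 2 i = m.
Proof. by move=> h; apply: trunc_log_eq. Qed.

Lemma level_trunc_log2 i : (0 < i)%N -> (2 ^ trunc_log 2 i <= i < 2 ^ (trunc_log 2 i).+1)%N.
Proof. by move=> i0; rewrite trunc_logP // trunc_log_ltn. Qed.

(** A point of cell [i] is in exactly one of the two children of [i]. *)
Lemma freqD n z i : (0 < i)%N -> freq n z i = freq n z i.*2 + freq n z i.*2.+1.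
Proof.
move=> i0; have := level_trunc_log2 i0; set m := trunc_log 2 i => im.
have e0 : trunc_log 2 i.*2 = m.+1.
  by apply: trunc_log2_level; rewrite !expnS in im *; lia.
have e1 : trunc_log 2 i.*2.+1 = m.+1.
  by apply: trunc_log2_level; rewrite !expnS in im *; lia.
rewrite /freq e0 e1 -/m -mulrDl -big_split /=; congr (_ / _).
apply: eq_bigr => k _; rewrite -code_half -natrD; congr _%:R.
by move: (code _ _) => c; lia.
Qed.

(** Rewrites sums weighted by masses as averages over the points; used twice, it
    turns an energy of the tree into an average over pairs of points. *)
Lemma freq_sum n z m (phi : nat -> R) :
  \sum_(2 ^ m <= i < 2 ^ m.+1) freq n z i * phi i =
  (\sum_(k < n) phi (code m (z k))) / n%:R.
Proof.
rewrite (eq_big_nat _ _ (F2 := fun i =>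
   (\sum_(k < n) (code m (z k) == i)%:R * phi i) / n%:R)); last first.
  move=> i im; rewrite /freq (trunc_log2_level im) mulrAC; congr (_ / _).
  by rewrite mulr_suml.
rewrite -mulr_suml; congr (_ / _); rewrite exchange_big /=; apply: eq_bigr => k _.
rewrite (bigD1_seq (code m (z k))) ?iota_uniq //=; last first.
  by rewrite mem_index_iota code_range.
by rewrite eqxx mul1r big1 ?addr0 // => i; rewrite eq_sym => /negbTE ->; rewrite mul0r.
Qed.

Variables (K : set (complexes R)) (C : R).
Hypothesis many : forall N : nat, exists n : nat, (N <= n)%N /\
  exists z : nat -> complexes R,
    (forall k, (k < n)%N -> K (z k)) /\ C ^+ 'C(n, 2) <= pairprod z n.

(** A cluster point of the masses of the cells.  Being the masses of a
    probability on the tree is a closed condition, so that it holds for [a]; a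
    cell of positive limit mass contains points of [K] since it has positive mass
    along the sequence. *)
Lemma tree_limit : exists a : nat -> R,
  [/\ a 1%N = 1, forall i, 0 <= a i,
      forall i, (0 < i)%N -> a i = a i.*2 + a i.*2.+1,
      forall m i, (2 ^ m <= i < 2 ^ m.+1)%N -> 0 < a i ->
        exists2 z, K z & code m z = i
    & forall (M N : nat) (e : R), 0 < e -> exists n z,
        [/\ (N < n)%N, forall k, (k < n)%N -> K (z k),
            C ^+ 'C(n, 2) <= pairprod z n &
            forall i, (i < M)%N -> a i <= freq n z i + e]].
Proof.
have /choice[n /all_and2[kn /choice[z /all_and2[Kz Cz]]]] : forall N, exists n, (N < n)%N /\
  exists z : nat -> complexes R,
    (forall k, (k < n)%N -> K (z k)) /\ C ^+ 'C(n, 2) <= pairprod z n.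
  by move=> N; have [n [Nn nz]] := many N.+1; exists n.
have [a ha] := cluster_point_coordinates (fun k i => freq01 (n k) (z k) i).
have n0 k : (0 < n k)%N by apply: leq_ltn_trans (kn k).
have alim (i j k : nat) (e : R) : 0 < e -> exists l,
    [/\ `|freq (n l) (z l) i - a i| < e, `|freq (n l) (z l) j - a j| < e &
        `|freq (n l) (z l) k - a k| < e].
  move=> e0; have [l _ h] := ha (i + j + k).+1 0%N e e0.
  by exists l; split; apply: h; lia.
exists a; split.
- apply/eqP; rewrite -subr_eq0 -normr_le0; apply/ler_addgt0Pr => e e0.
  have [l []] := alim 1%N 1%N 1%N _ e0; rewrite freq1 // distrC add0r => h _ _.
  exact: ltW.
- move=> i; apply/ler_addgt0Pr => e e0; have [l [h _ _]] := alim i i i _ e0.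
  have /andP[f0 _] := freq01 (n l) (z l) i.
  move: h; rewrite ltr_norml => /andP[]; lra.
- move=> i i0; apply/eqP; rewrite -subr_eq0 -normr_le0; apply/ler_addgt0Pr => e e0.
  have e3 : 0 < e / 3 by rewrite divr_gt0.
  have [l []] := alim i i.*2 i.*2.+1 _ e3; rewrite (freqD _ _ i0).
  rewrite !ltr_norml add0r ler_norml => /andP[? ?] /andP[? ?] /andP[? ?].
  apply/andP; split; lra.
- move=> m i im ai; have [l [h _ _]] := alim i i i _ ai.
  have : 0 < freq (n l) (z l) i by move: h; rewrite ltr_norml => /andP[]; lra.
  rewrite /freq (trunc_log2_level im) => f0.
  apply: contrapT => nz; move: f0; rewrite big1 ?mul0r ?ltxx // => k _.
  case: eqP => // ck; exfalso; apply: nz; exists (z l k) => //.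
  exact: Kz (ltn_ord k).
- move=> M N e e0; have [l Nl h] := ha M N e e0.
  exists (n l), (z l); split.
  + exact: leq_ltn_trans (kn l).
  + by move=> k; exact: Kz.
  + exact: Cz.
  + move=> i iM; have := h i iM; rewrite ltr_norml => /andP[]; lra.
Qed.

End TreeLimit.

(** * From points to a measure: truncated kernels *)

Section TruncatedKernel.
Variable R : realType.
Implicit Types z w : complexes R.
Notation borelC := (borel_complexes R).

Lemma ln_prod_gt0 n (F : nat -> R) : (forall i, (i < n)%N -> 0 < F i) ->
  ln (\prod_(i < n) F i) = \sum_(i < n) ln (F i).
Proof.
elim: n => [|n ih] F0; first by rewrite !big_ord0 ln1.
rewrite !big_ord_recr /= lnM ?posrE ?F0 //; last first.
  by apply: prodr_gt0 => i _; apply: F0; exact: leqW.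
by rewrite ih // => i ni; apply: F0; exact: leqW.
Qed.

Variable D : R.
Hypothesis D0 : 0 < D.

(** Distances below [d] count as [d], which makes the kernel bounded and
    Lipschitz; it increases to [logker] as [d] decreases to 0. *)
Definition trunc_ker (d : R) z w : R :=
  Num.max 0 (ln D - ln (Num.max (modulus (z - w)) d)).

Lemma trunc_ker_ge0 d z w : 0 <= trunc_ker d z w.
Proof. by rewrite /trunc_ker le_max lexx. Qed.

(** The logarithm has slope at most [1 / d] beyond [d]. *)
Lemma ln_max_lip (d x y : R) : 0 < d ->
  ln (Num.max x d) - ln (Num.max y d) <= `|x - y| / d.
Proof.
move=> d0; have u0 : 0 < Num.max x d by rewrite lt_max d0 orbT.
have v0 : 0 < Num.max y d by rewrite lt_max d0 orbT.
have vd : d <= Num.max y d by rewrite le_max lexx orbT.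
rewrite -ln_div ?posrE //.
have -> : Num.max x d / Num.max y d = 1 + (Num.max x d - Num.max y d) / Num.max y d.
  by field; rewrite gt_eqF.
apply: le_trans (le_ln1Dx _) _.
  by rewrite ltr_pdivlMr // mulN1r; move: u0; lra.
apply: (@le_trans _ _ (`|x - y| / Num.max y d)).
  rewrite ler_wpM2r ?invr_ge0 ?(ltW v0) //.
  have xy : x - y <= `|x - y| by exact: ler_norm.
  have n0 : 0 <= `|x - y| by [].
  have ym : y <= Num.max y d by rewrite le_max lexx.
  rewrite lerBlDr ge_max; apply/andP; split; lra.
by rewrite ler_wpM2l // lef_pV2 ?posrE.
Qed.

Lemma trunc_ker_lip d z w z' w' : 0 < d ->
  trunc_ker d z w <= trunc_ker d z' w' + (modulus (z - z') + modulus (w - w')) / d.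
Proof.
move=> d0; rewrite /trunc_ker.
have h := ln_max_lip (modulus (z' - w')) (modulus (z - w)) d0.
have h' : `|modulus (z' - w') - modulus (z - w)| / d <= (modulus (z - z') + modulus (w - w')) / d.
  rewrite ler_wpM2r ?invr_ge0 ?(ltW d0) //.
  have t1 : modulus (z - w) <= modulus (z - z') + modulus (z' - w') + modulus (w' - w).
    by apply: le_trans (modulusB_le _ w' _) _; rewrite lerD2r modulusB_le.
  have t2 : modulus (z' - w') <= modulus (z' - z) + modulus (z - w) + modulus (w - w').
    by apply: le_trans (modulusB_le _ w _) _; rewrite lerD2r modulusB_le.
  rewrite ler_norml; move: t1 t2; rewrite (modulusBC w' w) (modulusBC z' z) => *.
  by apply/andP; split; lra.
have p0 : 0 <= (modulus (z - z') + modulus (w - w')) / d.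
  by rewrite divr_ge0 ?(ltW d0) // addr_ge0 ?modulus_ge0.
set A := (X in _ <= Num.max 0 X + _).
have AE : A = ln D - ln (Num.max (modulus (z' - w')) d) by []; clearbody A.
have : A <= Num.max 0 A by rewrite le_max lexx orbT.
have : 0 <= Num.max 0 A by rewrite le_max lexx.
by rewrite ge_max => *; apply/andP; split; lra.
Qed.

Lemma trunc_ker_diag d z : 0 < d -> trunc_ker d z z = Num.max 0 (ln D - ln d).
Proof. by move=> d0; rewrite /trunc_ker subrr modulus0 (max_r (ltW d0)). Qed.

Lemma trunc_ker_le_log d z w : 0 < modulus (z - w) <= D ->
  trunc_ker d z w <= ln D - ln (modulus (z - w)).
Proof.
move=> /andP[m0 mD]; rewrite /trunc_ker ge_max subr_ge0 ler_ln ?posrE // mD /=.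
by rewrite lerD2l lerN2 ler_ln ?posrE ?lt_max ?m0 // le_max lexx.
Qed.

Lemma trunc_kerC d z w : trunc_ker d z w = trunc_ker d w z.
Proof. by rewrite /trunc_ker modulusBC. Qed.

(** Off the diagonal the truncation only decreases the kernel, whose sum over
    pairs is the logarithm of [pairprod] up to sign and an additive term; the
    diagonal contributes [n] copies of the value at distance 0, which are
    negligible against [n ^ 2]. *)
Lemma trunc_energy_points d (z : nat -> complexes R) n : 0 < d ->
  (forall i j, (i < n)%N -> (j < n)%N -> modulus (z i - z j) <= D) ->
  0 < pairprod z n ->
  \sum_(i < n) \sum_(j < n) trunc_ker d (z i) (z j) <=
  n%:R * Num.max 0 (ln D - ln d) + 2 * ('C(n, 2)%:R * ln D - ln (pairprod z n)).
Proof.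
move=> d0; elim: n => [|n ih] zD.
  by rewrite /pairprod !big_ord0 ln1 mul0r mul0r subr0 mulr0 addr0.
rewrite pairprodS => pp.
have p0 : 0 < pairprod z n.
  by rewrite lt_def pairprod_ge0 andbT; apply: contraTneq pp => ->; rewrite mul0r ltxx.
have q0 : 0 < \prod_(i < n) modulus (z n - z i) by move: pp; rewrite pmulr_rgt0.
have m0 i : (i < n)%N -> 0 < modulus (z n - z i).
  move=> ni; rewrite lt_def modulus_ge0 andbT; apply: contraTneq q0 => e.
  by rewrite (bigD1 (Ordinal ni)) //= e mul0r ltxx.
rewrite big_ord_recr /= [X in _ + X]big_ord_recr /=.
under eq_bigr do rewrite big_ord_recr /=.
rewrite big_split /= trunc_ker_diag //.
have -> : \sum_(i < n) trunc_ker d (z i) (z n) = \sum_(i < n) trunc_ker d (z n) (z i).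
  by apply: eq_bigr => i _; rewrite trunc_kerC.
have ihn := ih (fun i j ni nj => zD _ _ (leqW ni) (leqW nj)) p0.
have s1 : \sum_(i < n) trunc_ker d (z n) (z i) <=
    n%:R * ln D - ln (\prod_(i < n) modulus (z n - z i)).
  rewrite (@ln_prod_gt0 n (fun i => modulus (z n - z i))) //.
  have -> : n%:R * ln D = \sum_(i < n) ln D by rewrite sumr_const card_ord mulr_natl.
  rewrite -sumrB; apply: ler_sum => i _; apply: trunc_ker_le_log.
  by rewrite m0 // zD // leqW.
rewrite lnM ?posrE // binS bin1 natrD -natr1; lra.
Qed.

Lemma measurable_trunc_ker d : measurable_fun [set: borelC * borelC]
  (fun x : borelC * borelC => (trunc_ker d x.1 x.2)%:E).
Proof.
apply/measurable_EFinP; apply: measurable_maxr => //.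
apply: measurable_funB => //.
apply: (measurableT_comp (@measurable_ln R)).
by apply: measurable_maxr => //; exact: measurable_dist.
Qed.

Lemma measurable_trunc_ker1 d z :
  measurable_fun [set: borelC] (fun w : borelC => (trunc_ker d z w)%:E).
Proof.
exact: (measurableT_comp (measurable_trunc_ker d) (pair1_measurable (z : borelC))).
Qed.

Lemma trunc_ker_mono z w : {homo (fun n : nat => trunc_ker n.+1%:R^-1 z w) :
  n m / (n <= m)%N >-> n <= m}.
Proof.
move=> n m nm; rewrite /trunc_ker ge_max le_max lexx /= le_max; apply/orP; right.
have dn (k : nat) : 0 < k.+1%:R^-1 :> R by rewrite invr_gt0.
rewrite lerD2l lerN2 ler_ln ?posrE ?lt_max ?dn ?orbT //.
rewrite ge_max le_max lexx /= le_max; apply/orP; right.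
by rewrite lef_pV2 ?posrE // ler_nat.
Qed.

(** Off the diagonal the sequence is eventually constant. *)
Lemma trunc_ker_cvg z w :
  (fun n : nat => (trunc_ker n.+1%:R^-1 z w)%:E) @ \oo --> logker D z w.
Proof.
have dn (k : nat) : 0 < k.+1%:R^-1 :> R by rewrite invr_gt0.
have [m0|m0] := eqVneq (modulus (z - w)) 0.
  have -> : logker D z w = +oo%E by rewrite /logker /log_dist m0 /= lexx /= max_r ?leey.
  apply/cvgeyPge => A; exists (Num.truncn (expR (A - ln D))) => // n /= nk.
  rewrite lee_fin /trunc_ker m0 (max_r (ltW (dn _))) le_max; apply/orP; right.
  rewrite lnV ?posrE // opprK -lerBlDl -(expRK (A - ln D)).
  rewrite ler_ln ?posrE ?expR_gt0 // ltW // (lt_le_trans (truncnS_gt _)) //.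
  by rewrite ler_nat.
have {}m0 : 0 < modulus (z - w) by rewrite lt_def m0 modulus_ge0.
apply: (cvg_near_cst _); exists (Num.truncn (modulus (z - w))^-1) => // n /= nk.
rewrite /logker /log_dist lne_EFin // -EFinB -EFin_max /trunc_ker; congr (Num.max _ (_ - ln _))%:E.
apply: max_l; rewrite -[leRHS]invrK lef_pV2 ?posrE ?invr_gt0 // ltW //.
by rewrite (lt_le_trans (truncnS_gt _)) // ler_nat.
Qed.

End TruncatedKernel.

(** * From points to a measure: the limit measure and its energy *)

Section PointsToMeasure.
Variable R : realType.
Notation borelC := (borel_complexes R).
Variable K : set (complexes R).
Hypothesis cK : compact K.
Variable code : nat -> complexes R -> nat.
Hypothesis code_half : forall m z, (code m.+1 z)./2 = code m z.
Hypothesis code_sep : forall e : R, 0 < e -> exists m, forall z w, K z -> K w ->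
        code m z = code m w -> modulus (z - w) <= e.

Variable a : nat -> R.
Hypothesis a1 : a 1%N = 1.
Hypothesis a0 : forall i, 0 <= a i.
Hypothesis aD : forall i, (0 < i)%N -> a i = a i.*2 + a i.*2.+1.
Hypothesis apos : forall m i, (2 ^ m <= i < 2 ^ m.+1)%N -> 0 < a i ->
        exists2 z, K z & code m z = i.
Definition resolves (m : nat) (e : R) := forall z w, K z -> K w ->
  code m z = code m w -> modulus (z - w) <= e.

Definition cell_point (m i : nat) : complexes R := xget 0 [set z | K z /\ code m z = i].

Lemma cell_pointP m i : (exists2 z, K z & code m z = i) -> K (cell_point m i) /\ code m (cell_point m i) = i.
Proof.
move=> [z Kz zi].
exact: (@xgetPex _ 0 [set z | K z /\ code m z = i] (ex_intro _ z (conj Kz zi))).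
Qed.

Definition cell_of (m : nat) (s : R) : nat := node a m (clamp s).

Lemma cell_point_of m s : K (cell_point m (cell_of m s)) /\ code m (cell_point m (cell_of m s)) = cell_of m s.
Proof.
apply: cell_pointP; apply: apos; first exact: node_range.
have := node_itv a1 aD m (clamp01 s); rewrite -/(cell_of m s); lra.
Qed.

Lemma cell_of_half m s : (cell_of m.+1 s)./2 = cell_of m s.
Proof. exact: node_half. Qed.

(** The nodes of [s] form a branch of the tree, and so do the cells that contain
    a given point. *)
Lemma code_cell_point_of m k s : code m (cell_point (k + m) (cell_of (k + m) s)) = cell_of m s.
Proof.
suff h j z : (j <= k)%N -> code (k + m) z = cell_of (k + m) s -> code (k - j + m) z = cell_of (k - j + m) s.
  have := h k (cell_point (k + m) (cell_of (k + m) s)) (leqnn _) (cell_point_of _ _).2.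
  by rewrite subnn add0n.
elim: j => [|j ih] jk e; first by rewrite subn0.
have := ih (ltnW jk) e; have -> : (k - j + m = (k - j.+1 + m).+1)%N by lia.
by move=> /(congr1 half); rewrite code_half cell_of_half.
Qed.

(** A cluster point of the chosen points of the cells that [s] runs through.  It
    may lie on the border of these cells, and therefore is only asserted to be
    close to their chosen points. *)
Lemma sample_point s : exists x, K x /\
  forall m e, resolves m e -> modulus (x - cell_point m (cell_of m s)) <= e.
Proof.
have [|x [Kx clx]] := cK (F := (fun k => cell_point k (cell_of k s)) @ \oo).
  by exists 0%N => // k _; exact: (cell_point_of k s).1.
exists x; split => // m e me; apply/ler_addgt0Pr => h h0.
have [] := clx ((fun k => cell_point k (cell_of k s)) @` [set k | (m <= k)%N]) (disc x h).
- by exists m => // k /= mk; exists k.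
- exact: nbhs_disc.
- move=> _ [[k /= mk <-] dk].
  apply: (le_trans (modulusB_le _ (cell_point k (cell_of k s)) _)); rewrite addrC; apply: lerD.
    apply: me; [exact: (cell_point_of k s).1|exact: (cell_point_of m s).1|].
    by rewrite -{1 2}(subnK mk) code_cell_point_of (cell_point_of m s).2.
  exact: ltW.
Qed.

(** The limit measure will be the law of [sample s], for [s] uniform on the unit
    interval. *)
Definition sample (s : R) : complexes R := projT1 (cid (sample_point s)).

Lemma sampleK s : K (sample s).
Proof. by rewrite /sample; case: cid => x []. Qed.

Lemma sample_resolves s m e : resolves m e -> modulus (sample s - cell_point m (cell_of m s)) <= e.
Proof. by rewrite /sample; case: cid => x /= [_]; apply. Qed.

(** The value [sample s] is in an open set exactly when, for some level, the
    node of [s] says so, up to the resolution of that level; nodes take countably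
    many values and are measurable. *)
Lemma measurable_sample :
  measurable_fun [set: measurableTypeR R] (sample : measurableTypeR R -> borelC).
Proof.
have gen : @measurable _ borelC = <<s [set U : set (complexes R) | open U] >> by [].
apply: (measurability _ gen).
move=> _ [U oU <-]; rewrite setTI.
pose inv (j : nat) : R := j.+1%:R^-1.
have inv0 j : 0 < inv j by rewrite invr_gt0.
have -> : sample @^-1` U = \bigcup_m \bigcup_(j in [set j | resolves m (inv j)])
    (cell_of m @^-1` [set i | disc (cell_point m i) (2 * inv j) `<=` U]).
  apply/seteqP; split => s /=.
    move=> /(iffLR (open_complexP _) oU)[e e0 sU].
    (* The chosen point is within [inv j] of the sample, and a disc of radius
       [2 * inv j] around it has to lie in the disc of radius [e]. *)
    pose j := Num.truncn (3 / e).
    have je : 3 * inv j < e.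
      by rewrite /inv ltr_pdivrMr // mulrC -ltr_pdivrMr //; exact: truncnS_gt.
    have [m hm] := code_sep (inv0 j).
    exists m => //; exists j => //= u; rewrite /disc /= => ru; apply: sU.
    apply: (le_lt_trans (modulusB_le _ (cell_point m (cell_of m s)) _)).
    apply: le_lt_trans je; have := sample_resolves s hm; lra.
  move=> [m _ [j /= mj]]; apply; rewrite /disc /= modulusBC.
  apply: (le_lt_trans (sample_resolves s mj)); have := inv0 j; lra.
apply: bigcup_measurable => m _; apply: bigcup_measurable => j _.
by rewrite -[_ @^-1` _]setTI; apply: measurable_node.
Qed.

Local Notation P := (uniform_prob (@ltr01 R)).
Let sampleB : measurableTypeR R -> borelC := sample.
Let sample_mixin := isMeasurableFun.Build _ _ _ _ _ measurable_sample.
Let sample_mfun : {mfun _ >-> _} := HB.pack sampleB sample_mixin.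

Definition limit_measure : probability borelC R := distribution P sample_mfun.

Lemma limit_measureK : limit_measure K = 1%E.
Proof.
rewrite /limit_measure /= /distribution /pushforward.
have -> : sample @^-1` K = setT by apply/seteqP; split => // s _; exact: sampleK.
exact: probability_setT.
Qed.

Lemma integral_limit_measure (G : borelC -> \bar R) :
  measurable_fun [set: borelC] G -> (forall z, 0 <= G z)%E ->
  (\int[limit_measure]_(z in (K : set borelC)) G z = \int[P]_s G (sample s))%E.
Proof.
move=> mG G0; rewrite (ge0_integral_pushforward measurable_sample) //.
- congr (integral _ _ _); apply/seteqP; split => // s _; exact: sampleK.
- exact: (measurable_compact cK).
- exact: measurable_funTS.
Qed.

Hypothesis code0 : forall z, code 0%N z = 1%N.
Variables C D : R.
Hypotheses (C0 : 0 < C) (CD : C <= D).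
Hypothesis KD : forall z w, K z -> K w -> modulus (z - w) <= D.
Hypothesis alim : forall (M N : nat) (e : R), 0 < e -> exists n z,
        [/\ (N < n)%N, forall k, (k < n)%N -> K (z k),
            C ^+ 'C(n, 2) <= pairprod z n &
            forall i, (i < M)%N -> a i <= freq code n z i + e].

Let D0 : 0 < D. Proof. exact: lt_le_trans CD. Qed.
Let Bd : R := ln D - ln C.
Let Bd0 : 0 <= Bd.
Proof. by rewrite /Bd subr_ge0 ler_ln ?posrE. Qed.

(** An upper bound of the truncated kernel on pairs of points that are within [e]
    of the chosen points of cells [i] and [j]. *)
Definition cell_ker (d e : R) (m i j : nat) : R :=
  trunc_ker D d (cell_point m i) (cell_point m j) + 2 * e / d.

Lemma cell_ker_ge0 d e m i j : 0 < d -> 0 <= e -> 0 <= cell_ker d e m i j.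
Proof.
move=> d0 e0; rewrite addr_ge0 ?trunc_ker_ge0 // divr_ge0 ?(ltW d0) //.
by rewrite mulr_ge0.
Qed.

(** Finitely many cells matter, so the limit masses may be replaced by those of
    the uniform measure on [n] points, with [n] as large as desired; there
    [trunc_energy_points] and the lower bound on [pairprod] apply. *)
Lemma tree_energy_le (d e : R) (m : nat) : 0 < d -> 0 <= e -> resolves m e ->
  \sum_(2 ^ m <= i < 2 ^ m.+1) a i *
    (\sum_(2 ^ m <= j < 2 ^ m.+1) a j * cell_ker d e m i j) <= Bd + 4 * e / d.
Proof.
move=> d0 e0 me; apply/ler_addgt0Pr => eta eta0.
pose S (f g : nat -> R) := \sum_(2 ^ m <= i < 2 ^ m.+1) f i *
    (\sum_(2 ^ m <= j < 2 ^ m.+1) g j * cell_ker d e m i j).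
pose Phi := S (fun=> 1) (fun=> 1).
have c0 i j : 0 <= cell_ker d e m i j by exact: cell_ker_ge0.
have Phi0 : 0 <= Phi.
  by apply: sumr_ge0 => i _; rewrite mul1r sumr_ge0 // => j _; rewrite mul1r.
pose M := Num.max 0 (ln D - ln d).
have M0 : 0 <= M by rewrite /M le_max lexx.
(* [(f i + h) (f j + h) <= f i * f j + 3 h] for [f] and [h] at most 1, so this
   costs [3 h Phi <= eta / 2]; the other half is for the diagonal terms. *)
pose h := Num.min 1 (eta / (6 * (Phi + 1))).
have h0 : 0 < h by rewrite /h lt_min ltr01 divr_gt0 // mulr_gt0 // ltr_wpDl.
have h1 : h <= 1 by rewrite /h ge_min lexx.
have hPhi : 3 * h * Phi <= eta / 2.
  have : h <= eta / (6 * (Phi + 1)) by rewrite /h ge_min lexx orbT.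
  rewrite ler_pdivlMr ?mulr_gt0 ?ltr_wpDl // => hh; nra.
have [n [z [nN Kz Cz az]]] := alim (2 ^ m.+1)%N (Num.truncn (2 * M / eta)) h0.
have n0 : 0 < n%:R :> R by rewrite ltr0n (leq_ltn_trans _ nN).
have nM : M / n%:R <= eta / 2.
  have : 2 * M / eta < n%:R.
    by apply: lt_le_trans (truncnS_gt _) _; rewrite ler_nat.
  rewrite ltr_pdivrMr // ler_pdivrMr // => *; lra.
pose f := freq code n z.
have f01 i : 0 <= f i <= 1 by exact: freq01.
have fE : f = freq code n z by []; clearbody f.
have step1 : S a a <= S f f + 3 * h * Phi.
  rewrite /S /Phi /S mulr_sumr -big_split /= ler_sum_nat // => i /andP[_ i2].
  rewrite mulr_sumr mul1r !mulr_sumr -big_split /= ler_sum_nat // => j /andP[_ j2].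
  rewrite mul1r !mulrA -mulrDl ler_wpM2r //.
  have /andP[fi0 fi1] := f01 i; have /andP[fj0 fj1] := f01 j.
  have ai := az i i2; have aj := az j j2; rewrite -fE in ai aj.
  apply: (@le_trans _ _ ((f i + h) * (f j + h))).
    by apply: ler_pM.
  have hh (x : R) : x <= 1 -> 0 <= h * (1 - x) by move=> x1; apply: mulr_ge0; [exact: ltW|rewrite subr_ge0].
  have := hh _ fi1; have := hh _ fj1; have := hh _ h1.
  rewrite !mulrBr !mulr1 mulrDl !mulrDr [f i * h]mulrC; lra.
have step2 : S f f <= M / n%:R + Bd + 4 * e / d.
  rewrite /S fE freq_sum //.
  under eq_bigr do rewrite freq_sum //.
  rewrite -mulr_suml.
  have tp : \sum_(k < n) \sum_(l < n) cell_ker d e m (code m (z k)) (code m (z l)) <=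
      \sum_(k < n) \sum_(l < n) (trunc_ker D d (z k) (z l) + 4 * e / d).
    apply: ler_sum => k _; apply: ler_sum => l _.
    have near (p : 'I_n) : modulus (cell_point m (code m (z p)) - z p) <= e.
      have [|Kr cr] := @cell_pointP m (code m (z p)); first by exists (z p) => //; exact: Kz.
      by apply: me => //; exact: Kz.
    have := trunc_ker_lip D (cell_point m (code m (z k))) (cell_point m (code m (z l))) (z k) (z l) d0.
    rewrite /cell_ker.
    have : (modulus (cell_point m (code m (z k)) - z k) + modulus (cell_point m (code m (z l)) - z l)) / d <= 2 * e / d.
      by rewrite ler_wpM2r ?invr_ge0 ?(ltW d0) // mulr_natl mulr2n lerD.
    have -> : 4 * e / d = 2 * e / d + 2 * e / d by field; rewrite gt_eqF.
    lra.
  have pp : 0 < pairprod z n by apply: lt_le_trans Cz; rewrite exprn_gt0.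
  have te := trunc_energy_points D0 d0 (fun i j ni nj => KD (Kz i ni) (Kz j nj)) pp.
  have lnV : 'C(n, 2)%:R * ln C <= ln (pairprod z n).
    by rewrite mulr_natl -lnXn // ler_ln ?posrE // exprn_gt0.
  have bin : 2 * 'C(n, 2)%:R <= n%:R ^+ 2 :> R.
    rewrite -natrM -natrX ler_nat; rewrite bin2 mul2n.
    by apply: (leq_trans (n := n * n.-1)); rewrite ?halfK ?leq_subr // -mulnn leq_mul // leq_pred.
  rewrite -mulrA -invfM ler_pdivrMr ?mulr_gt0 //.
  apply: (le_trans tp).
  under eq_bigr do rewrite big_split /= sumr_const card_ord.
  rewrite big_split /= sumr_const card_ord -mulrnA -[(4 * e / d) *+ _]mulr_natl natrM -mulrA.
  have -> : (M / n%:R + Bd + 4 * e / d) * (n%:R * n%:R) =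
     n%:R * M + n%:R ^+ 2 * Bd + n%:R * (n%:R * (4 * e / d)).
    by field; rewrite !gt_eqF.
  rewrite lerD2r; apply: (le_trans te); rewrite lerD2l.
  apply: (@le_trans _ _ (2 * 'C(n, 2)%:R * Bd)); last by rewrite ler_wpM2r.
  by rewrite /Bd -mulrA ler_wpM2l // mulrBr lerD2l lerN2.
have : S a a <= S f f + 3 * h * Phi by [].
rewrite -/(S a a); lra.
Qed.

(** Replacing the points by the chosen points of their cells changes the
    truncated kernel by a multiple of [e / d], which is made small by refining
    the level. *)
Lemma trunc_energy_le (d : R) : 0 < d ->
  (\int[limit_measure]_(z in (K : set borelC)) \int[limit_measure]_(w in (K : set borelC))
     (trunc_ker D d z w)%:E <= Bd%:E)%E.
Proof.
move=> d0; set mu := limit_measure.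
pose J (z : borelC) := (\int[mu]_(w in (K : set borelC)) (trunc_ker D d z w)%:E)%E.
have mJ : measurable_fun [set: borelC] J.
  apply: (@measurable_potential _ K cK mu (fun z w => (trunc_ker D d z w)%:E)).
    exact: measurable_trunc_ker.
  by move=> z w; rewrite lee_fin trunc_ker_ge0.
have J0 z : (0 <= J z)%E.
  by apply: integral_ge0 => w _; rewrite lee_fin trunc_ker_ge0.
rewrite -/J integral_limit_measure //.
apply/lee_addgt0Pr => eps eps0.
(* The error [4 e / d] of [tree_energy_le] becomes [eps]. *)
pose e := eps * d / 4.
have e0 : 0 < e by rewrite /e divr_gt0 // mulr_gt0.
have [m hm] := code_sep e0.
have me : resolves m e by [].
have c0 i j : 0 <= cell_ker d e m i j by apply: cell_ker_ge0 => //; exact: ltW.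
pose psi i := \sum_(2 ^ m <= j < 2 ^ m.+1) a j * cell_ker d e m i j.
have psi0 i : 0 <= psi i by apply: sumr_ge0 => j _; rewrite mulr_ge0.
have Jle s : (J (sample s) <= (psi (cell_of m s))%:E)%E.
  rewrite /J integral_limit_measure; last 2 first.
  - exact: measurable_trunc_ker1.
  - by move=> w; rewrite lee_fin trunc_ker_ge0.
  apply: (@le_trans _ _ (\int[P]_t (cell_ker d e m (cell_of m s) (cell_of m t))%:E)%E); last exact: (integral_node_le a1 a0 aD m (c0 (cell_of m s))).
  apply: ge0_le_integral => //.
  - by move=> t _; rewrite lee_fin trunc_ker_ge0.
  - exact: (measurableT_comp (measurable_trunc_ker1 D d (sample s)) measurable_sample).
  - apply/measurable_EFinP.
    exact: (measurable_fun_nat (cell_ker d e m (cell_of m s)) (measurable_node a m)).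
  - move=> t _; rewrite lee_fin.
    apply: (le_trans (trunc_ker_lip D _ _ (cell_point m (cell_of m s)) (cell_point m (cell_of m t)) d0)).
    rewrite /cell_ker lerD2l ler_wpM2r ?invr_ge0 ?(ltW d0) //.
    by rewrite mulr_natl mulr2n lerD ?sample_resolves.
apply: (@le_trans _ _ (\int[P]_s (psi (cell_of m s))%:E)%E).
  apply: ge0_le_integral => //.
  - by move=> s _; exact: J0.
  - exact: (measurableT_comp mJ measurable_sample).
  - apply/measurable_EFinP; exact: (measurable_fun_nat psi (measurable_node a m)).
  - by move=> s _; exact: Jle.
apply: (@le_trans _ _ (\sum_(2 ^ m <= i < 2 ^ m.+1) a i * psi i)%:E).
  exact: (integral_node_le a1 a0 aD m psi0).
rewrite lee_fin; apply: (le_trans (tree_energy_le d0 (ltW e0) me)).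
rewrite lerD2l /e le_eqVlt; apply/orP; left; apply/eqP.
by field; rewrite gt_eqF.
Qed.

(** The bound does not depend on the truncation, and passes to the limit by
    monotone convergence, in both variables. *)
Lemma kenergy_limit_le : (kenergy K D limit_measure <= Bd%:E)%E.
Proof.
set mu := limit_measure.
pose J (n : nat) (z : borelC) :=
  (\int[mu]_(w in (K : set borelC)) (trunc_ker D n.+1%:R^-1 z w)%:E)%E.
have mK := measurable_compact cK.
have dn (k : nat) : 0 < k.+1%:R^-1 :> R by rewrite invr_gt0.
have mJ n : measurable_fun [set: borelC] (J n).
  apply: (@measurable_potential _ K cK mu (fun z w => (trunc_ker D n.+1%:R^-1 z w)%:E)).
    exact: measurable_trunc_ker.
  by move=> z w; rewrite lee_fin trunc_ker_ge0.
have J0 n z : (0 <= J n z)%E.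
  by apply: integral_ge0 => w _; rewrite lee_fin trunc_ker_ge0.
have Jnd z n k : (n <= k)%N -> (J n z <= J k z)%E.
  move=> nk; apply: ge0_le_integral => //.
  - by move=> w _; rewrite lee_fin trunc_ker_ge0.
  - by apply: measurable_funTS; exact: measurable_trunc_ker1.
  - by apply: measurable_funTS; exact: measurable_trunc_ker1.
  - by move=> w _; rewrite lee_fin; exact: trunc_ker_mono.
have potE z : kpotential K D mu z = limn (fun n => J n z).
  rewrite /kpotential.
  transitivity (\int[mu]_(w in (K : set borelC)) limn (fun n => (trunc_ker D n.+1%:R^-1 z w)%:E))%E.
    by apply: eq_integral => w _; apply/esym/cvg_lim => //; exact: trunc_ker_cvg.
  apply: monotone_convergence => //.
  - by move=> n; apply: measurable_funTS; exact: measurable_trunc_ker1.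
  - by move=> n w _; rewrite lee_fin trunc_ker_ge0.
  - by move=> w _ n k nk; rewrite lee_fin; exact: trunc_ker_mono.
rewrite /kenergy.
rewrite (eq_integral (fun z => limn (fun n => J n z))); last by move=> z _; exact: potE.
rewrite monotone_convergence //; last first.
- by move=> z _ n k; exact: Jnd.
- by move=> n; apply: measurable_funTS; exact: mJ.
apply: lime_le.
  apply: ereal_nondecreasing_is_cvgn => n k nk; apply: ge0_le_integral => //.
  - by apply: measurable_funTS; exact: mJ.
  - by apply: measurable_funTS; exact: mJ.
  - by move=> z _; exact: Jnd.
by apply: nearW => n; exact: trunc_energy_le.
Qed.

Lemma log_energy_limit_ge : ((ln C)%:E <= log_energy K limit_measure)%E.
Proof.
rewrite (log_energy_kenergy cK D0 KD limit_measureK).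
have := kenergy_limit_le; rewrite /Bd => h.
rewrite leeBrDr; last first.
  by rewrite ge0_fin_numE ?kenergy_ge0 // (le_lt_trans h) // ltry.
rewrite addeC -leeBrDr //.
Qed.

End PointsToMeasure.

(** The uniform measures on the given points accumulate at a measure of energy at
    least [ln C]. *)
Lemma log_capacity_ge (R : realType) (K : set (complexes R)) (C : R) :
  compact K -> 0 < C ->
  (forall N : nat, exists n : nat, (N <= n)%N /\
    exists z : nat -> complexes R,
      (forall k, (k < n)%N -> K (z k)) /\ C ^+ 'C(n, 2) <= pairprod z n) ->
  (C%:E <= log_capacity K)%E.
Proof.
move=> cK C0 many.
have [B B1 KB] := compact_bounded_modulus cK.
have KD z w : K z -> K w -> modulus (z - w) <= Num.max C (2 * B).
  move=> /KB zB /KB wB; rewrite le_max; apply/orP; right.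
  apply: (le_trans (modulusD _ _)); rewrite modulusN; lra.
have CD : C <= Num.max C (2 * B) by rewrite le_max lexx.
have [code [code0 code_half code_sep]] := exists_code cK.
have [a [a1 a0 aD apos alim]] := tree_limit code0 code_half many.
have -> : C%:E = expeR (ln C)%:E by rewrite /= lnK ?posrE.
rewrite lee_expeR; apply: le_ereal_sup_tmp.
pose mu := limit_measure cK code_half code_sep a1 aD apos.
exists (log_energy K mu); last exact: (log_energy_limit_ge cK code_half code_sep a1 a0 aD apos code0 C0 CD KD alim).
by exists mu => //; exact: limit_measureK.
Qed.

(** * From a measure to points: greedy choice *)

Section MeasureToPoints.
Variable R : realType.
Notation borelC := (borel_complexes R).
Variables (K : set (complexes R)) (D : R).
Hypotheses (cK : compact K) (D0 : 0 < D).
Hypothesis KD : forall z w, K z -> K w -> modulus (z - w) <= D.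
Variable mu : probability borelC R.
Hypothesis muK : mu K = 1%E.

Local Notation G := (logker D).
Local Notation V := (kpotential K D mu).
Local Notation E0 := (kenergy K D mu).

Lemma exists_lt_integral (h : borelC -> \bar R) (c : R) :
  measurable_fun (K : set borelC) h -> (forall z, 0 <= h z)%E -> 0 <= c ->
  (\int[mu]_(z in (K : set borelC)) h z < c%:E)%E ->
  exists2 z, K z & (h z < c%:E)%E.
Proof.
move=> mh h0 c0 hc; apply: contrapT => nh; move: hc; rewrite ltNge => /negP; apply.
have <- : (\int[mu]_(x in (K : set borelC)) c%:E = c%:E)%E.
  rewrite integral_cst //; last exact: (measurable_compact cK).
  by rewrite [X in (_ * X)%E](_ : _ = 1%E) ?mule1.
apply: ge0_le_integral => //; first exact: (measurable_compact cK).
move=> z Kz; rewrite leNgt; apply/negP => hz; apply: nh.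
by exists z.
Qed.

Fixpoint pair_energy (l : seq (complexes R)) : \bar R :=
  if l is x :: l' then (pair_energy l' + \sum_(w <- l') G w x)%E else 0%E.

Lemma pair_energy_ge0 l : (0 <= pair_energy l)%E.
Proof.
elim: l => //= x l ih; apply: adde_ge0 => //; apply: sume_ge0 => w _.
exact: logker_ge0.
Qed.

(** The expectation of the pair energy of [l] followed by [r] independent random
    points. *)
Definition expected_energy (l : seq (complexes R)) (r : nat) : \bar R :=
  (pair_energy l + r%:R%:E * \sum_(w <- l) V w + 'C(r, 2)%:R%:E * E0)%E.

(** The expectation is the average over the next point [z] of the expectation
    for [z :: l], so that some [z] does not increase it beyond [c]. *)
Lemma greedy_points (c : R) r l : 0 <= c -> (forall w, w \in l -> K w) ->
  (expected_energy l r < c%:E)%E ->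
  exists l', [/\ size l' = (r + size l)%N, forall w, w \in l' -> K w &
    (pair_energy l' < c%:E)%E].
Proof.
move=> c0; elim: r l => [|r ih] l lK.
  by rewrite /expected_energy bin0n mul0e !adde0 mul0e adde0 => h; exists l.
move=> h; have mK := measurable_compact cK.
have V0 z : (0 <= V z)%E by exact: kpotential_ge0.
have sV0 : (0 <= \sum_(w <- l) V w)%E by apply: sume_ge0 => w _.
have E00 : (0 <= E0)%E by exact: kenergy_ge0.
have r0 (k : nat) : (0 <= k%:R%:E :> \bar R)%E by rewrite lee_fin.
pose A := (pair_energy l + r%:R%:E * (\sum_(w <- l) V w) + 'C(r, 2)%:R%:E * E0)%E.
have A0 : (0 <= A)%E.
  by rewrite !adde_ge0 ?pair_energy_ge0 // mule_ge0.
have hA : expected_energy l r.+1 = (A + (\sum_(w <- l) V w + r%:R%:E * E0))%E.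
  rewrite /expected_energy /A binS bin1 natrD EFinD ge0_muleDl //.
  rewrite -natr1 EFinD ge0_muleDl // mul1e.
  by rewrite [X in (X + _)%E = _]addeA addeACA.
have Afin : A \is a fin_num.
  rewrite ge0_fin_numE //; apply: le_lt_trans (ltry c).
  apply: le_trans (ltW h); rewrite hA leeDl //.
  by rewrite adde_ge0 // mule_ge0.
pose f (z : borelC) := (A + (\sum_(w <- l) G w z + r%:R%:E * V z))%E.
have mG w : measurable_fun [set: borelC] (fun z : borelC => G w z).
  exact: measurable_logker1.
have mV : measurable_fun [set: borelC] (fun z : borelC => V z).
  exact: measurable_kpotential.
have msum : measurable_fun [set: borelC] (fun z : borelC => \sum_(w <- l) G w z)%E.
  exact: emeasurable_sum.
have mrV : measurable_fun [set: borelC] (fun z : borelC => r%:R%:E * V z)%E.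
  exact: emeasurable_funM.
have f1 z : (0 <= \sum_(w <- l) G w z)%E by apply: sume_ge0 => w _; exact: logker_ge0.
have f2 z : (0 <= r%:R%:E * V z)%E by rewrite mule_ge0.
have intf : (\int[mu]_(z in (K : set borelC)) f z = expected_energy l r.+1)%E.
  rewrite hA /f ge0_integralD //; last 2 first.
  - by move=> z _; exact: adde_ge0.
  - by apply: measurable_funTS; exact: emeasurable_funD.
  rewrite ge0_integralD //; last 2 first.
  - exact: measurable_funTS.
  - exact: measurable_funTS.
  rewrite ge0_integral_sum //; last 2 first.
  - by move=> w; exact: measurable_funTS.
  - by move=> w z _; exact: logker_ge0.
  rewrite ge0_integralZl //; last exact: measurable_funTS.
  congr (_ + _)%E; rewrite -(fineK Afin) integral_cst //.
  by rewrite [X in (_ * X)%E](_ : _ = 1%E) ?mule1.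
have [||//||z Kz fz] := @exists_lt_integral f c.
- by apply: measurable_funTS; apply: emeasurable_funD => //; exact: emeasurable_funD.
- by move=> z; apply: adde_ge0 => //; exact: adde_ge0.
- by rewrite intf.
have [|| l' [sl' Kl' el']] := ih (z :: l).
- by move=> w; rewrite inE => /predU1P[->|/lK].
- apply: le_lt_trans fz; rewrite /expected_energy /f /A /= big_cons ge0_muleDr //.
  rewrite le_eqVlt; apply/orP; left; apply/eqP.
  by rewrite [(_ * V z + _)%E]addeC [X in (X + _)%E = _]addeACA [LHS]addeAC.
by exists l'; split => //; rewrite sl' /= addSnnS.
Qed.

Lemma prod_dist_ge x (l : seq (complexes R)) (q : R) : K x -> (forall w, w \in l -> K w) ->
  (\sum_(w <- l) G w x <= q%:E)%E ->
  expR ((size l)%:R * ln D - q) <= \prod_(w <- l) modulus (x - w).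
Proof.
move=> Kx; elim: l q => [|w l ih] q lK.
  by rewrite !big_nil lee_fin mul0r sub0r => q0; rewrite -expR0 ler_expR oppr_le0.
rewrite !big_cons => h.
have s0 : (0 <= \sum_(w <- l) G w x)%E by apply: sume_ge0 => u _; exact: logker_ge0.
have Kw : K w by apply: lK; rewrite mem_head.
have [g [gE g0]] : exists g : R, G w x = g%:E /\ 0 <= g.
  have : (G w x < +oo)%E by rewrite (le_lt_trans _ (ltry q)) // (le_trans _ h) // leeDl.
  rewrite -ge0_fin_numE ?logker_ge0 // => /fineK <-; exists (fine (G w x)); split => //.
  by apply: fine_ge0; exact: logker_ge0.
rewrite gE addeC -leeBrDr // -EFinB in h.
have {ih} := ih _ (fun u ul => lK u (mem_behead (s := w :: l) ul)) h.
have mwx : expR (ln D - g) <= modulus (x - w).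
  have := log_dist_logker D0 KD Kw Kx; rewrite gE /log_dist modulusBC -EFinB /=.
  case: ifP => // /negbT; rewrite -ltNge => m0 [<-].
  by rewrite lnK.
move=> ih; apply: (@le_trans _ _ (expR (ln D - g) * expR ((size l)%:R * ln D - (q - g)))).
  rewrite -expRD ler_expR /= -natr1; lra.
by apply: ler_pM => //; exact: expR_ge0.
Qed.

(** The list grows at its head while [pairprod] numbers the points from the first
    one, whence the reversal. *)
Lemma pairprod_ge l (A : R) : (forall w, w \in l -> K w) -> (pair_energy l <= A%:E)%E ->
  expR ('C(size l, 2)%:R * ln D - A) <= pairprod (nth 0 (rev l)) (size l).
Proof.
elim: l A => [|x l ih] A lK /=.
  by rewrite lee_fin /pairprod big_ord0 bin0n mul0r sub0r => A0; rewrite -expR0 ler_expR oppr_le0.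
move=> h.
have s0 : (0 <= \sum_(w <- l) G w x)%E by apply: sume_ge0 => u _; exact: logker_ge0.
have [p [pE p0]] : exists p : R, pair_energy l = p%:E /\ 0 <= p.
  have : (pair_energy l < +oo)%E by rewrite (le_lt_trans _ (ltry A)) // (le_trans _ h) // leeDl.
  rewrite -ge0_fin_numE ?pair_energy_ge0 // => /fineK <-; exists (fine (pair_energy l)); split => //.
  by apply: fine_ge0; exact: pair_energy_ge0.
rewrite pE addeC -leeBrDr // -EFinB in h.
have lK' u : u \in l -> K u by move=> ul; apply: lK; rewrite inE ul orbT.
have {}h := prod_dist_ge (lK x (mem_head _ _)) lK' h.
have {ih} := ih p lK'; rewrite pE => /(_ (lexx _)) ih.
have -> : pairprod (nth 0 (rev (x :: l))) (size l).+1 =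
    pairprod (nth 0 (rev l)) (size l) * \prod_(w <- l) modulus (x - w).
  rewrite pairprodS rev_cons; congr (_ * _).
    apply: eq_bigr => j _; apply: eq_bigr => i _.
    by rewrite !nth_rcons size_rev ltn_ord (ltn_trans (ltn_ord i) (ltn_ord j)).
  rewrite -(perm_big _ (permEl (perm_rev l))) (big_nth 0) /= size_rev big_mkord.
  by apply: eq_bigr => i _; rewrite !nth_rcons size_rev ltnn eqxx ltn_ord.
apply: (@le_trans _ _ (expR ('C(size l, 2)%:R * ln D - p) * expR ((size l)%:R * ln D - (A - p)))).
  rewrite -expRD ler_expR binS bin1 natrD; lra.
by apply: ler_pM => //; exact: expR_ge0.
Qed.

Lemma points_of_energy (E : R) n : (1 < n)%N -> (E0 < E%:E)%E ->
  exists z : nat -> complexes R, (forall k, (k < n)%N -> K (z k)) /\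
    expR ((ln D - E) *+ 'C(n, 2)) <= pairprod z n.
Proof.
move=> n1 hE; have E00 : (0 <= E0)%E by exact: kenergy_ge0.
have Epos : 0 <= E by rewrite -lee_fin (le_trans E00) // ltW.
have b0 : 0 < 'C(n, 2)%:R :> R by rewrite ltr0n bin_gt0.
have [|||l [sl Kl el]] := @greedy_points ('C(n, 2)%:R * E) n [::].
- by rewrite mulr_ge0.
- by [].
- rewrite /expected_energy /= big_nil mule0 !add0e EFinM.
  by rewrite lte_pmul2l.
rewrite addn0 in sl; exists (nth 0 (rev l)); split.
  by move=> k kn; apply: Kl; rewrite -mem_rev mem_nth // size_rev sl.
have := pairprod_ge Kl (ltW el); by rewrite sl -[(_ - _) *+ _]mulr_natl mulrBr.
Qed.

End MeasureToPoints.

(** Random points drawn from a measure whose energy exceeds [ln C] have such a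
    product of distances on average. *)
Lemma points_of_capacity (R : realType) (K : set (complexes R)) (C : R) n :
  compact K -> 0 < C -> (C%:E < log_capacity K)%E ->
  exists z : nat -> complexes R, (forall k, (k < n)%N -> K (z k)) /\
    C ^+ 'C(n, 2) <= pairprod z n.
Proof.
move=> cK C0 hC.
have [B B1 KB] := compact_bounded_modulus cK.
have KD z w : K z -> K w -> modulus (z - w) <= 2 * B.
  move=> /KB zB /KB wB; apply: (le_trans (modulusD _ _)); rewrite modulusN; lra.
have D0 : 0 < 2 * B by lra.
have : (C%:E < log_capacity K)%E by [].
have -> : C%:E = expeR (ln C)%:E by rewrite /= lnK ?posrE.
rewrite lte_expeR => /ereal_sup_gt[_ [mu muK <-]].
rewrite (log_energy_kenergy cK D0 KD muK) => hE.
have [n1|] := ltnP 1 n; last first.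
  case: n => [|[|//]] _; first by exists (fun=> 0); rewrite /pairprod big_ord0 bin0n expr0.
  have [z Kz] : K !=set0.
    apply/set0P/eqP => K0; move: muK; rewrite /= K0 measure0 => /eqP.
    by rewrite eqe eq_sym oner_eq0.
  exists (fun=> z); split => //.
  by rewrite /pairprod big_ord1 big_ord0 bin_small // expr0.
have [|z [Kz hz]] := @points_of_energy _ K _ cK D0 KD mu muK (ln (2 * B) - ln C) n n1.
  move: hE; rewrite EFinB; move: (kenergy_ge0 K (2 * B) mu).
  by case: (kenergy _ _ _) => [r _| //|//]; rewrite -!EFinB !lte_fin; lra.
exists z; split => //; move: hz; rewrite subKr -lnXn // lnK // posrE exprn_gt0 //.
Qed.

(** * The capacity of a connected set is at least a quarter of its diameter *)

Section UnitCircle.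
Variable R : realType.
Implicit Types (z w : complexes R) (p : {poly complexes R}).

(** Instead of averaging over the circle, average over [w] and [- w] only: this
    keeps the monomials of the parity of [n], hence, up to a power of [w], a
    polynomial in [w ^+ 2] of half the degree. *)
Lemma unit_circle_coef n p : (size p <= n.+1)%N ->
  exists2 w, modulus w = 1 & modulus p`_n <= modulus p.[w].
Proof.
elim/ltn_ind: n p => -[|n] ih p sp.
  by exists 1; rewrite ?modulus1 // (size1_polyC sp) hornerC coefC eqxx.
(* The part whose coefficients have the parity of the degree, as a polynomial in
   the square of the variable. *)
pose q := if odd n.+1 then odd_poly p else even_poly p.
have qn : q`_(n.+1)./2 = p`_n.+1.
  rewrite /q; case: ifP => on; rewrite ?coef_odd_poly ?coef_even_poly; congr (p`_ _).
    by rewrite -[RHS]odd_double_half on.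
  by rewrite -[RHS]odd_double_half on.
have sq : (size q <= (n.+1)./2.+1)%N.
  apply/leq_sizeP => j hj; rewrite /q; case: ifP => on;
    rewrite ?coef_odd_poly ?coef_even_poly nth_default //; apply: leq_trans sp _;
    have := odd_double_half n.+1; rewrite on; move: (_./2) hj => h; lia.
have [|v v1 hv] := ih (n.+1)./2 _ q sq; first by lia.
pose w := sqrtC v.
have w2 : w ^+ 2 = v by rewrite sqrtCK.
have w1 : modulus w = 1.
  by apply/eqP; rewrite -(@eqrXn2 _ 2) ?modulus_ge0 // -modulusX w2 v1 expr1n.
have pE u : p.[u] = (even_poly p).[u ^+ 2] + (odd_poly p).[u ^+ 2] * u.
  by rewrite -{1}(poly_even_odd p) !hornerE !horner_comp !hornerE.
have wN1 : modulus (- w) = 1 by rewrite modulusN.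
suff : modulus q.[v] <= modulus p.[w] \/ modulus q.[v] <= modulus p.[- w].
  by rewrite -qn => -[h|h]; [exists w|exists (- w)] => //; exact: le_trans hv h.
have pw := pE w; have pNw := pE (- w); rewrite sqrrN w2 in pw pNw.
have half : 2 * modulus q.[v] <= modulus p.[w] + modulus p.[- w].
  have -> : 2 * modulus q.[v] = modulus (ofreal 2 * q.[v]).
    by rewrite modulusM modulus_ofreal ger0_norm.
  have o2 : ofreal 2 = 2 :> complexes R by exact: (rmorph_nat (real_complex R)).
  rewrite o2 /q; case: ifP => _.
    apply: (@le_trans _ _ (modulus (p.[w] - p.[- w]))).
      rewrite pw pNw -[leLHS]mulr1 -w1 -modulusM le_eqVlt; apply/orP; left.
      by apply/eqP; congr modulus; ring.
    by rewrite (le_trans (modulusD _ _)) // modulusN.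
  apply: le_trans (modulusD _ _).
  rewrite pw pNw le_eqVlt; apply/orP; left.
  by apply/eqP; congr modulus; ring.
have [h|h] := leP (modulus q.[v]) (modulus p.[w]); [by left|right; lra].
Qed.

(** Multiplying by a unit [u] and taking the real part projects to the line of
    direction the conjugate of [u]. *)
Definition rot_re (u z : complexes R) : R := complex.Re ((u * z : complexes R) : R[i]).

Lemma rot_reB u z w : rot_re u (z - w) = rot_re u z - rot_re u w.
Proof. by rewrite /rot_re mulrBr raddfB. Qed.

Lemma rot_re_le u z : modulus u = 1 -> `|rot_re u z| <= modulus z.
Proof. by move=> u1; rewrite -[leRHS]mul1r -u1 -modulusM normRe_le. Qed.

Lemma continuous_rot_re u : continuous (rot_re u).
Proof.
move=> z; apply: (@continuous_comp _ _ _ (fun z => u * z) (fun z : complexes R => complex.Re (z : R[i]))).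
  by apply: continuousM; [exact: cst_continuous|exact: cvg_id].
exact: continuous_re.
Qed.

Definition cconj (z : complexes R) : complexes R := conjc (z : R[i]).

Lemma mul_cconj z : z * cconj z = ofreal (modulus z ^+ 2).
Proof.
rewrite /cconj /ofreal -(sqr_normc (z : R[i])).
rewrite -[LHS]/(`|z| ^+ 2) normE; exact/esym/(rmorphXn (real_complex R)).
Qed.

Lemma inv_unit w : modulus w = 1 -> w^-1 = cconj w.
Proof.
move=> w1; have w0 : w != 0 by rewrite -modulus_gt0 w1.
by apply: (mulfI w0); rewrite divff // mul_cconj w1 expr1n.
Qed.

Lemma add_cconj z : z + cconj z = ofreal (2 * complex.Re (z : R[i])).
Proof.
rewrite [z + _](addcJ (z : R[i])).
by rewrite /ofreal rmorphM rmorph_nat.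
Qed.

Lemma cconjM z w : cconj (z * w) = cconj z * cconj w.
Proof. exact: (rmorphM (@conjc R)). Qed.

Lemma modulus_cconj z : modulus (cconj z) = modulus z.
Proof. by rewrite !modulusE; case: z => a b /=; rewrite sqrrN. Qed.

(** If [y = 2 cos t], then [w = exp (i t)]. *)
Lemma joukowski_unit (y : R) : `|y| <= 2 ->
  exists2 w, modulus w = 1 & ofreal y = w + w^-1.
Proof.
move=> y2; pose t := y / 2.
have t1 : t ^+ 2 <= 1.
  by move: y2; rewrite ler_norml expr2 /t => /andP[l r]; nra.
pose w : complexes R := (t +i* Num.sqrt (1 - t ^+ 2))%C.
have w1 : modulus w = 1.
  by rewrite modulusE /= sqr_sqrtr ?subr_ge0 // addrC subrK sqrtr1.
exists w => //; rewrite inv_unit // add_cconj /=; congr ofreal; rewrite /t; lra.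
Qed.

End UnitCircle.

Section Continuum.
Variable R : realType.
Variables (K : set (complexes R)) (a b : complexes R).
Hypotheses (cK : connected K) (Ka : K a) (Kb : K b).
Hypothesis ab : a != b.

Let L := modulus (b - a).
Let L0 : 0 < L. Proof. by rewrite modulus_gt0 subr_eq0 eq_sym. Qed.
Let u : complexes R := (b - a)^-1 * ofreal L.
Let u1 : modulus u = 1.
Proof. by rewrite modulusM modulusV modulus_ofreal ger0_norm ?modulus_ge0 // mulVf // gt_eqF. Qed.

Let uL : rot_re u b - rot_re u a = L.
Proof.
rewrite -rot_reB /rot_re /u mulrAC mulVf ?mul1r // subr_eq0 eq_sym //.
Qed.

Lemma connected_image_itv (f : complexes R -> R) x y (t : R) : continuous f ->
  K x -> K y -> f x <= t <= f y -> exists2 z, K z & f z = t.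
Proof.
move=> cf Kx Ky h.
have /connected_intervalP itv : connected (f @` K).
  by apply: connected_continuous_connected => //; exact: continuous_subspaceT.
have := itv (f x) (f y); case/(_ _ _ t h); [by exists x|by exists y|].
by move=> z; exists z.
Qed.

(** On the line through [a] and [b], parametrize the interval between them by
    the real part of a point [w] of the unit circle: the distance to the
    projection of [z i] is [L / 4] times the modulus of a monic quadratic
    polynomial in [w], and a monic polynomial is at least 1 somewhere on the
    circle.  The connected set [K] has a point over each point of the
    interval. *)
Lemma exists_far_point n (z : nat -> complexes R) :
  exists2 x, K x & (L / 4) ^+ n <= \prod_(i < n) modulus (x - z i).
Proof.
(* Chosen so that [L / 4 * (w + w^-1 + c i)] is the point of the line of parameter
   [w] minus the projection of [z i]. *)
pose c i := 2 - 4 * (rot_re u (z i) - rot_re u a) / L.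
pose q (i : 'I_n) : {poly complexes R} := 'X^2 + (ofreal (c i)) *: 'X + 1.
have sq i : size (q i) = 3%N.
  rewrite /q -addrA size_polyDl ?size_polyXn // (leq_ltn_trans (size_polyD _ _)) //.
  rewrite gtn_max size_poly1 andbT (leq_ltn_trans (size_scale_leq _ _)) // size_polyX //.
have lq i : q i \is monic.
  rewrite monicE /lead_coef sq /q !coefE /= mulr0 !addr0 //.
have mQ : \prod_i q i \is monic by apply: monic_prod => i _.
have [|w w1 hw] := @unit_circle_coef R (n.*2) (\prod_i q i).
  rewrite size_prod; last by move=> i _; exact: monic_neq0.
  by rewrite (eq_bigr (fun=> 3%N)) // sum_nat_const !card_ord mulnS -addnS addKn muln2.
pose x := rot_re u a + L / 4 * (2 + 2 * complex.Re (w : R[i])).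
have Re1 : `|complex.Re (w : R[i])| <= 1 by rewrite -w1 normRe_le.
have [|y Ky yx] := @connected_image_itv (rot_re u) a b x (@continuous_rot_re _ u) Ka Kb.
  have -> : rot_re u b = rot_re u a + L by rewrite -uL; ring.
  move: Re1; rewrite ler_norml /x => /andP[l r].
  move: (complex.Re _) l r (rot_re u a) => t l r e.
  have p1 : 0 <= L * (1 + t) by apply: mulr_ge0; [exact: ltW|lra].
  have p2 : 0 <= L * (1 - t) by apply: mulr_ge0; [exact: ltW|lra].
  by apply/andP; split; lra.
exists y => //.
have w0 : w != 0 by rewrite -modulus_gt0 w1.
have coef : modulus (\prod_i q i)`_(n.*2) = 1.
  have -> : (\prod_i q i)`_(n.*2) = lead_coef (\prod_i q i).
    rewrite /lead_coef size_prod; last by move=> i _; exact: monic_neq0.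
    by rewrite (eq_bigr (fun=> 3%N)) // sum_nat_const !card_ord; congr (_`_ _); rewrite mulnS -addnS addKn muln2.
  by rewrite (eqP mQ) modulus1.
rewrite coef horner_prod modulus_prod in hw.
have step i : L / 4 * modulus (q i).[w] <= modulus (y - z i).
  apply: le_trans (rot_re_le _ u1); rewrite rot_reB yx.
  rewrite -(modulus_ofreal (x - _)).
  have -> : ofreal (x - rot_re u (z i)) = ofreal (L / 4) * w^-1 * (q i).[w].
    have -> : (q i).[w] = w ^+ 2 + ofreal (c i) * w + 1 by rewrite /q !hornerE.
    have -> : ofreal (L / 4) * w^-1 * (w ^+ 2 + ofreal (c i) * w + 1) =
        ofreal (L / 4) * ((w + w^-1) + ofreal (c i)) by field.
    rewrite inv_unit // add_cconj -[_ + ofreal (c i)](rmorphD (real_complex R)).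
    rewrite -[ofreal (L / 4) * _](rmorphM (real_complex R)); congr (real_complex R).
    by rewrite /x /c; field; rewrite gt_eqF.
  by rewrite !modulusM modulusV w1 invr1 mulr1 modulus_ofreal ger0_norm // divr_ge0 // ltW.
apply: (@le_trans _ _ (\prod_(i < n) (L / 4 * modulus (q i).[w]))).
  rewrite big_split /= prodr_const card_ord ler_peMr //.
  by rewrite exprn_ge0 // divr_ge0 // ltW.
apply: ler_prod => i _; rewrite step andbT mulr_ge0 ?modulus_ge0 //.
by rewrite divr_ge0 // ltW.
Qed.

(** Each point is chosen far from the previous ones. *)
Lemma leja_points n : exists z : nat -> complexes R, (forall k, (k < n)%N -> K (z k)) /\
  (L / 4) ^+ 'C(n, 2) <= pairprod z n.
Proof.
elim: n => [|n [z [Kz hz]]].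
  by exists (fun=> 0); rewrite /pairprod big_ord0 bin0n expr0.
have [x Kx hx] := exists_far_point n z.
pose z' k := if k == n then x else z k; exists z'; split.
  move=> k; rewrite ltnS leq_eqVlt => /predU1P[->|kn]; rewrite /z' ?eqxx //.
  by rewrite ltn_eqF //; exact: Kz.
rewrite pairprodS binS bin1 exprD.
have e k : (k < n)%N -> z' k = z k by move=> kn; rewrite /z' ltn_eqF.
have -> : pairprod z' n = pairprod z n.
  apply: eq_bigr => j _; apply: eq_bigr => i _.
  by rewrite (e j) // (e i) // (ltn_trans (ltn_ord i)).
have -> : \prod_(i < n) modulus (z' n - z' i) = \prod_(i < n) modulus (x - z i).
  by apply: eq_bigr => i _; rewrite (e i) // /z' eqxx.
have L4 : 0 <= L / 4 by rewrite divr_ge0 // ltW.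
by apply: ler_pM => //; exact: exprn_ge0.
Qed.

End Continuum.

(** * Sets of diameter 1 have capacity at most 1/2 *)

Section Interval.
Variable R : realType.

(** [chebyshev n] is the Chebyshev polynomial of the second kind in [x / 2],
    which makes it monic; the pair holds two consecutive ones. *)
Fixpoint chebyshev_pair (n : nat) : {poly complexes R} * {poly complexes R} :=
  if n is m.+1 then
    let q := chebyshev_pair m in (q.2, 'X * q.2 - q.1)
  else (1, 'X).
Definition chebyshev n := (chebyshev_pair n).1.

Lemma chebyshevSS n : chebyshev n.+2 = 'X * chebyshev n.+1 - chebyshev n.
Proof. by []. Qed.

Lemma nat_ind2 (Q : nat -> Prop) :
  Q 0%N -> Q 1%N -> (forall n, Q n -> Q n.+1 -> Q n.+2) -> forall n, Q n.
Proof.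
move=> Q0 Q1 QS n; suff [] : Q n /\ Q n.+1 by [].
by elim: n => [|n [h h']]; split => //; exact: QS.
Qed.

Lemma coef_chebyshev n : (chebyshev n)`_n = 1 /\ forall k, (n < k)%N -> (chebyshev n)`_k = 0.
Proof.
elim/nat_ind2: n => [||n [_ h0] [h1 h1']].
- by split; rewrite /chebyshev /= ?coef1 // => -[|k] //; rewrite coef1.
- by split; rewrite /chebyshev /= ?coefX // => -[|[|k]] //; rewrite coefX.
- rewrite chebyshevSS; split => [|[|k] //].
    by rewrite coefB coefXM /= h1 h0 ?subr0.
  rewrite ltnS => nk; rewrite coefB coefXM /= h1' // h0 ?subrr //.
  by rewrite (ltn_trans _ (ltn_trans nk _)).
Qed.

(** The formula [sin ((n + 1) t) / sin t] for the value at [2 cos t], free of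
    divisions. *)
Lemma horner_chebyshev n (w : complexes R) : w != 0 ->
  w ^+ n * (chebyshev n).[w + w^-1] = \sum_(i < n.+1) (w ^+ 2) ^+ i.
Proof.
move=> w0; elim/nat_ind2: n => [||n h0 h1].
- by rewrite big_ord1 !expr0 mul1r /chebyshev /= hornerC.
- rewrite expr1 !big_ord_recr big_ord0 /= add0r expr0 expr1 /chebyshev /= hornerX.
  by field.
- rewrite chebyshevSS !hornerE mulrBr.
  have -> : w ^+ n.+2 * ((w + w^-1) * (chebyshev n.+1).[w + w^-1]) =
    (w ^+ 2 + 1) * (w ^+ n.+1 * (chebyshev n.+1).[w + w^-1]).
    by rewrite !exprS; field.
  have -> : w ^+ n.+2 * (chebyshev n).[w + w^-1] = w ^+ 2 * (w ^+ n * (chebyshev n).[w + w^-1]).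
    by rewrite !exprS; ring.
  rewrite h0 h1 [RHS]big_ord_recr /= [in LHS]big_ord_recr /=.
  rewrite [in RHS]big_ord_recr /=.
  by rewrite [in RHS](exprS _ n.+1); ring.
Qed.

Lemma modulus_chebyshev n (y : R) : `|y| <= 2 ->
  modulus (chebyshev n).[ofreal y] <= n.+1%:R.
Proof.
move=> /joukowski_unit[w w1 ->]; have w0 : w != 0 by rewrite -modulus_gt0 w1.
have -> : modulus (chebyshev n).[w + w^-1] = modulus (w ^+ n * (chebyshev n).[w + w^-1]).
  by rewrite modulusM modulusX w1 expr1n mul1r.
rewrite horner_chebyshev //; apply: (le_trans (modulus_sum _ _ _)).
rewrite (eq_bigr (fun=> 1)) ?sumr_const ?card_ord //.
by move=> i _; rewrite !modulusX w1 !expr1n.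
Qed.

(** The crude bound by the number of permutations is enough: only the growth of
    the exponent [binomial(n, 2)] matters. *)
Lemma modulus_det_le n (A : 'M[complexes R]_n) (c : nat -> R) :
  (forall i j, modulus (A i j) <= c i) ->
  modulus (\det A) <= n`!%:R * \prod_(i < n) c i.
Proof.
move=> Ac; rewrite /determinant; apply: (le_trans (modulus_sum _ _ _)).
apply: (@le_trans _ _ (\sum_(s : 'S_n) \prod_(i < n) c i)).
  apply: ler_sum => s _; rewrite modulusM modulus_prod modulusX modulusN modulus1 expr1n mul1r.
  by apply: ler_prod => i _; rewrite modulus_ge0 Ac.
by rewrite sumr_const card_Sn mulr_natl.
Qed.

(** Row operations replace the powers in the Vandermonde matrix by monic
    polynomials that are small on the interval [-2, 2], of capacity 1. *)
Lemma pairprod_interval n (y : nat -> R) : (forall i, (i < n)%N -> `|y i| <= 2) ->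
  pairprod (fun i => ofreal (y i)) n <= n`!%:R ^+ 2.
Proof.
move=> y2; pose V := Vandermonde n (\row_(i < n) ofreal (y i)).
pose A := \matrix_(k < n, l < n) (chebyshev k)`_l.
have detV : modulus (\det V) = pairprod (fun i => ofreal (y i)) n.
  rewrite det_Vandermonde modulus_prod /pairprod.
  under eq_bigr do rewrite modulus_prod.
  rewrite (exchange_big_dep predT) //=; apply: eq_bigr => j _.
  rewrite [RHS](@big_ord_widen _ _ _ j n (fun i => modulus (ofreal (y j) - ofreal (y i)))).
    by apply: eq_bigr => i _; rewrite !mxE.
  exact: ltnW.
have detA : \det A = 1.
  rewrite det_trig; last first.
    by apply/is_trig_mxP => i j ij; rewrite mxE; apply: (coef_chebyshev i).2.
  by apply: big1 => i _; rewrite mxE; exact: (coef_chebyshev i).1.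
rewrite -detV; have -> : \det V = \det (A *m V) by rewrite det_mulmx detA mul1r.
apply: (le_trans (@modulus_det_le n _ (fun i => i.+1%:R) _)).
  move=> k i; have -> : (A *m V) k i = (chebyshev k).[ofreal (y i)].
    rewrite mxE (@horner_coef_wide _ n); last first.
      apply/leq_sizeP => j nj; apply: (coef_chebyshev k).2.
      exact: leq_trans (ltn_ord k) nj.
    by apply: eq_bigr => j _; rewrite !mxE.
  by apply: modulus_chebyshev; exact: y2.
by rewrite expr2 -natr_prod fact_prod big_add1 big_mkord.
Qed.

Lemma coef_mul_top (p q : {poly complexes R}) m n : (size p <= m.+1)%N -> (size q <= n.+1)%N ->
  (size (p * q)%R <= (m + n).+1)%N /\ (p * q)`_(m + n) = p`_m * q`_n.
Proof.
move=> sp sq; split.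
  apply: (leq_trans (size_polyMleq _ _)); rewrite -subn1 leq_subLR; lia.
have mn : (m < (m + n).+1)%N by rewrite ltnS leq_addr.
rewrite coefM (bigD1 (Ordinal mn)) //= addKn big1 ?addr0 // => i.
rewrite -val_eqE /= neq_ltn => /orP[im|im].
  by rewrite [q`_ _]nth_default ?mulr0 // (leq_trans sq) //; lia.
by rewrite nth_default ?mul0r // (leq_trans sp).
Qed.

(** For [w = u ^+ 2] with [u] a unit, twice the length of the projection of a
    vector [v] is the modulus of [v * w + conj v], of degree 1 in [w] with leading
    coefficient [v].  The product of these polynomials over all pairs has leading
    coefficient of modulus [pairprod z n], and is at least as large somewhere on
    the unit circle. *)
Lemma exists_direction n (z : nat -> complexes R) : exists2 u, modulus u = 1 &
  2^-1 ^+ 'C(n, 2) * pairprod z n <= pairprod (fun i => ofreal (rot_re u (z i))) n.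
Proof.
pose v j i : complexes R := z j - z i.
pose q j i : {poly complexes R} := (v j i) *: 'X + (cconj (v j i))%:P.
pose Q m := \prod_(j < m) \prod_(i < j) q j i.
have sq j i : (size (q j i) <= 2)%N.
  rewrite (leq_trans (size_polyD _ _)) // geq_max (leq_trans (size_scale_leq _ _)) ?size_polyX //.
  by rewrite (leq_trans (size_polyC_leq1 _)).
have q1 j i : (q j i)`_1 = v j i.
  by rewrite /q coefD coefZ coefX coefC /= mulr1 addr0.
have row_top j : (size (\prod_(i < j) q j i)%R <= j.+1)%N /\
    (\prod_(i < j) q j i)`_j = \prod_(i < j) v j i.
  suff h m : (size (\prod_(i < m) q j i)%R <= m.+1)%N /\
    (\prod_(i < m) q j i)`_m = \prod_(i < m) v j i by exact: h.
  elim: m => [|m [sm cm]]; first by rewrite !big_ord0 size_poly1 coef1.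
  rewrite !big_ord_recr /=; have [] := coef_mul_top sm (sq j m).
  by rewrite addn1 => -> ->; rewrite cm q1.
have Qtop : (size (Q n) <= 'C(n, 2).+1)%N /\
    (Q n)`_('C(n, 2)) = \prod_(j < n) \prod_(i < j) v j i.
  rewrite /Q; elim: n => [|m [sm cm]]; first by rewrite !big_ord0 size_poly1 coef1.
  rewrite !big_ord_recr /= binS bin1; have [sr cr] := row_top m.
  by have [-> ->] := coef_mul_top sm sr; rewrite cm cr.
have [w w1] := unit_circle_coef Qtop.1.
rewrite Qtop.2 modulus_prod; under eq_bigr do rewrite modulus_prod.
rewrite -/(pairprod z n) => hw.
pose u := sqrtC w; have u2 : u ^+ 2 = w by rewrite sqrtCK.
have u1 : modulus u = 1.
  by apply/eqP; rewrite -(@eqrXn2 _ 2) ?modulus_ge0 // -modulusX u2 w1 expr1n.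
exists u => //.
have qw j i : modulus (q j i).[w] = 2 * modulus (ofreal (rot_re u (z j)) - ofreal (rot_re u (z i))).
  have -> : (q j i).[w] = w * v j i + cconj (v j i) by rewrite /q !hornerE mulrC.
  have -> : w * v j i + cconj (v j i) = u * (u * v j i + cconj (u * v j i)).
    rewrite [RHS]mulrDr mulrA -expr2 u2; congr (_ + _).
    rewrite cconjM mulrA mul_cconj u1 expr1n.
    by rewrite mul1r.
  rewrite modulusM u1 mul1r add_cconj modulus_ofreal normrM ger0_norm //; congr (_ * _).
  rewrite -[ofreal _ - _](rmorphB (real_complex R)) modulus_ofreal -rot_reB //.
apply: (@le_trans _ _ (2^-1 ^+ 'C(n, 2) * modulus (Q n).[w])).
  by rewrite ler_wpM2l // exprn_ge0.
have -> : modulus (Q n).[w] = 2 ^+ 'C(n, 2) * pairprod (fun i => ofreal (rot_re u (z i))) n.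
  rewrite /Q horner_prod modulus_prod /pairprod; elim: n {hw Qtop} => [|m ih].
    by rewrite !big_ord0 bin0n expr0 mul1r.
  rewrite !big_ord_recr /= ih binS bin1 exprD -!mulrA; congr (_ * _).
  rewrite mulrCA; congr (_ * _).
  rewrite horner_prod modulus_prod; under eq_bigr do rewrite qw.
  by rewrite big_split /= prodr_const card_ord.
by rewrite mulrA -exprMn mulVf // expr1n mul1r.
Qed.

(** In a suitable direction the projections keep half of the distances in
    geometric mean, and they lie in an interval of length 1, which is rescaled to
    [-2, 2]. *)
Lemma pairprod_diam1 n (z : nat -> complexes R) :
  (forall i j, (i < n)%N -> (j < n)%N -> modulus (z i - z j) <= 1) ->
  pairprod z n <= 2^-1 ^+ 'C(n, 2) * n`!%:R ^+ 2.
Proof.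
move=> z1; have [u u1 hu] := exists_direction n z.
pose x i := rot_re u (z i).
have [n0|n0] := posnP n.
  by rewrite n0 /pairprod big_ord0 bin0n expr0 mul1r fact0 expr1n.
have [i0 _ xmin] := arg_minP (fun i : 'I_n => x i) (isT : xpredT (Ordinal n0)).
(* The interval of length 1 starting at the least [x i0] becomes [-2, 2]. *)
pose y i := 4 * (x i - x i0) - 2.
have xB i j : (i < n)%N -> (j < n)%N -> x i - x j <= 1.
  move=> ni nj; apply: le_trans (z1 _ _ ni nj); apply: le_trans (rot_re_le _ u1).
  by rewrite rot_reB ler_norm.
have y2 i : (i < n)%N -> `|y i| <= 2.
  move=> ni; have := xB i i0 ni (ltn_ord i0).
  have : x i0 <= x i by exact: (xmin (Ordinal ni) isT).
  by rewrite ler_norml /y => *; apply/andP; split; lra.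
have yx k : pairprod (fun i => ofreal (y i)) k = 4 ^+ 'C(k, 2) * pairprod (fun i => ofreal (x i)) k.
  have e j i : modulus (ofreal (y j) - ofreal (y i)) = 4 * modulus (ofreal (x j) - ofreal (x i)).
    rewrite -2![ofreal _ - _](rmorphB (real_complex R)) !modulus_ofreal.
    rewrite -[4 in RHS]ger0_norm // -normrM; congr `| _ |; rewrite /y; ring.
  elim: k => [|m ih]; first by rewrite /pairprod !big_ord0 bin0n expr0 mul1r.
  rewrite !pairprodS ih binS bin1 exprD -!mulrA; congr (_ * _); rewrite mulrCA.
  congr (_ * _); under eq_bigr do rewrite e.
  by rewrite big_split /= prodr_const card_ord.
have := pairprod_interval y2; rewrite yx => hx.
have h4 : pairprod (fun i => ofreal (x i)) n <= 4^-1 ^+ 'C(n, 2) * n`!%:R ^+ 2.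
  by rewrite exprVn ler_pdivlMl // exprn_gt0.
have := le_trans hu h4; rewrite -ler_pdivlMl ?exprn_gt0 ?invr_gt0 //.
rewrite mulrA -exprVn -exprMn invrK; have -> : 2 * 4^-1 = 2^-1 :> R by field.
by [].
Qed.

(** Bernoulli's inequality for the fifth root of a lower bound of [b] makes the
    exponential larger than a multiple of [n ^ 5]. *)
Lemma expr_beats_poly (b : R) : 1 < b ->
  exists2 n : nat, (0 < n)%N & n%:R ^+ 4 < b ^+ n.-1.
Proof.
move=> b1.
(* [(1 + h) ^ 5 <= 1 + 31 h] for [0 <= h <= 1], as [2 ^ 5 = 1 + 31]. *)
pose h := Num.min 1 ((b - 1) / 31).
have h0 : 0 < h by rewrite lt_min ltr01 divr_gt0 // subr_gt0.
have h1 : h <= 1 by rewrite ge_min lexx.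
have hb : (1 + h) ^+ 5 <= b.
  have : h <= (b - 1) / 31 by rewrite ge_min lexx orbT.
  rewrite ler_pdivlMr // => h31.
  have hX k : h ^+ k.+1 <= h.
    by rewrite exprS; apply: ler_piMr; rewrite ?(ltW h0) // exprn_ile1 // ltW.
  have := hX 1%N; have := hX 2%N; have := hX 3%N; have := hX 4%N.
  have -> : (1 + h) ^+ 5 = 1 + 5 * h + 10 * h ^+ 2 + 10 * h ^+ 3 + 5 * h ^+ 4 + h ^+ 5 by ring.
  lra.
have bern m : 1 + m%:R * h <= (1 + h) ^+ m.
  elim: m => [|m ih]; first by rewrite mul0r addr0 expr0.
  rewrite exprS; apply: (@le_trans _ _ ((1 + h) * (1 + m%:R * h))).
    have m0 : 0 <= m%:R * (h * h) by rewrite mulr_ge0 // mulr_ge0 // ltW.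
    by rewrite -natr1; nra.
  by rewrite ler_wpM2l // addr_ge0 // ltW.
pose N := Num.truncn (h ^- 5 * 2 ^+ 4); exists N.+2 => //=.
apply: (@lt_le_trans _ _ ((1 + N.+1%:R * h) ^+ 5)); last first.
  apply: (@le_trans _ _ (((1 + h) ^+ N.+1) ^+ 5)).
    by rewrite ler_pXn2r ?nnegrE ?exprn_ge0 ?addr_ge0 ?mulr_ge0 // ltW.
  rewrite exprAC ler_pXn2r ?nnegrE ?exprn_ge0 ?addr_ge0 ?(ltW h0) //.
  by apply: le_trans (ltW b1).
have M0 : 0 < N.+1%:R :> R by rewrite ltr0n.
have NM : h ^- 5 * 2 ^+ 4 < N.+1%:R by exact: truncnS_gt.
apply: (@lt_le_trans _ _ ((N.+1%:R * h) ^+ 5)); last first.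
  by rewrite ler_pXn2r ?nnegrE ?addr_ge0 ?mulr_ge0 ?(ltW h0) // lerDr.
apply: (@le_lt_trans _ _ ((2 * N.+1%:R) ^+ 4)).
  rewrite ler_pXn2r ?nnegrE ?mulr_ge0 // -natrM ler_nat; lia.
have -> : (N.+1%:R * h) ^+ 5 = h ^+ 5 * N.+1%:R * N.+1%:R ^+ 4 by ring.
rewrite exprMn ltr_pM2r ?exprn_gt0 //.
by rewrite -ltr_pdivrMl ?exprn_gt0.
Qed.

(** If the diameter were at most 1, [pairprod_diam1] would bound by
    [(n`!) ^ 2 <= n ^ (2 n)] the quantities [(2 C) ^ binomial(n, 2)], for some
    [C] larger than 1/2. *)
Lemma diam_gt1 (K : set (complexes R)) : compact K ->
  ((2^-1)%:E < log_capacity K)%E ->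
  exists a b, [/\ K a, K b & 1 < modulus (a - b)].
Proof.
move=> cK hK; apply: contrapT => nd.
have d1 z w : K z -> K w -> modulus (z - w) <= 1.
  move=> Kz Kw; rewrite leNgt; apply/negP => h; apply: nd; by exists z, w.
have [C C2 hC] : exists2 C : R, 2^-1 < C & (C%:E < log_capacity K)%E.
  case: (log_capacity K) hK => [c| |] //.
    rewrite lte_fin => h; exists ((2^-1 + c) / 2); rewrite ?lte_fin; lra.
  by move=> _; exists 1; rewrite ?ltry //; lra.
have C0 : 0 < C by lra.
have [n n0 big] := @expr_beats_poly (2 * C) ltac:(lra).
have [z [Kz hz]] := points_of_capacity n cK C0 hC.
have := le_trans hz (pairprod_diam1 (fun i j ni nj => d1 _ _ (Kz i ni) (Kz j nj))).
rewrite exprVn ler_pdivlMl ?exprn_gt0 // -exprMn => h.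
have fn : n`!%:R <= n%:R ^+ n :> R.
  rewrite -natrX ler_nat fact_prod big_add1 big_mkord -[X in (_ <= _ ^ X)%N]card_ord.
  by rewrite -prod_nat_const; apply: leq_prod => i _.
have : ((2 * C) ^+ n.-1) ^+ n <= (n%:R ^+ 4) ^+ n.
  rewrite -exprM; have -> : (n.-1 * n = 'C(n, 2) * 2)%N.
    rewrite bin2 muln2 mulnC -[LHS]odd_double_half oddM.
    by case: (n) => // k /=; rewrite andNb.
  have -> : (n%:R ^+ 4) ^+ n = ((n%:R ^+ n) ^+ 2) ^+ 2 :> R.
    by rewrite -!exprM; congr (_ ^+ _); lia.
  rewrite exprM; have e0 : 0 <= (2 * C) ^+ 'C(n, 2) by rewrite exprn_ge0 // mulr_ge0 // ltW.
  rewrite ler_pXn2r ?nnegrE ?e0 ?exprn_ge0 ?ler0n //; apply: (le_trans h).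
  by rewrite ler_pXn2r ?nnegrE ?exprn_ge0.
by rewrite leNgt ltr_pXn2r ?nnegrE ?exprn_ge0 ?mulr_ge0 ?(ltW C0) // big.
Qed.

End Interval.

(** * Lemniscates with zeros in a connected set of diameter 1 *)

Section ConnectedLemniscate.
Variable R : realType.
Implicit Types v w : complexes R.

(** The scalar product of the Euclidean plane. *)
Definition inner (a b : complexes R) : R :=
  complex.Re ((a * cconj b : complexes R) : R[i]).

Lemma inner_le a b : inner a b <= modulus a * modulus b.
Proof.
by rewrite /inner -(modulus_cconj b) -modulusM; apply: le_trans (normRe_le _); exact: ler_norm.
Qed.

Lemma innerE a b : inner a b = complex.Re (a : R[i]) * complex.Re (b : R[i]) +
  complex.Im (a : R[i]) * complex.Im (b : R[i]).
Proof. by rewrite /inner; case: a b => [a a'] [b b'] /=; rewrite mulrN opprK. Qed.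

Lemma modulus_sqrD a b (t : R) :
  modulus (a + ofreal t * b) ^+ 2 = modulus a ^+ 2 + 2 * t * inner a b + t ^+ 2 * modulus b ^+ 2.
Proof. by rewrite !modulus_sqr innerE; case: a b => [a a'] [b b'] /=; ring. Qed.

Lemma inner_polar a b : 2 * inner a b = modulus a ^+ 2 + modulus b ^+ 2 - modulus (a - b) ^+ 2.
Proof. by rewrite !modulus_sqr innerE; case: a b => [a a'] [b b'] /=; ring. Qed.

Lemma innerD a b c : inner (a + b) c = inner a c + inner b c.
Proof. by rewrite /inner mulrDl raddfD. Qed.

Lemma innerN a c : inner (- a) c = - inner a c.
Proof. by rewrite /inner mulNr raddfN. Qed.

Section OneDiameter.
Variables (K : set (complexes R)) (n : nat) (z : 'I_n -> complexes R) (i0 : 'I_n).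
Hypotheses (cK : connected K) (Kz : forall i, K (z i)) (kK : compact K).
Hypothesis K1 : forall v w, K v -> K w -> modulus (v - w) <= 1.

Let p : {poly complexes R} := \prod_(j < n) ('X - (z j)%:P).
Let C := connected_component (lemniscate p) (z i0).

Lemma modulus_root_prod v : modulus p.[v] = \prod_(j < n) modulus (v - z j).
Proof. exact: modulus_prod_XsubC. Qed.

Lemma closer_in_lemniscate v v' : (forall j, modulus (v' - z j) < modulus (v - z j)) ->
  modulus p.[v] <= 1 -> lemniscate p v'.
Proof.
move=> h; rewrite lemniscateE; apply: lt_le_trans; rewrite !modulus_root_prod.
apply: ltr_prod; first by apply/hasP; exists i0; rewrite ?mem_index_enum.
by move=> j _; rewrite modulus_ge0 h.
Qed.

Section BoundaryPoint.
Variable w : complexes R.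
Hypotheses (Kw : K w) (w1 : forall j, modulus (w - z j) = 1).

Let e := z i0 - w.
Let e1 : modulus e = 1. Proof. by rewrite /e modulusBC w1. Qed.

(** Around [w] all zeros lie on the unit circle, and their mutual distances are
    at most 1; so the scalar product of two directions towards zeros is at least
    1/2.  Since [v] is within 1/32 of [w], moving [v] by [t] along one of them
    changes a squared distance by at most
    [2 t (1/32 - 1/2) + t ^ 2 <= - 11/16 t]. *)
Lemma move_closer v (t : R) j : modulus (w - v) < 1 / 32 -> 0 <= t -> t <= 1 / 4 ->
  modulus (v + ofreal t * e - z j) ^+ 2 <= modulus (v - z j) ^+ 2 - 11 / 16 * t.
Proof.
move=> vw t0 t4; rewrite addrAC modulus_sqrD e1 expr1n mulr1.
have -> : v - z j = (v - w) + (- (z j - w)) by ring.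
rewrite innerD innerN; have h1 := inner_le (v - w) e; rewrite e1 mulr1 modulusBC in h1.
have zj1 : modulus (z j - w) = 1 by rewrite modulusBC w1.
have h2 : modulus (z j - z i0) ^+ 2 <= 1 by rewrite exprn_ile1 ?modulus_ge0 ?K1.
have h3 : 2 * inner (z j - w) e = 1 + 1 - modulus (z j - z i0) ^+ 2.
  by rewrite inner_polar e1 zj1 expr1n; congr (_ - modulus _ ^+ 2); rewrite /e; ring.
move: (inner (z j - w) e) (inner (v - w) e) h1 h3 => b a h1 h3.
have s : 0 <= t * (- a + b - 15 / 32 ) by apply: mulr_ge0 => //; lra.
have s' : 0 <= t * (1 / 4 - t) by apply: mulr_ge0 => //; lra.
rewrite -addrA lerD2l; lra.
Qed.

Lemma moved_in_lemniscate v (t : R) : modulus (w - v) < 1 / 32 -> 0 < t -> t <= 1 / 4 ->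
  modulus p.[v] <= 1 -> lemniscate p (v + ofreal t * e).
Proof.
move=> vw t0 t4; apply: closer_in_lemniscate => j.
rewrite -(@ltr_pXn2r _ 2) ?nnegrE ?modulus_ge0 //.
apply: (le_lt_trans (move_closer j vw (ltW t0) t4)); lra.
Qed.

(** The squared distances to the zeros drop from at most [(33/32) ^ 2] by
    [11/64], to less than 1. *)
Lemma far_moved_in_lemniscate v : modulus (w - v) < 1 / 32 ->
  lemniscate p (v + ofreal (1 / 4) * e).
Proof.
move=> vw; rewrite lemniscateE modulus_root_prod.
apply: (@lt_le_trans _ _ (\prod_(j < n) 1)); last by rewrite big1.
apply: ltr_prod; first by apply/hasP; exists i0; rewrite ?mem_index_enum.
move=> j _; rewrite modulus_ge0 /= -(@ltr_pXn2r _ 2) ?nnegrE ?modulus_ge0 // expr1n.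
have h := move_closer j vw (ltac:(lra) : 0 <= 1 / 4) (lexx _).
have : modulus (v - z j) <= 33 / 32.
  apply: (le_trans (modulusB_le _ w _)); rewrite w1 modulusBC; lra.
have : 0 <= modulus (v - z j) by exact: modulus_ge0.
nra.
Qed.

(** Both points move by 1/4 towards the zero inside the lemniscate, and end in a
    small disc contained in it. *)
Lemma same_component_near u v : modulus (w - u) < 1 / 32 -> modulus (w - v) < 1 / 32 ->
  lemniscate p u -> lemniscate p v -> connected_component (lemniscate p) u v.
Proof.
have up x : modulus (w - x) < 1 / 32 -> lemniscate p x ->
    connected_component (lemniscate p) x (x + ofreal (1 / 4) * e).
  move=> wx Lx; apply: (@connected_component_max _ _ (segment x (x + ofreal (1 / 4) * e))).
  - exact: segmentl.
  - move=> y [t /= /[!in_itv]/= /andP[t0 t1] <-].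
    rewrite addrAC subrr add0r mulrA -ofrealM.
    move: t0; rewrite le_eqVlt => /predU1P[<-|t0].
      by rewrite mul0r ofreal0 mul0r addr0.
    apply: moved_in_lemniscate => //; [by rewrite mulr_gt0|lra|].
    by move: Lx; rewrite lemniscateE => /ltW.
  - exact: connected_segment.
  - exact: segmentr.
move=> wu wv Lu Lv; apply: (connected_component_trans (up u wu Lu)).
apply: connected_component_trans; last by apply: connected_component_sym; exact: up.
pose T := disc (w + ofreal (1 / 4) * e) (1 / 32).
apply: (@connected_component_max _ _ T).
- by rewrite /T /disc /= opprD addrACA subrr addr0.
- move=> y Ty; have -> : y = (y - ofreal (1 / 4) * e) + ofreal (1 / 4) * e by rewrite subrK.
  apply: far_moved_in_lemniscate; move: Ty; rewrite /T /disc /=; congr (modulus _ < _).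
  by ring.
- exact: connected_disc.
- by rewrite /T /disc /= opprD addrACA subrr addr0.
Qed.

End BoundaryPoint.

Lemma K_lemniscate_le v : K v -> modulus p.[v] <= 1.
Proof.
move=> Kv; rewrite modulus_root_prod; apply: prodr_ile1 => j _.
by rewrite modulus_ge0 K1.
Qed.

Lemma boundary_dist v : K v -> ~ lemniscate p v -> forall j, modulus (v - z j) = 1.
Proof.
move=> Kv; rewrite lemniscateE => /negP; rewrite -leNgt modulus_root_prod => h j.
apply/eqP; rewrite eq_le K1 //= -[1]mulr1.
move: h; rewrite (bigD1 j) //= => h.
apply: (le_trans _ (_ : modulus (v - z j) * 1 <= _)); last by rewrite mulr1.
rewrite mulr1; apply: (le_trans h); rewrite ler_wpM2l ?modulus_ge0 //.
by apply: prodr_ile1 => i _; rewrite modulus_ge0 K1.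
Qed.

(** If [w] is not in the lemniscate, points of [K] near [w] enter it as soon as
    they move towards the zero, and [same_component_near] shows that they enter
    [C]. *)
Lemma closure_component_near w : K w -> closure C w -> exists2 d : R, 0 < d &
  forall v, K v -> modulus (w - v) < d -> closure C v.
Proof.
move=> Kw Cw; have oL : open (lemniscate p) by exact: open_lemniscate.
have [Lw|nLw] := pselect (lemniscate p w).
  have Cw' : C w by exact: closure_component.
  have oC : open C by exact: open_component.
  have [d d0 dC] := iffLR (open_complexP _) oC w Cw'.
  exists d; first exact: d0.
  move=> v _ wv; apply: subset_closure; exact: (dC v wv).
have w1 := boundary_dist Kw nLw.
have [|u [Cu du]] := Cw (disc w (1 / 32)); first by apply: nbhs_disc; lra.
have Lu : lemniscate p u by exact: connected_component_sub Cu.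
exists (1 / 32) => [|v Kv wv]; first by lra.
move=> N /nbhs_complexP[d d0 dN].
pose t := Num.min (1 / 4) (Num.min (d / 2) ((1 / 32 - modulus (w - v)) / 2)).
have t0 : 0 < t by rewrite !lt_min; apply/and3P; split; lra.
have [t4 td tw] : [/\ t <= 1 / 4, t <= d / 2 & t <= (1 / 32 - modulus (w - v)) / 2].
  by split; rewrite !ge_min lexx ?orbT.
have ev : modulus (ofreal t * (z i0 - w)) = t.
  by rewrite modulusM modulus_ofreal gtr0_norm // modulusBC w1 mulr1.
exists (v + ofreal t * (z i0 - w)); split.
  apply: (connected_component_trans Cu); apply: (same_component_near w1).
  - exact: du.
  - rewrite opprD addrA; apply: (le_lt_trans (modulusD _ _)); rewrite modulusN ev; lra.
  - exact: Lu.
  - by apply: (moved_in_lemniscate w1) => //; exact: K_lemniscate_le.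
by apply: dN; rewrite opprD addNKr modulusN ev; lra.
Qed.

(** The part of [K] in the closure of [C] is closed, relatively open and
    nonempty. *)
Lemma K_sub_closure : K `<=` closure C.
Proof.
pose B := K `&` closure C; suff <- : B = K by move=> v [].
apply: cK.
- exists (z i0); split; first exact: Kz.
  apply: subset_closure; apply: connected_component_refl; exact: lemniscate_root.
- exists (\bigcup_(x in [set x : complexes R * R | K `&` disc x.1 x.2 `<=` closure C]) disc x.1 x.2).
    by apply: bigcup_open => x _; exact: open_disc.
  apply/seteqP; split => [w [Kw Cw]|w [Kw [x xC dw]]]; last by split => //; exact: xC.
  split => //; have [d d0 dC] := closure_component_near Kw Cw.
  exists (w, d) => /=; last exact: disc_center.
  by move=> v [Kv wv]; exact: dC.
- by exists (closure C) => //; exact: closed_closure.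
Qed.

Lemma nb_components_eq1 : nb_components p = 1%E.
Proof.
have [B _ KB] := compact_bounded_modulus kK.
have zB i : modulus (z i) <= B by exact: KB.
have L0 : lemniscate p (z i0) by exact: lemniscate_root.
have -> : nb_components p = counting ((fun k : nat => C) @` `I_1).
  congr counting; apply/seteqP; split => [_ [w Lw <-]|_ [k _ <-]]; last by exists (z i0).
  exists 0%N => //; have [i <-] := component_has_root zB Lw.
  apply: same_connected_component; apply: closure_component => //.
  - exact: open_lemniscate.
  - exact: lemniscate_root.
  - exact: K_sub_closure.
apply: counting_injective => k l; rewrite !inE /=; lia.
Qed.

End OneDiameter.
End ConnectedLemniscate.

(** * Many components when the diameter exceeds 1 *)

Section FactorialBounds.
Local Open Scope nat_scope.

Lemma bin_le_exp2 n m : 'C(n, m) <= 2 ^ n.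
Proof.
have [mn|nm] := leqP m n; last by rewrite bin_small.
rewrite -[2]/(1 + 1) expnDn (bigD1 (inord m : 'I_n.+1)) //= inordK ?ltnS //.
by rewrite !exp1n !muln1 leq_addr.
Qed.

(** The falling factorial [2k (2k - 1) ... (k + 1)] lies between [k ^ k] and
    [binomial(2k, k) k!]. *)
Lemma expnn_le_fact k : k ^ k <= 4 ^ k * k`!.
Proof.
have h : k ^ k <= (k.*2) ^_ k.
  rewrite ffact_prod -[X in _ ^ X <= _]card_ord -prod_nat_const.
  by apply: leq_prod => i _; have := ltn_ord i; lia.
apply: (leq_trans h); rewrite -bin_ffact leq_mul2r; apply/orP; right.
by rewrite (leq_trans (bin_le_exp2 _ _)) // -mul2n expnM.
Qed.

(** The distance of [i] and [j], except that it is 1 when they are equal: a point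
    of a small circle around the [j]-th of several equally spaced points is about
    as far from the centre as half of the spacing. *)
Definition gap (i j : nat) : nat := (i - j) + (j - i) + (i == j).

Lemma prod_gap k j : j < k -> \prod_(i < k) gap i j = j`! * (k.-1 - j)`!.
Proof.
move=> jk; rewrite -(big_mkord predT (fun i => gap i j)) (big_cat_nat _ (n := j)) //=; last exact: ltnW.
rewrite (big_ltn jk) {2}/gap subnn eqxx mul1n; congr (_ * _).
  rewrite big_mkord -ffactnn ffact_prod; apply: eq_bigr => i _.
  by have := ltn_ord i; rewrite /gap; lia.
have -> : k = (k.-1 - j) + j.+1 by lia.
rewrite -{1}[j.+1]add0n big_addn addnK fact_prod big_add1 /=.
have -> : (k.-1 - j + j.+1).-1 - j = k.-1 - j by lia.
by apply: eq_big_nat => i _; rewrite /gap; lia.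
Qed.

(** The product is [k!] divided by [k * binomial(k - 1, j)], which is at most
    [4 ^ k]. *)
Lemma expnn_le_gap k j : j < k -> k ^ k <= 16 ^ k * \prod_(i < k) gap i j.
Proof.
move=> jk; rewrite prod_gap //; apply: (leq_trans (expnn_le_fact k)).
have k0 : 0 < k by lia.
have kE : k`! = k * k.-1`! by rewrite -{1 2}(prednK k0) factS.
have jk1 : j <= k.-1 by lia.
have := bin_fact jk1; have := bin_le_exp2 k.-1 j.
set c := 'C(_, _); set x := j`! * _ => cb cx.
rewrite kE -cx (_ : 16 = 4 * 4) // expnMn -!mulnA leq_mul2l; apply/orP; right.
rewrite mulnA leq_mul2r; apply/orP; right.
apply: (@leq_trans (2 ^ k * 2 ^ k)); last by rewrite -expnMn.
rewrite leq_mul //; first exact/ltnW/ltn_expl.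
by apply: (leq_trans cb); rewrite leq_exp2l // leq_pred.
Qed.

End FactorialBounds.

Section ManyComponents.
Variable R : realType.

Lemma counting_le (T : choiceType) (A B : set T) :
  A `<=` B -> (@counting T R A <= counting B)%E.
Proof.
move=> AB; rewrite /counting; case: asboolP => fA; case: asboolP => fB; rewrite ?leey //.
  by rewrite lee_fin ler_nat finmap.fsubset_leq_card // -fset_set_sub.
by exfalso; apply: fA; exact: sub_finite_set fB.
Qed.

Variables (K : set (complexes R)) (a b : complexes R).
Hypotheses (cK : connected K) (Ka : K a) (Kb : K b).
Hypothesis ab1 : 1 < modulus (a - b).

(* Points at distance at most [s] from [b], and circles around them of radius at
   most [s], stay at distance at least [1 + 2 s] from [a]. *)
Let s : R := (modulus (a - b) - 1) / 4.
Let s0 : 0 < s. Proof. by rewrite divr_gt0 // subr_gt0. Qed.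

(** By connectedness the distance to [b] takes on [K] all values up to
    [|a - b|]. *)
Lemma spaced_points k : exists z : nat -> complexes R, forall j, (j < k)%N ->
  K (z j) /\ modulus (z j - b) = s * j.+1%:R / k%:R.
Proof.
suff /choice[z hz] : forall j, exists z, (j < k)%N ->
    K z /\ modulus (z - b) = s * j.+1%:R / k%:R by exists z.
move=> j.
have [jk|_] := ltnP j k; last by exists 0.
have k0 : 0 < k%:R :> R by rewrite ltr0n; exact: leq_ltn_trans jk.
have cf : continuous (fun z : complexes R => modulus (z - b)).
  apply: continuous_lip1 => u v; rewrite ler_norml.
  have := modulusB_le u v b; have := modulusB_le v u b; rewrite (modulusBC v u) => *.
  by apply/andP; split; lra.
have [|z Kz zj] := @connected_image_itv R K cK _ b a (s * j.+1%:R / k%:R) cf Kb Ka.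
  rewrite subrr modulus0; apply/andP; split.
    by apply: divr_ge0; [apply: mulr_ge0; [exact: ltW|]|exact: ltW].
  rewrite ler_pdivrMr //; apply: (@le_trans _ _ (s * k%:R)).
    by rewrite ler_wpM2l ?(ltW s0) // ler_nat.
  rewrite ler_wpM2r ?(ltW k0) //; have := ab1; rewrite /s; lra.
by exists z.
Qed.

Section Lemniscate.
Variables (n k q : nat) (zb : nat -> complexes R).
Hypothesis zbP : forall j, (j < k)%N -> K (zb j) /\ modulus (zb j - b) = s * j.+1%:R / k%:R.
Hypothesis qk : (k * q.+1 <= n)%N.
Hypothesis hq : 32 / s <= (1 + 2 * s) ^+ q.

Let z (i : 'I_n) : complexes R := if (i < k)%N then zb i else a.
Let p : {poly complexes R} := \prod_(i < n) ('X - (z i)%:P).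

Lemma modulus_split v : modulus p.[v] =
  (\prod_(i < k) modulus (v - zb i)) * modulus (v - a) ^+ (n - k).
Proof.
have kn : (k <= n)%N by apply: leq_trans qk; rewrite leq_pmulr.
rewrite modulus_prod_XsubC (bigID (fun i : 'I_n => (i < k)%N)) /=; congr (_ * _).
  rewrite (big_ord_widen n (fun i => modulus (v - zb i)) kn).
  by apply: eq_bigr => i ik; rewrite /z ik.
rewrite (eq_bigr (fun=> modulus (v - a))); last by move=> i /negbTE ik; rewrite /z ik.
rewrite prodr_const; congr (_ ^+ _).
rewrite -[in RHS](card_ord n) -(cardC (fun i : 'I_n => (i < k)%N)).
have -> : #|[pred i : 'I_n | (i < k)%N]| = k.
  rewrite -sum1_card -(big_ord_widen n (fun=> 1%N) kn) sum1_card card_ord //.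
by rewrite addKn; apply: eq_card => i; rewrite !inE.
Qed.

Lemma spaced i j : (i < k)%N -> (j < k)%N -> i != j ->
  s / k%:R * (gap i j)%:R <= modulus (zb i - zb j).
Proof.
move=> ik jk ij; have [_ zi] := zbP ik; have [_ zj] := zbP jk.
have h1 := modulusB_le (zb i) (zb j) b; have h2 := modulusB_le (zb j) (zb i) b.
rewrite (modulusBC (zb j) (zb i)) zi zj in h2; rewrite zi zj in h1.
rewrite /gap (negbTE ij) addn0; case: (ltngtP i j) ij => // lt _.
  have -> : (i - j + (j - i) = j - i)%N by lia.
  rewrite natrB ?(ltnW lt) //; move: h2; rewrite -!natr1; lra.
have -> : (i - j + (j - i) = i - j)%N by lia.
rewrite natrB ?(ltnW lt) //; move: h1; rewrite -!natr1; lra.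
Qed.

(** On the circle the [k] factors near [b] are at least [(s / 32) ^ k], by
    [expnn_le_gap], and the distance to [a] is at least [1 + 2 s]; by the choice
    of [q], already [q] factors of the latter kind per factor of the former
    suffice. *)
Lemma large_on_circle j v : (j < k)%N -> modulus (v - zb j) = s / (2 * k%:R) ->
  1 <= modulus p.[v].
Proof.
move=> jk vj; have k0 : 0 < k%:R :> R by rewrite ltr0n; exact: leq_ltn_trans jk.
have k1 : 1 <= k%:R :> R by rewrite ler1n; exact: leq_ltn_trans jk.
set t := s / (2 * k%:R) in vj; have t0 : 0 < t by rewrite divr_gt0 // mulr_gt0.
have ts : t <= s by rewrite ler_pdivrMr ?mulr_gt0 // ler_peMr ?(ltW s0) //; lra.
have tE : s / k%:R = 2 * t by rewrite /t; field; rewrite gt_eqF.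
have near i : (i < k)%N -> t * (gap i j)%:R <= modulus (v - zb i).
  move=> ik; have [->|ij] := eqVneq i j.
    by rewrite vj /gap !subnn eqxx mulr1.
  have g1 : 1 <= (gap i j)%:R :> R by rewrite ler1n /gap (negbTE ij); move: ij; lia.
  have := spaced ik jk ij; rewrite tE; have := modulusB_le (zb i) v (zb j).
  rewrite vj (modulusBC (zb i) v).
  have : t <= t * (gap i j)%:R by rewrite ler_peMr // ltW.
  lra.
have va : 1 + 2 * s <= modulus (v - a).
  have [_ zj] := zbP jk.
  have zs : modulus (zb j - b) <= s.
    by rewrite zj ler_pdivrMr // ler_wpM2l ?(ltW s0) // ler_nat.
  have := modulusB_le a v b; have := modulusB_le v (zb j) b; rewrite vj (modulusBC a v).
  have : modulus (a - b) = 1 + 4 * s by rewrite /s; lra.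
  lra.
have lowb : (s / 32) ^+ k <= \prod_(i < k) modulus (v - zb i).
  apply: (@le_trans _ _ (\prod_(i < k) (t * (gap i j)%:R))); last first.
    by apply: ler_prod => i _; rewrite near // andbT mulr_ge0 // ltW.
  rewrite big_split /= prodr_const card_ord -natr_prod.
  have := expnn_le_gap jk; rewrite -(ler_nat R) natrM !natrX => h.
  (* The factor 16 is the one of [expnn_le_gap]. *)
  have -> : t = s / 32 * (16 / k%:R) by rewrite /t; field; rewrite gt_eqF.
  rewrite [(s / 32 * _) ^+ k]exprMn -mulrA; apply: ler_peMr.
    by apply: exprn_ge0; apply: divr_ge0 => //; exact: ltW.
  by rewrite [(16 / _) ^+ k]exprMn exprVn mulrAC ler_pdivlMr ?exprn_gt0 // mul1r.
have sp0 : 0 < s / 32 by rewrite divr_gt0.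
have one : 1 <= (s / 32) * (1 + 2 * s) ^+ q.
  by rewrite -ler_pdivrMl // mulr1 invf_div.
rewrite modulus_split; apply: (@le_trans _ _ ((s / 32) ^+ k * (1 + 2 * s) ^+ (n - k))).
  have e1 : 1 <= 1 + 2 * s by have := s0; lra.
  apply: (@le_trans _ _ ((s / 32) ^+ k * (1 + 2 * s) ^+ (q * k))).
    by rewrite exprM -exprMn exprn_ege1.
  rewrite ler_wpM2l ?exprn_ge0 ?(ltW sp0) // ler_weXn2l //.
  rewrite leq_subRL; first by rewrite mulnC -mulnS.
  by apply: leq_trans qk; rewrite leq_pmulr.
apply: ler_pM => //; rewrite ?exprn_ge0 ?(ltW sp0) //.
- by have := s0; lra.
- by apply: lerXn2r; rewrite ?nnegrE ?modulus_ge0 //; have := s0; lra.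
Qed.

(** A component containing two of the points would meet the circle around one of
    them, which does not meet the lemniscate. *)
Lemma many_components : (k%:R%:E <= nb_components p)%E.
Proof.
have kn : (k <= n)%N by apply: leq_trans qk; rewrite leq_pmulr.
pose f j := connected_component (lemniscate p) (zb j).
have Lz j : (j < k)%N -> lemniscate p (zb j).
  move=> jk; have := lemniscate_root z (Ordinal (leq_trans jk kn)).
  by rewrite {2}/z /= jk.
rewrite -(@counting_injective _ _ f k).
  apply: counting_le => _ [j /= jk <-]; exists (zb j) => //; exact: Lz.
move=> i j /set_mem /= ik /set_mem /= jk fij; apply/eqP; apply: contraT => ij.
have Ci : f i (zb i) by apply: connected_component_refl; exact: Lz.
have Cj : f i (zb j) by rewrite fij; apply: connected_component_refl; exact: Lz.
have k0 : 0 < k%:R :> R by rewrite ltr0n; exact: leq_ltn_trans jk.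
have cf : continuous (fun z : complexes R => modulus (z - zb i)).
  apply: continuous_lip1 => u v; rewrite ler_norml.
  have := modulusB_le u v (zb i); have := modulusB_le v u (zb i); rewrite (modulusBC v u) => *.
  by apply/andP; split; lra.
have [||v Cv vi] := @connected_image_itv R (f i) _ _ (zb i) (zb j) (s / (2 * k%:R)) cf Ci Cj.
- exact: component_connected.
- rewrite subrr modulus0; apply/andP; split.
    by apply: divr_ge0; [exact: ltW|apply: mulr_ge0 => //; exact: ltW].
  apply: (@le_trans _ _ (s / k%:R * (gap j i)%:R)); last by apply: spaced => //; rewrite eq_sym.
  have g1 : 1 <= (gap j i)%:R :> R by rewrite ler1n /gap; move: ij; lia.
  apply: (@le_trans _ _ (s / k%:R)); last by rewrite ler_peMr // divr_ge0 // ltW.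
  by rewrite ler_wpM2l ?(ltW s0) // lef_pV2 ?posrE ?mulr_gt0 // ler_peMl ?(ltW k0) // ler1n.
have := large_on_circle ik vi.
have := connected_component_sub Cv; rewrite lemniscateE ltNge => /negP; contradiction.
Qed.

Lemma many_components_zeros : monic_with_zeros_in n K p.
Proof.
exists z => // i; rewrite /z; case: ifP => // ik.
by have [] := zbP ik.
Qed.

End Lemniscate.

(** With [q] fixed by [s], degree [n] leaves room for [k = n / (q + 1)] spaced
    points. *)
Lemma liminf_ratio_gt0_diam : (0 < liminf_ratio K)%E.
Proof.
have [q hq] : exists q : nat, 32 / s <= (1 + 2 * s) ^+ q.
  have h : 0 <= (1 + 2 * s)^-1 < 1.
    have := s0 => ?; rewrite invr_ge0 invf_lt1; lra.
  have e0 : 0 < (32 / s)^-1 by rewrite invr_gt0 divr_gt0.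
  have [q hq] := expr_lt_eventually h e0; exists q.
  have e1 : 0 < 1 + 2 * s by have := s0; lra.
  have e2 : 0 < 32 / s by rewrite divr_gt0.
  have := hq q (leqnn _); rewrite exprVn ltf_pV2 ?posrE ?exprn_gt0 //; exact: ltW.
apply: (@lt_le_trans _ _ ((2 * q.+1)%N%:R^-1)%:E).
  by rewrite lte_fin invr_gt0 ltr0n.
apply: (@limn_einf_ge _ _ _ q.+1) => n qn.
pose k := (n %/ q.+1)%N.
have k0 : (0 < k)%N by rewrite divn_gt0.
have [zb zbP] := spaced_points k.
have kq : (k * q.+1 <= n)%N by exact: leq_divM.
have nk : (n <= k * (2 * q.+1))%N.
  have := divn_eq n q.+1; have := ltn_pmod n (ltn0Sn q); rewrite -/k; nia.
have := many_components zbP kq hq; set p := (\prod_(i < n) _)%R => hp.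
have Kp : monic_with_zeros_in n K p by exact: many_components_zeros.
rewrite /component_ratio.
apply: (@le_trans _ _ (k%:R%:E * (n%:R^-1)%:E)%E).
  rewrite -EFinM lee_fin ler_pdivlMr ?ltr0n ?(leq_trans _ qn) //.
  by rewrite ler_pdivrMl ?ltr0n // -natrM ler_nat mulnC.
apply: lee_wpmul2r; first by rewrite lee_fin invr_ge0.
by apply: (le_trans hp); apply: ereal_sup_ubound; exists p.
Qed.

End ManyComponents.

(** * The three parts of the theorem *)

Section ConnectedSets.
Variable R : realType.

Lemma connected_closure_jordan (D : set (complexes R)) :
  bounded_jordan_domain D -> connected (closure D).
Proof.
move=> [J [_ [x _ <-] _]]; apply: connected_closure; exact: component_connected.
Qed.

(** The difference quotients are bounded near each point. *)
Lemma has_derivative_continuous (A : set R) (f f' : R -> complexes R) :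
  has_derivative_on A f f' -> {within A, continuous f}.
Proof.
move=> df; apply/subspace_continuousP => t At V /nbhs_complexP[e e0 eV].
have /(_ (disc (f' t) 1)) := df t At.
case; first by apply: nbhs_disc; exact: ltr01.
move=> d /= d0 hd.
pose M := modulus (f' t) + 1.
have M0 : 0 < M by rewrite ltr_wpDl ?modulus_ge0.
exists (Num.min d (e / M)) => /=; first by rewrite lt_min d0 divr_gt0.
move=> s /= ts As; apply: eV; have [->|st] := eqVneq s t.
  by rewrite subrr modulus0.
move: ts; rewrite lt_min => /andP[td te].
have := hd s td st As; rewrite /disc /= => q1.
have st0 : ofreal (s - t) != 0 by rewrite -modulus_gt0 modulus_ofreal normr_gt0 subr_eq0.
have -> : f t - f s = - ((f s - f t) / ofreal (s - t) * ofreal (s - t)) by rewrite divfK // opprB.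
rewrite modulusN modulusM modulus_ofreal distrC.
apply: (@le_lt_trans _ _ (M * `|t - s|)); last by rewrite mulrC -ltr_pdivlMr.
rewrite ler_wpM2r //; set x := _ / _ in q1 *.
have := modulusB_le x (f' t) 0; rewrite !subr0 /M (modulusBC x); lra.
Qed.

Lemma connected_C2_arc (K : set (complexes R)) : C2_jordan_arc K -> connected K.
Proof.
move=> [g [g1 [g2 [[dg _ _] [_ _ ->]]]]].
apply: connected_continuous_connected; first exact: segment_connected.
exact: has_derivative_continuous dg.
Qed.

End ConnectedSets.

Section ThreeParts.
Variable R : realType.
Variable K : set (complexes R).
Hypothesis cK : compact K.

(** For [C] between the capacity and 1, [log_capacity_ge] leaves only finitely
    many [n] for which some [n] points have a large product of distances. *)
Lemma limsup_ratio_lt1_capacity : (log_capacity K < 1)%E -> (0 < log_capacity K)%E ->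
  (limsup_ratio K < 1)%E.
Proof.
case E : (log_capacity K) => [c| |] //; rewrite !lte_fin => c1 c0.
pose C := (c + 1) / 2.
have C01 : 0 < C < 1 by rewrite /C; apply/andP; split; lra.
have [C0 _] := andP C01.
suff [N hN] : exists N : nat, forall n, (N <= n)%N -> forall z, (forall k, (k < n)%N -> K (z k)) ->
    pairprod z n <= C ^+ 'C(n, 2).
  exact: limsup_ratio_lt1_pairprod cK C01 hN.
apply: contrapT => /forallNP h.
have : (C%:E <= log_capacity K)%E.
  apply: log_capacity_ge => // N; apply: contrapT => nN; apply: (h N) => n Nn z Kz.
  rewrite leNgt; apply/negP => lt; apply: nN; exists n; split => //.
  by exists z; split => //; exact: ltW.
rewrite E lee_fin /C; lra.
Qed.

Lemma liminf_ratio_gt0_capacity : ((2^-1)%:E < log_capacity K)%E -> connected K ->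
  (0 < liminf_ratio K)%E.
Proof.
move=> hc con; have [a [b [Ka Kb ab]]] := diam_gt1 cK hc.
exact: liminf_ratio_gt0_diam con Ka Kb ab.
Qed.

(** If the diameter exceeded 1, [leja_points] would make the capacity exceed
    1/4. *)
Lemma max_components_eq1_capacity : (0 < log_capacity K)%E -> (log_capacity K <= (4^-1)%:E)%E ->
  connected K ->
  (forall n : nat, (1 <= n)%N -> max_components n K = 1%E) /\ liminf_ratio K = 0%E.
Proof.
move=> c0 c4 con.
have K1 v w : K v -> K w -> modulus (v - w) <= 1.
  move=> Kv Kw; rewrite leNgt; apply/negP => h.
  have wv : w != v by apply: contraTneq h => ->; rewrite subrr modulus0 ltNge ler01.
  have : ((modulus (v - w) / 4)%:E <= log_capacity K)%E.
    apply: log_capacity_ge => //; first by rewrite divr_gt0 // (lt_trans ltr01).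
    by move=> N; exists N; split => //; have := leja_points con Kw Kv wv N.
  move=> /le_trans/(_ c4); rewrite lee_fin; lra.
have [z0 Kz0] : exists z, K z.
  have [C C0 hC] : exists2 C : R, 0 < C & (C%:E < log_capacity K)%E.
    case: (log_capacity K) c0 => [c| |] //; last by exists 1; rewrite ?ltry.
    by rewrite lte_fin => h; exists (c / 2); rewrite ?lte_fin; lra.
  by have [z [Kz _]] := points_of_capacity 1 cK C0 hC; exists (z 0%N); exact: Kz.
have max1 n : (1 <= n)%N -> max_components n K = 1%E.
  move=> n1; rewrite /max_components (_ : [set _ | _ in _] = [set 1%E]) ?ereal_sup1 //.
  apply/seteqP; split => [_ [p [z Kz ->] <-]|_ ->].
    exact: (nb_components_eq1 (Ordinal n1) con Kz cK K1).
  exists (\prod_(j < n) ('X - (z0)%:P)); first by exists (fun=> z0).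
  exact: (nb_components_eq1 (z := fun=> z0) (Ordinal n1) con (fun=> Kz0) cK K1).
split => //; apply/eqP; rewrite eq_le; apply/andP; split; last first.
  apply: (@limn_einf_ge _ _ _ 1) => n n1.
  by rewrite /component_ratio max1 // mul1e lee_fin invr_ge0.
apply: (le_trans (limn_einf_sup _)); apply/lee_addgt0Pr => e e0; rewrite add0e.
apply: (@limn_esup_le _ _ _ (Num.truncn e^-1).+1) => n hn.
have n1 : (1 <= n)%N by apply: leq_trans hn.
rewrite /component_ratio max1 // mul1e lee_fin.
rewrite -[leRHS]invrK lef_pV2 ?posrE ?invr_gt0 ?ltr0n //.
by apply: ltW; apply: lt_le_trans (truncnS_gt _) _; rewrite ler_nat.
Qed.

End ThreeParts.

Theorem theorem2p1 (R : realType) (K : set (complexes R)) :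
  compact K -> (0 < log_capacity K < 1)%E ->
  [/\ (limsup_ratio K < 1)%E,
      ((2^-1)%:E < log_capacity K < 1)%E ->
        (exists2 D, bounded_jordan_domain D & K = closure D) \/
          C2_jordan_arc K ->
        (0 < liminf_ratio K)%E
    & (log_capacity K <= (4^-1)%:E)%E -> connected K ->
        (forall n : nat, (1 <= n)%N -> max_components n K = 1%E) /\
        liminf_ratio K = 0%E].
Proof.
move=> cK /andP[c0 c1]; split; first exact: limsup_ratio_lt1_capacity.
- move=> /andP[c2 _] hK; apply: liminf_ratio_gt0_capacity => //.
  by case: hK => [[D jD ->]|/connected_C2_arc //]; exact: connected_closure_jordan.
- exact: max_components_eq1_capacity.
Qed.
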